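(* Let $R>0$ and let $\mathbf{M}\in L^2(\mathbb{B}_R,\mathbb{R}^3)$ (extended by zero to $\mathbb{R}^3$) satisfy the Hardy condition $$\operatorname*{ess\,sup}_{0\le r<R}\int_{\mathbb{S}_r}|\mathbf{M}(y)|^2\,d\omega_r(y)<\infty .$$ Let $D=\nabla\cdot\mathbf{M}$ (distributional divergence on $\mathbb{R}^3$). Then there exists $\mathbf{m}\in L^2(\mathbb{S}_R,\mathbb{R}^3)$ such that $\hat D=\nabla\cdot(\mathbf{m}\otimes\delta_{\mathbb{S}_R})$ is the balayage of $D$ onto $\mathbb{S}_R$, that is, $p_{\hat D}(x)=p_D(x)$ for all $x\in\mathbb{R}^3\setminus\overline{\mathbb{B}_R}$.
   Context: $\mathbb{B}_R=\{x\in\mathbb{R}^3:|x|<R\}$, $\mathbb{S}_R=\{x\in\mathbb{R}^3:|x|=R\}$, $\omega_r$ is the surface area measure on $\mathbb{S}_r$. For a compactly supported distribution $D$ on $\mathbb{R}^3$, its potential is $p_D(x)=D\left(-\frac{1}{4\pi}\frac{1}{|x-\cdot|}\right)$ for $x\in\mathbb{R}^3\setminus\operatorname{supp}D$, where the function $y\mapsto -\frac1{4\pi|x-y|}$ is first multiplied by a smooth compactly supported cutoff equal to $1$ near $\operatorname{supp}D$ and $0$ near $x$ (the result does not depend on the cutoff). $\mathbf{m}\otimes\delta_{\mathbb{S}_R}$ denotes the $\mathbb{R}^3$-valued distribution $\boldsymbol\varphi\mapsto\int_{\mathbb{S}_R}\mathbf{m}\cdot\boldsymbol\varphi\,d\omega_R$,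 so that $p_{\hat D}(x)=\frac{1}{4\pi}\int_{\mathbb{S}_R}\mathbf{m}(y)\cdot\frac{x-y}{|x-y|^3}\,d\omega_R(y)$. The balayage onto $\mathbb{S}_R$ of a distribution $D$ supported in $\overline{\mathbb{B}_R}$ is a distribution $\hat D$ carried by $\mathbb{S}_R$ with $p_{\hat D}=p_D$ on $\mathbb{R}^3\setminus\overline{\mathbb{B}_R}$. *)

(* Defs.v *)
From HB Require Import structures.
From mathcomp Require Import all_boot all_order all_algebra.
From mathcomp Require Import all_classical all_reals all_analysis.
From mathcomp Require Import measurable_realfun ess_sup_inf.
Set Implicit Arguments.
Unset Strict Implicit.
Unset Printing Implicit Defensive.
Import Order.TTheory GRing.Theory Num.Theory.
Import numFieldNormedType.Exports.
Local Open Scope classical_set_scope.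
Local Open Scope ring_scope.

(* Euclidean space R^3 as a topological and normed space.  The library norm
   `|x| on this type is the sup norm; the Euclidean norm is [enorm] below. *)
Notation R3 R := (R * R * R)%type.

(* The same types with the Borel sigma-algebra on which the library defines the
   Lebesgue measure; [mR3 R] is convertible to [R3 R]. *)
Notation mR2 R := (measurableTypeR R * measurableTypeR R)%type.
Notation mR3 R := (mR2 R * measurableTypeR R)%type.

Notation lebesgue2 R := (@lebesgue_measure R \x @lebesgue_measure R)%E.
Notation lebesgue3 R :=
  ((@lebesgue_measure R \x @lebesgue_measure R) \x @lebesgue_measure R)%E.

Section euclidean.
Context {R : realType}.
Implicit Types (x y : R3 R) (i : 'I_3) (r : R).

Definition coord3 i x : R := tnth [tuple x.1.1; x.1.2; x.2] i.

Definition basis3 i : R3 R :=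
  ((i == 0 :> nat)%:R, (i == 1 :> nat)%:R, (i == 2 :> nat)%:R).

Definition dot x y : R := \sum_(i < 3) coord3 i x * coord3 i y.

Definition enorm x : R := Num.sqrt (dot x x).

Definition eball r : set (R3 R) := [set x | enorm x < r].
Definition ecball r : set (R3 R) := [set x | enorm x <= r].
Definition esphere r : set (R3 R) := [set x | enorm x = r].

End euclidean.

Section surface_measure.
Context {R : realType}.

(* t.1 is the polar angle and t.2 the azimuth; the area element of this
   parametrization of the sphere of radius r is r^2 sin t.1 dt.1 dt.2. *)
Definition spherical (r : R) (t : R * R) : R3 R :=
  (r * sin t.1 * cos t.2, r * sin t.1 * sin t.2, r * cos t.1).

Definition angles : set (mR2 R) :=
  `[0, pi]%classic `*` `[0, 2 * pi]%classic.

Definition surface (r : R) (A : set (mR3 R)) : \bar R :=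
  \int[lebesgue2 R]_(t in angles `&` spherical r @^-1` A)
    (r ^+ 2 * sin t.1)%:E.

Lemma measurable_angles : measurable angles.
Proof. by apply: measurableX; exact: measurable_itv. Qed.

Let measurable_sin1 : measurable_fun setT (fun t : mR2 R => sin t.1).
Proof.
apply: (measurableT_comp (f := @sin R)).
  by apply: continuous_measurable_fun; exact: continuous_sin.
exact: measurable_fst.
Qed.

Let measurable_trig (f g : R -> R) :
  continuous f -> continuous g -> forall r : R,
  measurable_fun setT (fun t : mR2 R => r * f t.1 * g t.2).
Proof.
move=> cf cg r; apply: measurable_funM.
- apply: measurable_funM; first exact: measurable_cst.
  apply: (measurableT_comp (f := f)); last exact: measurable_fst.
  exact: continuous_measurable_fun.
- apply: (measurableT_comp (f := g)); last exact: measurable_snd.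
  exact: continuous_measurable_fun.
Qed.

Lemma measurable_spherical r : measurable_fun setT (spherical r : mR2 R -> mR3 R).
Proof.
apply: measurable_fun_pair.
  apply: measurable_fun_pair.
  - by apply: measurable_trig; [exact: continuous_sin|exact: continuous_cos].
  - by apply: measurable_trig; exact: continuous_sin.
apply: measurable_funM; first exact: measurable_cst.
apply: (measurableT_comp (f := @cos R)); last exact: measurable_fst.
by apply: continuous_measurable_fun; exact: continuous_cos.
Qed.

Variable r : R.

Let surface0 : surface r set0 = 0%E.
Proof. by rewrite /surface preimage_set0 setI0 integral_set0. Qed.

Let surface_ge0 A : (0 <= surface r A)%E.
Proof.
apply: integral_ge0 => t [[/= t1 _] _].
by rewrite lee_fin mulr_ge0 ?sqr_ge0// sin_ge0_pi.
Qed.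

Let surface_sigma_additive : semi_sigma_additive (surface r).
Proof.
move=> F mF tF mUF; rewrite /surface preimage_bigcup setI_bigcupr.
have mG n : measurable (angles `&` spherical r @^-1` F n).
  apply: measurableI; first exact: measurable_angles.
  by rewrite -[X in measurable X]setTI; exact: measurable_spherical.
have ge0 t : angles t -> (0 <= (r ^+ 2 * sin t.1)%:E)%E.
  by move=> [/= t1 _]; rewrite lee_fin mulr_ge0 ?sqr_ge0// sin_ge0_pi.
rewrite ge0_integral_bigcup//=; last 3 first.
- apply/measurable_EFinP/measurable_funM; first exact: measurable_cst.
  exact: measurable_funTS.
- by move=> t [n _ [? _]]; exact: ge0.
- apply/trivIsetP => i j _ _ ij.
  rewrite setIACA setIid -preimage_setI.
  by move/trivIsetP : tF => /(_ _ _ I I ij) ->; rewrite preimage_set0 setI0.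
by apply: is_cvg_ereal_nneg_natsum_cond => n _ _; exact: surface_ge0.
Qed.

HB.instance Definition _ := isMeasure.Build _ _ _ (surface r)
  surface0 surface_ge0 surface_sigma_additive.

End surface_measure.

Section L2.
Context {R : realType}.

Definition L2_field (mu : {measure set (mR3 R) -> \bar R}) (F : R3 R -> R3 R) :=
  forall i : 'I_3, (fun x : mR3 R => coord3 i (F x)) \in Lfun mu 2%:E.

Definition hardy_bounded (r : R) (M : R3 R -> R3 R) : Prop :=
  (ess_sup (mrestr lebesgue_measure (measurable_itv `[0%R, r[))
    (fun s => \int[surface s]_(y in esphere s) ((enorm (M y)) ^+ 2)%:E)
   < +oo)%E.

End L2.

Section distributions.
Context {R : realType}.
Implicit Types (phi chi : R3 R -> R) (D : (R3 R -> R) -> R).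

(* A multi-index is given by the sequence of its successive directions. *)
Definition mpartial (s : seq 'I_3) phi : R3 R -> R :=
  foldr (fun i f x => 'D_(basis3 i) f x) phi s.

Definition smooth phi := forall s : seq 'I_3,
  continuous (mpartial s phi) /\
  forall (i : 'I_3) x, derivable (mpartial s phi) x (basis3 i).

Definition fsupp phi : set (R3 R) := closure [set x | phi x != 0].

Definition test_function phi := smooth phi /\ compact (fsupp phi).

Definition grad phi (x : R3 R) : R3 R :=
  ('D_(basis3 0) phi x, 'D_(basis3 1) phi x, 'D_(basis3 2%:R) phi x).

(* A functional is total on functions, but only its values on test functions
   are meaningful.  The second clause is the usual seminorm estimate
   |D phi| <= C max_{|s| <= N} sup |d^s phi| on each compact set. *)
Definition is_distribution D :=
  (forall (a : R) phi psi, test_function phi -> test_function psi ->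
     D (fun x => a * phi x + psi x) = a * D phi + D psi) /\
  (forall K : set (R3 R), compact K ->
     exists (C : R) (N : nat), forall phi (b : R),
       test_function phi -> fsupp phi `<=` K ->
       (forall s : seq 'I_3, (size s <= N)%N ->
          forall x, `|mpartial s phi x| <= b) ->
       `|D phi| <= C * b).

Definition vanishes_on D (U : set (R3 R)) :=
  forall phi, test_function phi -> fsupp phi `<=` U -> D phi = 0.

Definition dsupp D : set (R3 R) :=
  ~` \bigcup_(U in [set U | open U /\ vanishes_on D U]) U.

(* R^3-valued distributions act on vector fields. *)
Definition field_distribution (M Phi : R3 R -> R3 R) : R :=
  \int[lebesgue3 R]_x dot (M x) (Phi x).

Definition sphere_distribution (r : R) (m Phi : R3 R -> R3 R) : R :=
  \int[surface r]_(y in esphere r) dot (m y) (Phi y).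

Definition divergence (T : (R3 R -> R3 R) -> R) : (R3 R -> R) -> R :=
  fun phi => - T (grad phi).

(* At y = x the value is 0 (inverse of 0); it is always cut off there. *)
Definition newton (x y : R3 R) : R := - (4 * pi)^-1 * (enorm (x - y))^-1.

Definition is_cutoff D (x : R3 R) chi :=
  [/\ test_function chi,
      forall z, dsupp D z -> \forall y \near z, chi y = 1
    & \forall y \near x, chi y = 0].

(* The common value of D (chi * newton x) over all cutoffs chi. *)
Definition potential D (x : R3 R) : R :=
  xget 0 [set v | exists2 chi, is_cutoff D x chi
                & v = D (fun y => chi y * newton x y)].

Definition is_balayage (r : R) D Dhat :=
  [/\ is_distribution D /\ dsupp D `<=` ecball r,
      is_distribution Dhat /\ dsupp Dhat `<=` esphere r
    & forall x, ~ ecball r x -> potential Dhat x = potential D x].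

End distributions.

(* Main.v *)
(* Duality.  The exterior potentials of div M and of div (m delta_S) at x are
   integrals of M, resp. m, against the gradient of the kernel 1/|x - .|, so m
   must represent on the sphere S the functional u |-> int_B M.u, where u ranges
   over the finite combinations of these gradients for |x| > r.  By
   Cauchy-Schwarz and the Riesz representation theorem it is enough to bound
   int_B |u|^2 by a multiple of int_S |u|^2.  Since the Jacobian of u is symmetric
   with zero trace, div (|u|^2 x - 2 (x.u) u) = |u|^2, whence
   int_B |u|^2 = r int_S |u|^2 - 2/r int_S (x.u)^2 <= r int_S |u|^2. *)
Require Import Defs.
From HB Require Import structures.
From mathcomp Require Import all_boot all_order all_algebra.
From mathcomp Require Import all_classical all_reals all_analysis.
From mathcomp Require Import measurable_realfun ring lra.
Set Implicit Arguments.
Unset Strict Implicit.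
Unset Printing Implicit Defensive.
Import Order.TTheory GRing.Theory Num.Theory.
Import numFieldNormedType.Exports.
Local Open Scope classical_set_scope.
Local Open Scope ring_scope.

(** * Change of variables *)

(** The divergence identity is integrated on the box of spherical coordinates, where it reads
    [DA + DB + DC = s^2 sin t |u|^2]. Each term is a derivative in one variable, so the
    one-dimensional fundamental theorem suffices: [B] dies at the poles through sin t, [C] by
    periodicity, [A] at the centre through s^3, and only the sphere contributes. Two obstacles shape
    the rest. The three terms have no sign, while Tonelli is applied to nonnegative functions only:
    each term is shifted by a constant that makes it nonnegative on the compact box, and the finite
    total shift is cancelled at the end. The span of the gradients is not complete: the representing
    field is a pointwise limit of almost-minimizers of an energy, taken to precision 16^-n so that
    the squared increments remain summable with weight 4^n. The gradients are truncated to the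
    closed ball, so that the same functions lie in both L^2 spaces despite their poles. *)

Section weighted_pushforward.
Local Open Scope ereal_scope.
Context d1 d2 (X : measurableType d1) (Y : measurableType d2) (R : realType).
Variables (mu : {measure set X -> \bar R}) (phi : X -> Y) (w : X -> R)
  (E : set X).
Hypotheses (mphi : measurable_fun setT phi) (mw : measurable_fun setT w)
  (mE : measurable E) (w0 : forall x, E x -> (0 <= w x)%R).

Let mphiI A : measurable A -> measurable (E `&` phi @^-1` A).
Proof. by move=> mA; apply: measurableI => //; rewrite -[X in measurable X]setTI; exact: mphi. Qed.

Let mEw D : measurable D -> measurable_fun D (EFin \o w).
Proof. by move=> mD; apply/measurable_EFinP; exact: measurable_funTS. Qed.

Lemma weighted_pushforward_measure : exists nu : {measure set Y -> \bar R},
  forall A, nu A = \int[mu]_(x in E `&` phi @^-1` A) (w x)%:E.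
Proof.
pose nu A := \int[mu]_(x in E `&` phi @^-1` A) (w x)%:E.
have nu0 : nu set0 = 0 by rewrite /nu preimage_set0 setI0 integral_set0.
have nu_ge0 A : 0 <= nu A by apply: integral_ge0 => x [Ex _]; rewrite lee_fin w0.
have nu_sigma : semi_sigma_additive nu.
  move=> F mF tF mUF; rewrite /nu preimage_bigcup setI_bigcupr.
  rewrite ge0_integral_bigcup//=; last 4 first.
  - by move=> k; exact: mphiI.
  - by apply: mEw; apply: bigcup_measurable => k _; exact: mphiI.
  - by move=> x [n _ [Ex _]]; rewrite lee_fin w0.
  - apply/trivIsetP => i j _ _ ij.
    rewrite setIACA setIid -preimage_setI.
    by move/trivIsetP : tF => /(_ _ _ I I ij) ->; rewrite preimage_set0 setI0.
  by apply: is_cvg_ereal_nneg_natsum_cond => n _ _; exact: nu_ge0.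
pose m := isMeasure.Build _ _ _ nu nu0 nu_ge0 nu_sigma.
pose M : {measure set Y -> \bar R} := HB.pack nu m.
by exists M.
Qed.

Import HBNNSimple.
Variable nu : {measure set Y -> \bar R}.
Hypothesis nuE : forall A, measurable A ->
  nu A = \int[mu]_(x in E `&` phi @^-1` A) (w x)%:E.

(** Both sides agree on indicators by [nuE], hence on simple functions, and pass to increasing
    limits. The measure [nu] is known only through its values, so the lemma serves Lebesgue measure
    itself (change of variables) as well as [surface r]. *)
Lemma ge0_integral_weighted_pushforward (f : Y -> \bar R) :
  measurable_fun setT f -> (forall y, 0 <= f y) ->
  \int[nu]_y f y = \int[mu]_(x in E) (f (phi x) * (w x)%:E).
Proof.
move=> mf f0.
pose f_ := nnsfun_approx measurableT mf.
transitivity (limn (fun n => \int[nu]_x (f_ n x)%:E)).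
  rewrite -monotone_convergence//.
  - apply: eq_integral => y _; apply/esym/cvg_lim => //.
    by apply: cvg_nnsfun_approx=> // *; apply: f0; rewrite inE.
  - by move=> n; exact/measurable_EFinP/measurable_funP.
  - by move=> n y _; rewrite lee_fin.
  - by move=> y _ m n mn; rewrite lee_fin; exact/lefP/nd_nnsfun_approx.
rewrite [X in limn X](_ : _ =
    (fun n => \int[mu]_(x in E) ((f_ n (phi x))%:E * (w x)%:E))).
  rewrite -monotone_convergence//; last 3 first.
  - move=> n; apply: emeasurable_funM; last exact: mEw.
    by apply/measurable_EFinP; apply: measurable_funTS; apply: measurableT_comp.
  - by move=> n x Ex; rewrite mule_ge0 ?lee_fin// w0.
  - move=> x Ex m n mn; apply: lee_wpmul2r; first by rewrite lee_fin w0.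
    by rewrite lee_fin; exact/lefP/nd_nnsfun_approx.
  apply: eq_integral => x /[!inE] Ex /=; apply/cvg_lim => //.
  apply: cvgeZr => //; apply: cvg_nnsfun_approx=> //.
apply/funext => n.
have mS k : measurable (f_ n @^-1` [set k]) by [].
have mind k : measurable_fun setT (fun x => \1_(f_ n @^-1` [set k]) (phi x) : R).
  apply: (@measurable_indic _ X R setT (phi @^-1` (f_ n @^-1` [set k]))).
  by rewrite -[X in measurable X]setTI; exact: mphi.
transitivity (\sum_(k \in range (f_ n)) (k%:E * nu (f_ n @^-1` [set k]))).
  under eq_integral do rewrite fimfunE -fsumEFin//.
  rewrite ge0_integral_fsum//; last 2 first.
  - by move=> y; exact/measurable_EFinP/measurable_funM.
  - by move=> y x _; rewrite nnfun_muleindic_ge0.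
  apply: eq_fsbigr => r _; rewrite integralZl_indic_nnsfun//.
  by rewrite integral_indic ?setIT.
rewrite [RHS](_ : _ = \int[mu]_(x in E) \sum_(k \in range (f_ n))
     ((k * \1_(f_ n @^-1` [set k]) (phi x))%:E * (w x)%:E)); last first.
  apply: eq_integral => x _; rewrite [in LHS]fimfunE -fsumEFin//.
  by rewrite ge0_mule_fsuml// => i; rewrite nnfun_muleindic_ge0.
rewrite ge0_integral_fsum//; last 2 first.
- move=> k; apply: emeasurable_funM; last exact: mEw.
  apply/measurable_EFinP/measurable_funM => //; apply: measurable_funTS.
  by exact: mind.
- move=> k x Ex; apply: mule_ge0; last by rewrite lee_fin w0.
  by rewrite EFinM; exact: nnfun_muleindic_ge0.
apply: eq_fsbigr => k /set_mem [y _ fyk].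
have k0 : (0 <= k)%R by rewrite -fyk; exact: fun_ge0.
rewrite nuE//.
under [RHS]eq_integral do rewrite EFinM -muleA.
rewrite ge0_integralZl//; last 2 first.
- apply: emeasurable_funM; last exact: mEw.
  apply/measurable_EFinP; apply: measurable_funTS.
  by exact: mind.
- by move=> x Ex; rewrite mule_ge0// lee_fin ?w0.
congr (_ * _); rewrite integral_mkcondr; apply: eq_integral => x _.
rewrite patchE indicE; rewrite -[phi x \in _]/(x \in phi @^-1` (f_ n @^-1` [set k])).
by case: ifPn => _; rewrite ?mul1e ?mul0e.
Qed.

End weighted_pushforward.

(** * Tonelli on rectangles *)

Section tonelli.
Local Open Scope ereal_scope.
Context d1 d2 (X : measurableType d1) (Y : measurableType d2) (R : realType).
Variables (m1 : {sigma_finite_measure set X -> \bar R})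
  (m2 : {sigma_finite_measure set Y -> \bar R}).

Variables (A : set X) (B : set Y) (f : X * Y -> \bar R).
Hypotheses (mA : measurable A) (mB : measurable B) (mf : measurable_fun setT f)
  (f0 : forall x y, A x -> B y -> 0 <= f (x, y)).

(** The sign of [f] is controlled on the rectangle only; extension by zero makes it nonnegative
    everywhere. *)
Let g := f \_ (A `*` B).

Let mg : measurable_fun setT g.
Proof.
apply: (measurable_restrictT _ _).1; first exact: measurableX.
exact: measurable_funTS.
Qed.

Let g0 z : 0 <= g z.
Proof.
rewrite /g patchE; case: ifPn => // /set_mem; case: z => x y [/= ? ?].
exact: f0.
Qed.

Let gx : fubini_F m2 g = (fun x => \int[m2]_(y in B) f (x, y)) \_ A.
Proof.
apply/funext => x; rewrite patchE /fubini_F; case: ifPn => xA.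
  rewrite [RHS]integral_mkcond; apply: eq_integral => y _.
  by rewrite /g !patchE in_setX/= xA.
by rewrite integral0_eq// => y _; rewrite /g patchE in_setX/= (negbTE xA).
Qed.

Let gy : fubini_G m1 g = (fun y => \int[m1]_(x in A) f (x, y)) \_ B.
Proof.
apply/funext => y; rewrite patchE /fubini_G; case: ifPn => yB.
  rewrite [RHS]integral_mkcond; apply: eq_integral => x _.
  by rewrite /g !patchE in_setX/= yB andbT.
by rewrite integral0_eq// => x _; rewrite /g patchE in_setX/= (negbTE yB) andbF.
Qed.

Lemma ge0_integral_setX1 : \int[m1 \x m2]_(z in A `*` B) f z =
  \int[m1]_(x in A) \int[m2]_(y in B) f (x, y).
Proof.
rewrite integral_mkcond (@fubini_tonelli1 _ _ _ _ _ m1 m2 g mg g0) gx.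
by rewrite [RHS]integral_mkcond.
Qed.

Lemma ge0_integral_setX2 : \int[m1 \x m2]_(z in A `*` B) f z =
  \int[m2]_(y in B) \int[m1]_(x in A) f (x, y).
Proof.
rewrite integral_mkcond (@fubini_tonelli2 _ _ _ _ _ m1 m2 g mg g0) gy.
by rewrite [RHS]integral_mkcond.
Qed.

Lemma tonelli_in :
  \int[m1]_(x in A) \int[m2]_(y in B) f (x, y) =
  \int[m2]_(y in B) \int[m1]_(x in A) f (x, y).
Proof. by rewrite -ge0_integral_setX1 ge0_integral_setX2. Qed.

End tonelli.

Section lebesgue2_sigma_finite.
Context {R : realType}.

Lemma sigma_finite_lebesgue2 : sigma_finite setT (lebesgue2 R).
Proof.
pose I (n : nat) : set (measurableTypeR R) := `]- n%:R, n%:R[%classic.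
exists (fun n => I n `*` I n).
  apply/esym; rewrite -subTset => -[x y] _.
  exists (Num.bound (`|x| + `|y|)) => //.
  have h : `|x| + `|y| < (Num.bound (`|x| + `|y|))%:R.
    by apply: archi_boundP; rewrite addr_ge0.
  by split; rewrite /I /= in_itv/= -ltr_norml; apply: le_lt_trans h; rewrite ?lerDl ?lerDr.
move=> n; split; first by apply: measurableX; exact: measurable_itv.
have hI : (lebesgue_measure (I n) < +oo)%E.
  by rewrite /I lebesgue_measure_itv/=; case: ifPn => _; rewrite ?ltry// -EFinB ltry.
rewrite product_measure1E; [|exact: measurable_itv..].
by apply: lte_mul_pinfty => //; rewrite ge0_fin_numE.
Qed.

Definition sf_lebesgue1 : {sigma_finite_measure set (measurableTypeR R) -> \bar R} :=
  (@lebesgue_measure R).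

Definition sf_lebesgue2 : {sigma_finite_measure set (mR2 R) -> \bar R} :=
  HB.pack (lebesgue2 R) (Measure_isSigmaFinite.Build _ _ _ (lebesgue2 R) sigma_finite_lebesgue2).

End lebesgue2_sigma_finite.

Section substitution.
Context {R : realType}.
Local Notation mu := (@lebesgue_measure R).

Lemma FTC2_is_derive (F f : R -> R) (a b : R) : a <= b ->
  (forall x : R, a <= x <= b -> is_derive x 1 F (f x)) ->
  (forall x : R, a <= x <= b -> {for x, continuous f}) ->
  (\int[mu]_(x in `[a, b]) (f x)%:E = (F b - F a)%:E)%E.
Proof.
rewrite le_eqVlt => /predU1P[->|ab] dF cf.
  by rewrite set_itv1 integral_set1 subrr.
have cF (x : R) : a <= x <= b -> {for x, continuous F}.
  move=> /dF [dFx _]; exact/differentiable_continuous/derivable1_diffP.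
rewrite (@continuous_FTC2 _ f F)//.
- by apply: continuous_in_subspaceT => x /[!inE]/=; rewrite in_itv/=; exact: cf.
- split.
  + by move=> x /[!in_itv]/= /andP[/ltW ax /ltW xb]; case: (dF x _) => //; rewrite ax xb.
  + by apply: cvg_at_right_filter; apply: cF; rewrite lexx ltW.
  + by apply: cvg_at_left_filter; apply: cF; rewrite lexx ltW.
- move=> x /[!in_itv]/= /andP[/ltW ax /ltW xb]; rewrite derive1E.
  by apply: (@derive_val _ _ _ _ _ _ _ (dF x _)); rewrite ax xb.
Qed.

(** A measure that gives each half-open interval its length is Lebesgue measure, so it is enough to
    test the weighted image of [E] on intervals. Neither injectivity nor smoothness of [phi] has to
    be discussed. *)
Lemma ge0_integral_substitution (E : set R) (phi w : R -> R)
  (f : R -> \bar R) :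
  measurable E ->
  measurable_fun setT (phi : measurableTypeR R -> measurableTypeR R) ->
  measurable_fun setT w ->
  (forall x, E x -> 0 <= w x) ->
  (forall a b : R, a < b ->
    (\int[mu]_(x in E `&` phi @^-1` `]a, b]%classic) (w x)%:E = (b - a)%:E)%E) ->
  measurable_fun setT f -> (forall x, (0 <= f x)%E) ->
  (\int[mu]_x f x = \int[mu]_(x in E) (f (phi x) * (w x)%:E))%E.
Proof.
move=> mE mphi mw w0 H mf f0.
have [nu nuE] := @weighted_pushforward_measure _ _ _ (measurableTypeR R) R mu phi w E mphi mw mE w0.
have munu A : measurable A -> mu A = nu A.
  apply: lebesgue_measure_unique => _ [[a b]] _ <- /=.
  rewrite nuE lebesgue_measure_itv/= lte_fin.
  case: ltP => ab; first by rewrite H// EFinB.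
  by rewrite set_itv_ge ?preimage_set0 ?setI0 ?integral_set0// bnd_simp -leNgt.
apply: (ge0_integral_weighted_pushforward mphi mw mE w0) => //.
by move=> A mA; rewrite -nuE; exact: munu.
Qed.

Lemma measurable_inv : measurable_fun setT (@GRing.inv R).
Proof.
have -> : [set: R] = [set 0] `|` ~` [set 0] by rewrite setUv.
apply/measurable_funU => //; first exact: measurableC.
split; first exact: measurable_fun_set1.
apply: open_continuous_measurable_fun.
  by rewrite openC; exact: closed_eq.
by move=> x /[!inE] /eqP x0; exact: inv_continuous.
Qed.

Lemma ge0_integral_scale (s : R) (f : R -> \bar R) : 0 < s ->
  measurable_fun setT f -> (forall x, (0 <= f x)%E) ->
  (\int[mu]_x f x = \int[mu]_x (f (x * s)%R * s%:E))%E.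
Proof.
move=> s0 mf f0.
apply: (ge0_integral_substitution (phi := fun x => x * s) (w := cst s)) => //.
- by apply: measurable_funM.
- by move=> x _; exact: ltW.
move=> a b ab; rewrite setTI.
have -> : (fun x => x * s) @^-1` `]a, b]%classic = `]a / s, b / s]%classic.
  apply/seteqP; split => x /=; rewrite !in_itv/= ltr_pdivrMr// ler_pdivlMr//.
rewrite [LHS](integral_cst _ _ s%:E)// [X in (_ * X)%E](lebesgue_measure_itv _)/= lte_fin ltr_pM2r ?invr_gt0// ab.
rewrite -EFinB -EFinM; congr EFin; field; exact: lt0r_neq0.
Qed.

Lemma ge0_integral_shift (s : R) (f : R -> \bar R) :
  measurable_fun setT f -> (forall x, (0 <= f x)%E) ->
  (\int[mu]_x f x = \int[mu]_x (f (x + s)%R))%E.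
Proof.
move=> mf f0.
rewrite (ge0_integral_substitution (phi := fun x => x + s) (w := cst 1) (E := setT)) => //.
- by apply: eq_integral => x _; rewrite mule1.
- by apply: measurable_funD.
move=> a b ab; rewrite setTI.
have -> : (fun x => x + s) @^-1` `]a, b]%classic = `]a - s, b - s]%classic.
  by apply/seteqP; split => x /=; rewrite !in_itv/= ltrBlDr lerBrDr.
rewrite [LHS](integral_cst _ _ 1%E)// [X in (_ * X)%E](lebesgue_measure_itv _)/= lte_fin ltrD2r ab mul1e -EFinB.
by congr EFin; ring.
Qed.

(** The branch of the inverse cotangent with values in ]0, pi[. *)
Let acot (c : R) := pi / 2 - atan c.

Let acot_lt_cot (y c t : R) : 0 < y -> t \in `]0, pi[ ->
  (c < y * (cos t / sin t)) = (t < acot (c / y)).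
Proof.
move=> y0 /[!in_itv]/= /andP[t0 tpi].
set u := pi / 2 - t.
have uI : u \in `](- (pi / 2)), (pi / 2)[.
  by rewrite in_itv/= /u; apply/andP; split; have := tpi; have := t0; lra.
have -> : cos t / sin t = tan u.
  by rewrite /tan /u cosB sinB cos_pihalf sin_pihalf; congr (_ / _); ring.
rewrite mulrC -ltr_pdivrMr// -[in RHS](subKr (pi / 2) t) -/u /acot ltrD2l ltrN2.
apply/idP/idP => [|au]; first by move/lt_atan; rewrite tanK.
by rewrite ltNge; apply/negP => /le_atan; rewrite tanK// leNgt au.
Qed.

Lemma measurable_cot_weight : [/\ measurable_fun setT (@sin R),
  measurable_fun setT (@cos R), measurable_fun setT (fun t : R => (sin t)^-1) &
  measurable_fun setT (fun t : R => cos t / sin t)].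
Proof.
have ms : measurable_fun setT (@sin R).
  by apply: continuous_measurable_fun; exact: continuous_sin.
have mc : measurable_fun setT (@cos R).
  by apply: continuous_measurable_fun; exact: continuous_cos.
have mi : measurable_fun setT (fun t : R => (sin t)^-1).
  by apply: (measurableT_comp measurable_inv).
by split => //; exact: measurable_funM.
Qed.

(** On the horizontal line at height y the abscissa is y cot t, where t is the polar angle. This is
    the first of the two one-dimensional substitutions behind polar coordinates. *)
Lemma ge0_integral_cot (y : R) (f : R -> \bar R) : 0 < y ->
  measurable_fun setT f -> (forall x, (0 <= f x)%E) ->
  (\int[mu]_x f x =
   \int[mu]_(t in `]0%R, pi[) (f (y * (cos t / sin t))%R
      * (y * ((sin t)^-1 * (sin t)^-1))%:E))%E.
Proof.
move=> y0 mf f0; have [ms mc mi mci] := measurable_cot_weight.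
apply: ge0_integral_substitution => //.
- by apply: measurable_funM.
- by do 2 apply: measurable_funM => //.
- move=> x /=; rewrite in_itv/= => /sin_gt0_pi x0.
  by rewrite mulr_ge0 ?ltW// mulr_gt0 ?invr_gt0.
move=> a b ab.
have ab' : acot (b / y) < acot (a / y).
  by rewrite /acot ltrD2l ltrN2 lt_atan// ltr_pM2r// invr_gt0.
have aI c : 0 < acot c < pi.
  have := atan_gtNpi2 c; have := atan_ltpi2 c; rewrite /acot => h1 h2.
  by apply/andP; split; lra.
(* The cotangent decreases, so the endpoints are exchanged and the open end moves to the right. *)
have -> : `]0, pi[%classic `&` (fun t => y * (cos t / sin t)) @^-1` `]a, b]%classic
    = `[acot (b / y), acot (a / y)[%classic.
  apply/seteqP; split => t /=.
    move=> [tI]; rewrite !in_itv/= acot_lt_cot// leNgt acot_lt_cot// -leNgt.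
    by rewrite andbC.
  move=> tab; have /andP[bt ta] : acot (b / y) <= t < acot (a / y).
    by move: tab; rewrite in_itv.
  have tI : t \in `]0, pi[.
    have /andP[h1 _] := aI (b / y); have /andP[_ h2] := aI (a / y).
    by rewrite in_itv/= (lt_le_trans h1)//= (lt_trans ta).
  by split => //; rewrite in_itv/= acot_lt_cot// leNgt acot_lt_cot// -leNgt ta.
have sI t : acot (b / y) <= t <= acot (a / y) -> 0 < sin t.
  move=> /andP[h1 h2]; apply: sin_gt0_pi.
  have /andP[h3 _] := aI (b / y); have /andP[_ h4] := aI (a / y).
  by rewrite (lt_le_trans h3)//= (le_lt_trans h2).
rewrite integral_itv_bndo_bndc; last first.
  by apply/measurable_EFinP; apply: measurable_funTS; do 2 apply: measurable_funM => //.
pose F t := - (y * (cos t * (sin t)^-1)).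
transitivity ((F (acot (a / y)) - F (acot (b / y)))%:E); last first.
  have cotE c : y * (cos (acot (c / y)) * (sin (acot (c / y)))^-1) = c.
    have := atanK (c / y); rewrite /tan /acot cosB sinB cos_pihalf sin_pihalf.
    rewrite !mul0r !mul1r add0r subr0 => ->.
    by rewrite mulrC divfK// lt0r_neq0.
  by rewrite /F !cotE; congr EFin; ring.
apply: FTC2_is_derive; first exact: ltW.
- move=> t /sI st0; have st : sin t != 0 by exact: lt0r_neq0.
  have dV := is_deriveV st (is_derive_sin t).
  apply: is_derive_eq.
  have cs := cos2Dsin2 t.
  rewrite /GRing.scale/=.
  apply: (mulIf (mulf_neq0 st st)).
  transitivity (y * (cos t ^+ 2 + sin t ^+ 2)); first by field.
  by rewrite cs; field.
- move=> t /sI st0; have st : sin t != 0 by exact: lt0r_neq0.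
  have cV : {for t, continuous (fun t : R => (sin t)^-1)}.
    by apply: continuousV => //; exact: continuous_sin.
  by apply: cvgM; [exact: cvg_cst|exact: cvgM].
Qed.

End substitution.

(** * Spherical coordinates *)

Section polar.
Context {R : realType}.
Local Notation mu := (@lebesgue_measure R).
Local Open Scope ereal_scope.

Lemma ge0_integral_opp (f : R -> \bar R) :
  measurable_fun setT f -> (forall x, 0 <= f x) ->
  \int[mu]_x f x = \int[mu]_x f (- x)%R.
Proof.
move=> mf f0.
rewrite -[X in \int[mu]_(x in X) f (- x)%R](preimage_setT (-%R : R -> R)).
rewrite -(@ge0_integral_pushforward _ _ (measurableTypeR R) (measurableTypeR R) R -%R _ mu setT f)//.
by apply: eq_measure_integral => A mA _; exact/esym/lebesgue_measureN.
Qed.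

Let mfst : measurable_fun setT (fun z : mR2 R => z.1 : measurableTypeR R).
Proof. exact: measurable_fst. Qed.
Let msnd : measurable_fun setT (fun z : mR2 R => z.2 : measurableTypeR R).
Proof. exact: measurable_snd. Qed.

Let comp2 (f : R -> R -> \bar R) d (T : measurableType d) (a b : T -> R) :
  measurable_fun setT (fun z : mR2 R => f z.1 z.2) ->
  measurable_fun setT a -> measurable_fun setT b ->
  measurable_fun setT (fun t => f (a t) (b t)).
Proof.
move=> mf ma mb.
apply: (@measurableT_comp _ _ _ _ _ _ (fun z : mR2 R => f z.1 z.2) _ (fun t => (a t, b t))) => //.
exact: measurable_fun_pair.
Qed.

(** No two-dimensional Jacobian is computed: substitute x = y cot t at fixed y, exchange the
    integrals, then substitute y = s sin t at fixed t. The weights y / sin^2 t and sin t multiply to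
    s. *)
Lemma ge0_integral_polar_half (f : R -> R -> \bar R) :
  measurable_fun setT (fun z : mR2 R => f z.1 z.2) ->
  (forall x y, 0 <= f x y) ->
  \int[mu]_(y in `]0%R, +oo[) \int[mu]_x f x y =
  \int[mu]_(t in `]0%R, pi[) \int[mu]_(s in `]0%R, +oo[)
     (f (s * cos t)%R (s * sin t)%R * s%:E).
Proof.
move=> mf f0; have [ms mc mi mci] := @measurable_cot_weight R.
pose F y t := f (y * (cos t / sin t))%R y * (y * ((sin t)^-1 * (sin t)^-1))%:E.
have mF : measurable_fun setT (fun z : mR2 R => F z.1 z.2).
  apply: emeasurable_funM.
    apply: comp2 => //; apply: measurable_funM => //.
    exact: (measurableT_comp mci).
  apply/measurable_EFinP; apply: measurable_funM => //.
  by apply: measurable_funM; exact: (measurableT_comp mi).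
have F0 y t : (0 < y)%R -> (0 < sin t)%R -> 0 <= F y t.
  move=> y0 t0; rewrite /F mule_ge0// lee_fin.
  by rewrite mulr_ge0 ?ltW// mulr_gt0 ?invr_gt0.
transitivity (\int[mu]_(y in `]0%R, +oo[) \int[mu]_(t in `]0%R, pi[) F y t).
  apply: eq_integral => y /[!inE]/=; rewrite in_itv/= andbT => y0.
  by rewrite (ge0_integral_cot y0)//; apply: comp2.
transitivity (\int[mu]_(t in `]0%R, pi[) \int[mu]_(y in `]0%R, +oo[) F y t).
  have F0' : forall x y, [set` `]0%R, +oo[] x -> [set` `]0%R, pi[] y -> 0 <= F x y.
    move=> x y /=; rewrite !in_itv/= andbT => x0 /sin_gt0_pi y0; exact: F0.
  exact: (@tonelli_in _ _ (measurableTypeR R) (measurableTypeR R) R sf_lebesgue1 sf_lebesgue1 _ _ (fun z => F z.1 z.2) (measurable_itv _) (measurable_itv _) mF F0').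
apply: eq_integral => t /[!inE]/=; rewrite in_itv/= => /sin_gt0_pi t0.
have mFt : measurable_fun setT (fun y => F y t).
  by apply: (@comp2 F _ (measurableTypeR R) idfun (cst t) mF); [exact: measurable_id|exact: measurable_cst].
rewrite integral_mkcond (ge0_integral_scale t0); last 2 first.
- by apply: (measurable_restrictT _ _).1 => //; exact: measurable_funTS.
- move=> y; rewrite patchE; case: ifPn => //; rewrite inE/= in_itv/= andbT => y0.
  exact: F0.
rewrite [RHS]integral_mkcond; apply: eq_integral => s _; rewrite !patchE.
have -> : ((s * sin t)%R \in `]0%R, +oo[%classic) = (s \in `]0%R, +oo[%classic).
  by apply/idP/idP; rewrite !inE/= !in_itv/= !andbT pmulr_lgt0.
case: ifPn => [_|]; last by rewrite mul0e.
have st : sin t != 0%R by exact: lt0r_neq0.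
rewrite /F -muleA -EFinM.
by congr (f _ _ * _%:E); field.
Qed.

(** The lower half-plane is reduced to the upper one by the central symmetry, which shifts the angle
    by pi; the rays at 0, pi and 2 pi are negligible. *)
Lemma ge0_integral_polar (f : R -> R -> \bar R) :
  measurable_fun setT (fun z : mR2 R => f z.1 z.2) ->
  (forall x y, 0 <= f x y) ->
  \int[mu]_y \int[mu]_x f x y =
  \int[mu]_(t in `[0%R, (2 * pi)%R]) \int[mu]_(s in `]0%R, +oo[)
     (f (s * cos t)%R (s * sin t)%R * s%:E).
Proof.
move=> mf f0; have [ms mc mi mci] := @measurable_cot_weight R.
have mN : measurable_fun setT (fun x : R => - x)%R by exact: oppr_measurable.
pose g y := \int[mu]_x f x y.
have mg : measurable_fun setT g.
  exact: (@measurable_fun_fubini_tonelli_G _ _ _ _ _ mu (fun z : mR2 R => f z.1 z.2)).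
have g0 y : 0 <= g y by exact: integral_ge0.
pose h t := \int[mu]_(s in `]0%R, +oo[) (f (s * cos t)%R (s * sin t)%R * s%:E).
have mh : measurable_fun setT h.
  pose H := fun z : mR2 R => ((fun s => f (s * cos z.1)%R (s * sin z.1)%R * s%:E) \_ `]0%R, +oo[) z.2.
  rewrite (_ : h = fun t => \int[mu]_s H (t, s)); last first.
    by apply/funext => t; rewrite /h integral_mkcond.
  apply: (@measurable_fun_fubini_tonelli_F _ _ _ _ _ mu H).
    rewrite (_ : H = (fun z : mR2 R => f (z.2 * cos z.1)%R (z.2 * sin z.1)%R * z.2%:E)
      \_ (setT `*` `]0%R, +oo[)); last first.
      apply/funext => z; rewrite /H !patchE.
      have -> : (z \in setT `*` `]0%R, +oo[%classic) = (z.2 \in `]0%R, +oo[%classic).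
        by case: z => a b; rewrite in_setX in_setT.
      by [].
    apply: (measurable_restrictT _ _).1; first exact: measurableX.
    apply: measurable_funTS; apply: emeasurable_funM; last exact/measurable_EFinP.
    by apply: comp2 => //; apply: measurable_funM => //;
      [exact: (measurableT_comp mc)|exact: (measurableT_comp ms)].
  move=> z; rewrite /H patchE; case: ifPn => //; rewrite inE/= in_itv/= andbT => z0.
  by rewrite mule_ge0// lee_fin ltW.
have h0 t : 0 <= h t.
  apply: integral_ge0 => s /=; rewrite in_itv/= andbT => s0.
  by rewrite mule_ge0// lee_fin ltW.
rewrite -/g -[RHS]/(\int[mu]_(t in `[0%R, (2 * pi)%R]) h t).
have -> : \int[mu]_y g y = \int[mu]_(y in `]-oo, 0%R]) g y + \int[mu]_(y in `]0%R, +oo[) g y.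
  rewrite -ge0_integral_setU//=; last 2 first.
  - exact: measurable_funTS.
  - apply/disj_set2P; rewrite -subset0 => y [/=].
    by rewrite !in_itv/= andbT => /le_lt_trans/[apply]; rewrite ltxx.
  rewrite (_ : _ `|` _ = setT)//; rewrite -subTset => y _ /=; rewrite !in_itv/= andbT.
  by case: (leP y 0%R); [left|right].
have -> : \int[mu]_(y in `]0%R, +oo[) g y = \int[mu]_(t in `]0%R, pi[) h t.
  exact: ge0_integral_polar_half.
have -> : \int[mu]_(y in `]-oo, 0%R]) g y = \int[mu]_(t in `]pi, (2 * pi)%R[) h t.
  transitivity (\int[mu]_(y in `]-oo, 0%R]) g (- - y)%R).
    by apply: eq_integral => y _; rewrite opprK.
  rewrite -(@ge0_integration_by_substitution0 _ (fun y => g (- y)%R))//; last first.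
    exact: (measurableT_comp mg).
  rewrite -integral_itv_obnd_cbnd; last by apply: measurable_funTS; exact: (measurableT_comp mg).
  transitivity (\int[mu]_(y in `]0%R, +oo[) \int[mu]_x f (- x)%R (- y)%R).
    apply: eq_integral => y _; rewrite /g (@ge0_integral_opp (f^~ (- y)%R))//.
    by apply: (@comp2 f _ (measurableTypeR R) idfun (cst (- y)%R) mf); [exact: measurable_id|exact: measurable_cst].
  rewrite (@ge0_integral_polar_half (fun x y => f (- x)%R (- y)%R))//; last first.
    by apply: comp2 => //; exact: (measurableT_comp mN).
  rewrite [RHS]integral_mkcond (@ge0_integral_shift _ pi)//; last 2 first.
  - by apply: (measurable_restrictT _ _).1 => //; exact: measurable_funTS.
  - by move=> x; rewrite patchE; case: ifPn.
  rewrite integral_mkcond; apply: eq_integral => t _; rewrite !patchE.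
  have -> : ((t + pi)%R \in `]pi, (2 * pi)%R[%classic) = (t \in `]0%R, pi[%classic).
    apply/idP/idP; rewrite !inE/= !in_itv/= => /andP[h1 h2]; apply/andP; split; lra.
  case: ifPn => // _; apply: eq_integral => s _.
  by rewrite cosDpi sinDpi !mulrN.
have pi0 := @pi_ge0 R.
have mhS D : measurable D -> measurable_fun D h by move=> mD; exact: measurable_funTS.
rewrite -(@integral_itv_bndoo _ pi (2 * pi) h false false); last exact: mhS.
rewrite -(@integral_itv_bndoo _ 0%R pi h true false); last exact: mhS.
rewrite addeC -ge0_integral_setU//=.
- by rewrite -itv_bndbnd_setU// bnd_simp; lra.
- by apply: mhS; exact: measurableU.
- apply/disj_set2P; rewrite -subset0 => y [/=].
  rewrite !in_itv/= => /andP[_ h1] /andP[h2 _].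
  by move: (lt_le_trans h2 h1); rewrite ltxx.
Qed.

(** Polar coordinates are used twice: in the horizontal plane at fixed z, then in the half-plane of
    (z, y), where y > 0 is the distance to the axis. The weights y = s sin t and s multiply to s^2
    sin t. *)
Lemma ge0_integral_spherical (f : mR3 R -> \bar R) :
  measurable_fun setT f -> (forall x, 0 <= f x) ->
  \int[lebesgue3 R]_x f x =
  \int[mu]_(p in `[0%R, (2 * pi)%R]) \int[mu]_(t in `[0%R, pi])
    \int[mu]_(s in `]0%R, +oo[) (f (spherical s (t, p)) * (s ^+ 2 * sin t)%:E).
Proof.
move=> mf f0; have [ms mc mi mci] := @measurable_cot_weight R.
have mp3 (d : measure_display) (T : measurableType d) (a b c : T -> R) :
    measurable_fun setT a -> measurable_fun setT b -> measurable_fun setT c ->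
    measurable_fun setT (fun t => f (a t, b t, c t)).
  move=> ma mb mc'; apply: (@measurableT_comp _ _ _ _ _ _ f _ (fun t => (a t, b t, c t))) => //.
  by apply: measurable_fun_pair => //; exact: measurable_fun_pair.
have ms1 : measurable_fun setT (fun z : mR2 R => sin z.1) by exact: (measurableT_comp ms).
have mc1 : measurable_fun setT (fun z : mR2 R => cos z.1) by exact: (measurableT_comp mc).
have mK (g : mR2 R -> R -> \bar R) :
    measurable_fun setT (fun w : mR2 R * measurableTypeR R => g w.1 w.2) ->
    (forall z s, (0 < s)%R -> 0 <= g z s) ->
    measurable_fun setT (fun z => \int[mu]_(s in `]0%R, +oo[) g z s).
  move=> mg g0.
  pose H := (fun w : mR2 R * measurableTypeR R => g w.1 w.2) \_ (setT `*` `]0%R, +oo[).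
  rewrite (_ : (fun z : mR2 R => _) = fun z => \int[mu]_s H (z, s)); last first.
    apply/funext => z; rewrite integral_mkcond; apply: eq_integral => s _.
    by rewrite /H !patchE in_setX in_setT.
  apply: (@measurable_fun_fubini_tonelli_F _ _ _ _ _ mu H).
    apply: (measurable_restrictT _ _).1; first exact: measurableX.
    exact: measurable_funTS.
  move=> z; rewrite /H patchE; case: ifPn => //; rewrite inE => -[_ /=].
  by rewrite in_itv/= andbT; exact: g0.
have m12 : measurable_fun setT (fun w : mR2 R * measurableTypeR R => w.1.2).
  exact: (measurableT_comp measurable_snd).
have m11 : measurable_fun setT (fun w : mR2 R * measurableTypeR R => w.1.1).
  exact: (measurableT_comp measurable_fst).
transitivity (\int[mu]_z \int[lebesgue2 R]_w f (w, z)).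
  exact: (@fubini_tonelli2 _ _ _ _ R sf_lebesgue2 sf_lebesgue1 f mf f0).
transitivity (\int[mu]_z \int[mu]_(p in `[0%R, (2 * pi)%R]) \int[mu]_(s in `]0%R, +oo[)
    (f (s * cos p, s * sin p, z)%R * s%:E)).
  apply: eq_integral => z _.
  have mfz : measurable_fun setT (fun w : mR2 R => f (w, z)).
    exact: measurable_fun_pair1.
  transitivity (\int[mu]_y \int[mu]_x f (x, y, z)).
    by apply: (@fubini_tonelli2 _ _ _ _ R sf_lebesgue1 sf_lebesgue1 (fun w => f (w, z)) mfz).
  by apply: (@ge0_integral_polar (fun x y => f (x, y, z))) => //; exact: mp3.
pose K p z s := f (s * cos p, s * sin p, z)%R * s%:E.
have K0 p z s : (0 < s)%R -> 0 <= K p z s.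
  by move=> s0; rewrite /K mule_ge0// lee_fin ltW.
pose G z p := \int[mu]_(s in `]0%R, +oo[) K p z s.
transitivity (\int[mu]_(p in `[0%R, (2 * pi)%R]) \int[mu]_z G z p).
  apply: (@tonelli_in _ _ (measurableTypeR R) (measurableTypeR R) R sf_lebesgue1 sf_lebesgue1 setT _ (fun z => G z.1 z.2)) => //; last first.
    by move=> x y _ _; apply: integral_ge0 => s /=; rewrite in_itv/= andbT; exact: K0.
  apply: (mK (fun z s => K z.2 z.1 s)); last by move=> z s; exact: K0.
  rewrite /K; apply: emeasurable_funM; last exact/measurable_EFinP.
  apply: mp3 => //; first by apply: measurable_funM => //; exact: (measurableT_comp mc).
  by apply: measurable_funM => //; exact: (measurableT_comp ms).
apply: eq_integral => p _.
transitivity (\int[mu]_(y in `]0%R, +oo[) \int[mu]_z K p z y).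
  apply: (@tonelli_in _ _ (measurableTypeR R) (measurableTypeR R) R sf_lebesgue1 sf_lebesgue1 setT _ (fun z => K p z.1 z.2)) => //.
    rewrite /K; apply: emeasurable_funM; last exact/measurable_EFinP.
    by apply: mp3 => //; exact: measurable_funM.
  by move=> x y _; rewrite /= in_itv/= andbT; exact: K0.
(* The half-plane formula asks for an integrand that is nonnegative everywhere, so the weight y
   becomes its absolute value, which changes nothing for y > 0. *)
pose K' z y := f (y * cos p, y * sin p, z)%R * `|y|%:E.
transitivity (\int[mu]_(y in `]0%R, +oo[) \int[mu]_z K' z y).
  apply: eq_integral => y; rewrite inE/= in_itv/= andbT => y0.
  by apply: eq_integral => z _; rewrite /K /K' gtr0_norm.
rewrite (@ge0_integral_polar_half K'); last 2 first.
- rewrite /K'; apply: emeasurable_funM; last first.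
    by apply/measurable_EFinP; exact: (measurableT_comp (@normr_measurable _ setT)).
  by apply: mp3 => //; exact: measurable_funM.
- by move=> x y; rewrite /K' mule_ge0.
pose L t s := f (spherical s (t, p)) * (s ^+ 2 * sin t)%:E.
have mL : measurable_fun `]0%R, pi[ (fun t => \int[mu]_(s in `]0%R, +oo[) L t s).
  pose L' (z : mR2 R) s := f (spherical s z) * (s ^+ 2 * `|sin z.1|)%:E.
  apply: (eq_measurable_fun (fun t => \int[mu]_(s in `]0%R, +oo[) L' (t, p) s)).
    move=> t; rewrite inE/= in_itv/= => /sin_gt0_pi t0.
    by apply: eq_integral => s _; rewrite /L /L' /= gtr0_norm.
  apply: measurable_funTS.
  apply: (@measurableT_comp _ _ _ _ _ _ (fun z : mR2 R => \int[mu]_(s in `]0%R, +oo[) L' z s) _ (fun t => (t, p))).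
    apply: mK; last by move=> z s s0; rewrite /L' mule_ge0// lee_fin mulr_ge0// sqr_ge0.
    have mc11 : measurable_fun setT (fun w : mR2 R * measurableTypeR R => cos w.1.1) by exact: (measurableT_comp mc).
    have ms11 : measurable_fun setT (fun w : mR2 R * measurableTypeR R => sin w.1.1) by exact: (measurableT_comp ms).
    apply: emeasurable_funM.
      by apply: mp3; do ?apply: measurable_funM => //;
        [exact: (measurableT_comp mc)|exact: (measurableT_comp ms)].
    apply/measurable_EFinP; apply: measurable_funM; first exact: measurable_funX.
    exact: (measurableT_comp (@normr_measurable _ setT)).
  exact: measurable_fun_pair.
rewrite [RHS](@integral_itv_bndoo _ 0%R pi _ true false)//.
apply: eq_integral => t; rewrite inE/= in_itv/= => /sin_gt0_pi t0.
apply: eq_integral => s; rewrite inE/= in_itv/= andbT => s0.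
rewrite /L /K' /spherical/= gtr0_norm ?mulr_gt0// -muleA -EFinM.
by congr (f (_, _, _) * _%:E); ring.
Qed.

End polar.

(** * Coordinates and the Euclidean norm *)

Section euclidean_space.
Context {R : realType}.
Implicit Types (x y z : R3 R).

(** Natural indices compute on literals and need no bound in statements: every index from 2 on
    designates the third coordinate. *)
Definition crd (i : nat) x : R :=
  match i with 0 => x.1.1 | 1 => x.1.2 | _ => x.2 end.

Lemma coord3E (i : 'I_3) x : coord3 i x = crd i x.
Proof. by case: i => -[|[|[|]]]. Qed.

Lemma dotE x y :
  dot x y = crd 0 x * crd 0 y + crd 1 x * crd 1 y + crd 2 x * crd 2 y.
Proof. by rewrite /dot !big_ord_recr big_ord0/= add0r !coord3E. Qed.

Lemma dotxx x : dot x x = x.1.1 ^+ 2 + x.1.2 ^+ 2 + x.2 ^+ 2.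
Proof. by rewrite dotE /=; ring. Qed.

Lemma dot_ge0 x : 0 <= dot x x.
Proof. by rewrite dotxx !addr_ge0// sqr_ge0. Qed.

Lemma enorm_ge0 x : 0 <= enorm x.
Proof. exact: sqrtr_ge0. Qed.

Lemma enorm_sqr x : enorm x ^+ 2 = dot x x.
Proof. by rewrite sqr_sqrtr// dot_ge0. Qed.

Lemma dot_gt0 x : x != 0 -> 0 < dot x x.
Proof.
move=> x0; rewrite lt_neqAle dot_ge0 andbT eq_sym; apply: contra x0.
rewrite dotxx => /eqP h; case: x h => [[a b] c] /= h.
have : a ^+ 2 = 0 /\ b ^+ 2 = 0 /\ c ^+ 2 = 0.
  by have := sqr_ge0 a; have := sqr_ge0 b; have := sqr_ge0 c; lra.
by move=> [/eqP + [/eqP + /eqP]]; rewrite !sqrf_eq0 => /eqP -> /eqP -> /eqP ->.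
Qed.

Lemma enorm_gt0 x : x != 0 -> 0 < enorm x.
Proof. by move=> x0; rewrite sqrtr_gt0 dot_gt0. Qed.

Lemma enorm_spherical (s : R) (t : R * R) : enorm (spherical s t) = `|s|.
Proof.
rewrite /enorm dotxx /spherical /= -sqrtr_sqr; congr Num.sqrt.
have h1 := cos2Dsin2 t.1; have h2 := cos2Dsin2 t.2.
transitivity (s ^+ 2 * (sin t.1 ^+ 2 * (cos t.2 ^+ 2 + sin t.2 ^+ 2) + cos t.1 ^+ 2)).
  by ring.
by rewrite h2 mulr1 addrC h1 mulr1.
Qed.

Lemma crd_continuous i : continuous (crd i : R3 R -> R).
Proof.
have c1 : continuous (fst : R3 R -> R * R) by move=> x; exact: cvg_fst.
case: i => [|[|i]] x /=; last exact: cvg_snd.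
- by apply: (@continuous_comp _ _ _ (fst : R3 R -> R * R) fst); [exact: c1|exact: cvg_fst].
- by apply: (@continuous_comp _ _ _ (fst : R3 R -> R * R) snd); [exact: c1|exact: cvg_snd].
Qed.

Lemma crdB i x y : crd i (x - y) = crd i x - crd i y.
Proof. by case: i => [|[|i]]. Qed.

Lemma measurable_crd i : measurable_fun setT (crd i : mR3 R -> R).
Proof.
case: i => [|[|i]] /=; last exact: measurable_snd.
- by apply: (measurableT_comp (f := fst)); [exact: measurable_fst|exact: measurable_fst].
- by apply: (measurableT_comp (f := snd)); [exact: measurable_snd|exact: measurable_fst].
Qed.

Lemma dot_continuous : continuous (fun x : R3 R => dot x x).
Proof.
rewrite (_ : (fun x => _) = (fun x => crd 0 x * crd 0 x + crd 1 x * crd 1 x + crd 2 x * crd 2 x)); last first.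
  by apply/funext => x; rewrite dotE.
by move=> x; apply: cvgD; [apply: cvgD|]; apply: cvgM; exact: crd_continuous.
Qed.

Lemma enorm_continuous : continuous (@enorm R).
Proof.
move=> x; apply: (@continuous_comp _ _ _ (fun x => dot x x) Num.sqrt).
  exact: dot_continuous.
exact: sqrt_continuous.
Qed.

Lemma measurable_enorm : measurable_fun setT (@enorm R : mR3 R -> R).
Proof.
rewrite (_ : @enorm R = @Num.sqrt R \o (fun x : mR3 R => dot x x))//.
apply: (@measurableT_comp _ _ _ _ _ _ (@Num.sqrt R)).
  by apply: continuous_measurable_fun; exact: sqrt_continuous.
rewrite (_ : (fun x => _) = fun x : R3 R => crd 0 x ^+ 2 + crd 1 x ^+ 2 + crd 2 x ^+ 2); last first.
  by apply/funext => x; rewrite dotxx.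
by apply: measurable_funD; [apply: measurable_funD|]; apply: measurable_funX; exact: measurable_crd.
Qed.

End euclidean_space.

(** * Derivatives of the Newton kernel *)

Section newton_kernel.
Context {R : realType}.
Implicit Types (x y : R3 R).

Definition rho x y : R := (enorm (x - y))^-1.

(* [kgrad i x] and [khess i j x] are the first and second partial derivatives
   of [rho x]. *)
Definition kgrad (i : nat) x y : R := crd i (x - y) * rho x y ^+ 3.

Definition khess (i j : nat) x y : R :=
  3 * crd i (x - y) * crd j (x - y) * rho x y ^+ 5 - (i == j)%:R * rho x y ^+ 3.

Lemma khessC i j x y : khess i j x y = khess j i x y.
Proof. by rewrite /khess eq_sym; congr (_ - _); ring. Qed.

Lemma rho_sqr x y : x != y -> rho x y ^+ 2 * dot (x - y) (x - y) = 1.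
Proof.
move=> xy; rewrite -enorm_sqr /rho -exprMn mulVf ?expr1n//.
by rewrite gt_eqF// enorm_gt0// subr_eq0.
Qed.

(** Harmonicity of the Newton kernel off its pole: the trace is 3 |x - y|^2 rho^5 - 3 rho^3. *)
Lemma khess_trace x y : x != y ->
  khess 0 0 x y + khess 1 1 x y + khess 2 2 x y = 0.
Proof.
move=> /rho_sqr; rewrite dotE /khess /= => h.
transitivity (3 * rho x y ^+ 3 * (rho x y ^+ 2 *
  (crd 0 (x - y) * crd 0 (x - y) + crd 1 (x - y) * crd 1 (x - y) + crd 2 (x - y) * crd 2 (x - y)) - 1)).
  by rewrite /=; ring.
by rewrite h subrr mulr0.
Qed.

(** Stated along an arbitrary curve, because it is differentiated along the coordinate lines of
    spherical coordinates; only one-variable derivatives then occur. *)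
Lemma is_derive_rho x (a b c : R -> R) (t a' b' c' : R) :
  x != (a t, b t, c t) ->
  is_derive t 1 a a' -> is_derive t 1 b b' -> is_derive t 1 c c' ->
  is_derive t 1 (fun s => rho x (a s, b s, c s))
    (kgrad 0 x (a t, b t, c t) * a' + kgrad 1 x (a t, b t, c t) * b'
     + kgrad 2 x (a t, b t, c t) * c').
Proof.
move=> xy da db dc.
pose q (s : R) := (x.1.1 - a s) ^+ 2 + (x.1.2 - b s) ^+ 2 + (x.2 - c s) ^+ 2.
have qE s : dot (x - (a s, b s, c s)) (x - (a s, b s, c s)) = q s.
  by rewrite dotxx.
have q0 : 0 < q t by rewrite -qE dot_gt0// subr_eq0.
have dq : is_derive t 1 q
    (- 2 * ((x.1.1 - a t) * a' + (x.1.2 - b t) * b' + (x.2 - c t) * c')).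
  by rewrite /q; apply: is_derive_eq; rewrite /GRing.scale/=; ring.
have dsq := is_derive1_comp (is_derive1_sqrt q0) dq.
have sq0 : Num.sqrt (q t) != 0 by rewrite gt_eqF// sqrtr_gt0.
have := is_deriveV (f := Num.sqrt \o q) sq0 dsq.
have -> : (fun s => ((Num.sqrt \o q) s)^-1) = (fun s => rho x (a s, b s, c s)).
  by apply/funext => s; rewrite /rho /enorm qE.
move=> h; apply: is_derive_eq.
rewrite /kgrad /rho /enorm qE /= /GRing.scale/=.
by field.
Qed.

Lemma is_derive_kgrad i x (a b c : R -> R) (t a' b' c' : R) : (i < 3)%N ->
  x != (a t, b t, c t) ->
  is_derive t 1 a a' -> is_derive t 1 b b' -> is_derive t 1 c c' ->
  is_derive t 1 (fun s => kgrad i x (a s, b s, c s))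
    (khess i 0 x (a t, b t, c t) * a' + khess i 1 x (a t, b t, c t) * b'
     + khess i 2 x (a t, b t, c t) * c').
Proof.
move=> i3 xy da db dc; have dr := is_derive_rho xy da db dc.
case: i i3 => [|[|[|//]]] _; rewrite /kgrad /=;
  by apply: is_derive_eq; rewrite /khess /kgrad /= /GRing.scale/=; ring.
Qed.

Lemma rho_continuous x y : x != y -> {for y, continuous (rho x)}.
Proof.
move=> xy; apply: continuousV; first by rewrite gt_eqF// enorm_gt0// subr_eq0.
apply: (@continuous_comp _ _ _ (fun y => x - y) (@enorm R)).
  by apply: cvgB; [exact: cvg_cst|exact: cvg_id].
exact: enorm_continuous.
Qed.

Lemma crdB_continuous i x : continuous (fun y => crd i (x - y)).
Proof.
move=> y; apply: (@continuous_comp _ _ _ (fun y => x - y) (crd i)).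
  by apply: cvgB; [exact: cvg_cst|exact: cvg_id].
exact: crd_continuous.
Qed.

Lemma kgrad_continuous i x y : x != y -> {for y, continuous (kgrad i x)}.
Proof.
move=> xy; apply: cvgM; first exact: crdB_continuous.
by apply: (@continuous_comp _ _ _ (rho x) (fun r => r ^+ 3));
  [exact: rho_continuous|exact: exprn_continuous].
Qed.

Lemma khess_continuous i j x y : x != y -> {for y, continuous (khess i j x)}.
Proof.
move=> xy.
have cX n : {for y, continuous (fun y => rho x y ^+ n)}.
  by apply: (@continuous_comp _ _ _ (rho x) (fun r => r ^+ n));
    [exact: rho_continuous|exact: exprn_continuous].
apply: cvgB; apply: cvgM => //; [|exact: cX|exact: cvg_cst|exact: cX].
apply: cvgM; last exact: crdB_continuous.
by apply: cvgM; [exact: cvg_cst|exact: crdB_continuous].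
Qed.

Lemma measurable_rho x : measurable_fun setT (rho x : mR3 R -> R).
Proof.
apply: (measurableT_comp measurable_inv).
rewrite (_ : (fun y => enorm (x - y)) = @Num.sqrt R \o (fun y : mR3 R => dot (x - y) (x - y)))//.
apply: (@measurableT_comp _ _ _ _ _ _ (@Num.sqrt R)).
  by apply: continuous_measurable_fun; exact: sqrt_continuous.
rewrite (_ : (fun y => _) = fun y : R3 R => (x.1.1 - crd 0 y) ^+ 2 + (x.1.2 - crd 1 y) ^+ 2 + (x.2 - crd 2 y) ^+ 2); last first.
  by apply/funext => y; rewrite dotxx.
by apply: measurable_funD; [apply: measurable_funD|]; apply: measurable_funX;
  apply: measurable_funB => //; exact: measurable_crd.
Qed.

Lemma measurable_crdB i x : measurable_fun setT ((fun y => crd i (x - y)) : mR3 R -> R).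
Proof.
rewrite (_ : (fun y => _) = fun y : mR3 R => crd i x - crd i y); last first.
  by apply/funext => y; rewrite crdB.
by apply: measurable_funB => //; exact: measurable_crd.
Qed.

Lemma measurable_kgrad i x : measurable_fun setT (kgrad i x : mR3 R -> R).
Proof.
apply: measurable_funM; first exact: measurable_crdB.
by apply: measurable_funX; exact: measurable_rho.
Qed.

Lemma measurable_khess i j x : measurable_fun setT (khess i j x : mR3 R -> R).
Proof.
apply: measurable_funB; last first.
  by apply: measurable_funM => //; apply: measurable_funX; exact: measurable_rho.
apply: measurable_funM; last by apply: measurable_funX; exact: measurable_rho.
apply: measurable_funM; last exact: measurable_crdB.
by apply: measurable_funM => //; exact: measurable_crdB.
Qed.

End newton_kernel.

Lemma lebesgue_segment_lty {R : realType} (x y : R) :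
  (lebesgue_measure `[x, y]%classic < +oo)%E.
Proof. by rewrite lebesgue_measure_itv/=; case: ifPn => _; rewrite ?ltry// -EFinB ltry. Qed.

(** * The Rellich inequality on a ball *)

Section box_integral.
Context {R : realType} (S T P : set (measurableTypeR R)) (f : mR3 R -> \bar R).
Hypotheses (mS : measurable S) (mT : measurable T) (mP : measurable P)
  (mf : measurable_fun setT f)
  (f0 : forall s t p, S s -> T t -> P p -> (0 <= f (s, t, p))%E).
Local Notation mu := (@lebesgue_measure R).
Local Open Scope ereal_scope.

Let fp0 : forall w p, (S `*` T) w -> P p -> 0 <= f (w, p).
Proof. by move=> [s t] p [/= ? ?] ?; exact: f0. Qed.

Let mfp p : measurable_fun setT (fun w => f (w, p)).
Proof. exact: measurable_fun_pair1. Qed.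

(** Several orders of integration are needed because each term of the divergence is integrated first
    in its own variable: s for [DA], t for [DB], p for [DC]. *)
Lemma box_integral_pst : \int[lebesgue3 R]_(z in (S `*` T) `*` P) f z =
  \int[mu]_(p in P) \int[lebesgue2 R]_(w in S `*` T) f (w, p).
Proof.
exact: (@ge0_integral_setX2 _ _ _ _ R sf_lebesgue2 sf_lebesgue1 _ _ f (measurableX mS mT) mP mf fp0).
Qed.

Lemma box_integral_stp : \int[lebesgue3 R]_(z in (S `*` T) `*` P) f z =
  \int[lebesgue2 R]_(w in S `*` T) \int[mu]_(p in P) f (w, p).
Proof.
exact: (@ge0_integral_setX1 _ _ _ _ R sf_lebesgue2 sf_lebesgue1 _ _ f (measurableX mS mT) mP mf fp0).
Qed.

Lemma box_integral_p_t_s : \int[lebesgue3 R]_(z in (S `*` T) `*` P) f z =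
  \int[mu]_(p in P) \int[mu]_(t in T) \int[mu]_(s in S) f (s, t, p).
Proof.
rewrite box_integral_pst; apply: eq_integral => p /set_mem Pp.
by apply: (@ge0_integral_setX2 _ _ _ _ R sf_lebesgue1 sf_lebesgue1 _ _ (fun w => f (w, p)) mS mT (mfp p)) => s t Ss Tt; exact: f0.
Qed.

Lemma box_integral_p_s_t : \int[lebesgue3 R]_(z in (S `*` T) `*` P) f z =
  \int[mu]_(p in P) \int[mu]_(s in S) \int[mu]_(t in T) f (s, t, p).
Proof.
rewrite box_integral_pst; apply: eq_integral => p /set_mem Pp.
by apply: (@ge0_integral_setX1 _ _ _ _ R sf_lebesgue1 sf_lebesgue1 _ _ (fun w => f (w, p)) mS mT (mfp p)) => s t Ss Tt; exact: f0.
Qed.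

End box_integral.

Section regular.
Context {R : realType} (D : set (R3 R)).

(** The two properties wanted of every integrand, in a form stable under sums and products:
    measurability for Tonelli, and continuity at the points of [D] for the fundamental theorem and
    for boundedness. *)
Definition regular (f : R3 R -> R) := measurable_fun setT (f : mR3 R -> R) /\
  forall z, D z -> {for z, continuous f}.

Lemma regular_measurable f : regular f -> measurable_fun setT (f : mR3 R -> R).
Proof. by case. Qed.

Lemma regular_continuous f z : regular f -> D z -> {for z, continuous f}.
Proof. by move=> [_]; exact. Qed.

Lemma regularD f1 f2 : regular f1 -> regular f2 -> regular (fun z => f1 z + f2 z).
Proof.
move=> [m1 c1] [m2 c2]; split; first exact: measurable_funD.
by move=> z Dz; apply: cvgD; [exact: c1|exact: c2].
Qed.

Lemma regularN f1 : regular f1 -> regular (fun z => - f1 z).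
Proof.
move=> [m1 c1]; split; first exact: measurable_funN.
by move=> z Dz; apply: cvgN; exact: c1.
Qed.

Lemma regularM f1 f2 : regular f1 -> regular f2 -> regular (fun z => f1 z * f2 z).
Proof.
move=> [m1 c1] [m2 c2]; split; first exact: measurable_funM.
by move=> z Dz; apply: cvgM; [exact: c1|exact: c2].
Qed.

Lemma regular_cst k : regular (fun=> k).
Proof. by split => // z _; exact: cvg_cst. Qed.

Lemma regularX n f1 : regular f1 -> regular (fun z => f1 z ^+ n).
Proof.
move=> n1; elim: n => [|n IH]; first exact: regular_cst.
rewrite (_ : (fun _ => _) = fun z => f1 z * f1 z ^+ n); first exact: regularM.
by apply/funext => z; rewrite exprS.
Qed.

Lemma regular_crd i : regular (crd i).
Proof. by split; [exact: measurable_crd|move=> z _; exact: crd_continuous]. Qed.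

Lemma regular_comp (k : R -> R) i : continuous k -> regular (fun z => k (crd i z)).
Proof.
move=> ck; split.
  by apply: (measurableT_comp (continuous_measurable_fun ck)); exact: measurable_crd.
move=> z _; apply: (@continuous_comp _ _ _ (crd i) k); last exact: ck.
exact: crd_continuous.
Qed.

(** This constant is the shift that turns a signed integrand into a nonnegative one. *)
Lemma regular_bounded f : compact D -> regular f ->
  exists2 k, 0 <= k & forall z, D z -> 0 <= f z + k.
Proof.
move=> cD [_ cf].
have : compact (f @` D).
  apply: continuous_compact => //; apply: continuous_in_subspaceT => z /set_mem.
  exact: cf.
move=> /compact_bounded [M [Mr HM]].
exists (`|M| + 1); first by rewrite addr_ge0.
move=> z Dz; have := HM (`|M| + 1) _ (f z) (ex_intro2 _ _ z Dz erefl).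
rewrite (le_lt_trans (ler_norm M)) ?ltrDl// => /(_ isT).
by move/lerNnormlW => /= hf; rewrite -lerBlDr sub0r.
Qed.

Lemma Regular f : measurable_fun setT (f : mR3 R -> R) ->
  (forall z, D z -> {for z, continuous f}) -> regular f.
Proof. by move=> mf cf; split. Qed.

End regular.
Local Opaque regular.

Section rellich.
Context {R : realType} (r : R) (g : nat -> R3 R -> R) (h : nat -> nat -> R3 R -> R).
Hypotheses (r0 : 0 < r)
  (mg : forall i, measurable_fun setT (g i : mR3 R -> R))
  (mh : forall i j, measurable_fun setT (h i j : mR3 R -> R))
  (cg : forall i x, ecball r x -> {for x, continuous (g i)})
  (ch : forall i j x, ecball r x -> {for x, continuous (h i j)})
  (hC : forall i j x, h i j x = h j i x)
  (htr : forall x, ecball r x -> h 0 0 x + h 1 1 x + h 2 2 x = 0)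
  (chain : forall i (a b c : R -> R) (t a' b' c' : R), (i < 3)%N ->
    ecball r (a t, b t, c t) ->
    is_derive t 1 a a' -> is_derive t 1 b b' -> is_derive t 1 c c' ->
    is_derive t 1 (fun s => g i (a s, b s, c s))
      (h i 0 (a t, b t, c t) * a' + h i 1 (a t, b t, c t) * b'
       + h i 2 (a t, b t, c t) * c')).
Local Notation mu := (@lebesgue_measure R).

Let S : set R := `[0, r]%classic.
Let T : set R := `[0, pi]%classic.
Let P : set R := `[0, 2 * pi]%classic.
Let Box : set (R3 R) := (S `*` T) `*` P.

(** The coordinates (s, t, p) are stored as a point of [R3], so that the measurability and
    continuity lemmas on [R3] also serve on the box. *)
Let sph (z : R3 R) : R3 R := spherical z.1.1 (z.1.2, z.2).

Let sph_ball z : S z.1.1 -> ecball r (sph z).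
Proof.
rewrite /S/= in_itv/= => /andP[h1 h2].
by rewrite /ecball/= /sph enorm_spherical ger0_norm.
Qed.

(** [er], [et] and [ep] form the moving frame of spherical coordinates. As functions of the angles
    they remain smooth at the centre and at the poles, where the coordinates degenerate. *)
Let er i (z : R3 R) : R := match i with
  0 => sin z.1.2 * cos z.2 | 1 => sin z.1.2 * sin z.2 | _ => cos z.1.2 end.
Let et i (z : R3 R) : R := match i with
  0 => cos z.1.2 * cos z.2 | 1 => cos z.1.2 * sin z.2 | _ => - sin z.1.2 end.
Let ep i (z : R3 R) : R := match i with 0 => - sin z.2 | 1 => cos z.2 | _ => 0 end.

Let G i z := g i (sph z).
Let ip (u v : nat -> R3 R -> R) z := u 0 z * v 0 z + u 1 z * v 1 z + u 2 z * v 2 z.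
Let Hv (v : nat -> R3 R -> R) i z :=
  h i 0 (sph z) * v 0 z + h i 1 (sph z) * v 1 z + h i 2 (sph z) * v 2 z.

(** Orthonormality in the form of the completeness relation, which is what converts Cartesian sums
    into frame components. *)
Let frame i j z : (i < 3)%N -> (j < 3)%N ->
  er i z * er j z + et i z * et j z + ep i z * ep j z = (i == j)%:R.
Proof.
have h1 := cos2Dsin2 z.1.2; have h2 := cos2Dsin2 z.2.
rewrite /er /et /ep.
move: (sin z.1.2) (cos z.1.2) (sin z.2) (cos z.2) h1 h2 => st ct sp cp h1 h2.
have e1 : ct ^+ 2 = 1 - st ^+ 2 by rewrite -h1; ring.
have e2 : cp ^+ 2 = 1 - sp ^+ 2 by rewrite -h2; ring.
case: i => [|[|[|//]]] _; case: j => [|[|[|//]]] _ /=.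
- by transitivity (cp ^+ 2 * (ct ^+ 2 + st ^+ 2) + sp ^+ 2); [ring|rewrite h1 mulr1 h2].
- by transitivity (cp * sp * (ct ^+ 2 + st ^+ 2) - cp * sp); [ring|rewrite h1; ring].
- by ring.
- by transitivity (cp * sp * (ct ^+ 2 + st ^+ 2) - cp * sp); [ring|rewrite h1; ring].
- by transitivity (sp ^+ 2 * (ct ^+ 2 + st ^+ 2) + cp ^+ 2); [ring|rewrite h1 mulr1 addrC h2].
- by ring.
- by ring.
- by ring.
- by transitivity (ct ^+ 2 + st ^+ 2); [ring|].
Qed.

Let parseval u v z :
  ip u v z = ip u er z * ip v er z + ip u et z * ip v et z + ip u ep z * ip v ep z.
Proof.
have f00 := frame z (isT : (0 < 3)%N) (isT : (0 < 3)%N).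
have f01 := frame z (isT : (0 < 3)%N) (isT : (1 < 3)%N).
have f02 := frame z (isT : (0 < 3)%N) (isT : (2 < 3)%N).
have f11 := frame z (isT : (1 < 3)%N) (isT : (1 < 3)%N).
have f12 := frame z (isT : (1 < 3)%N) (isT : (2 < 3)%N).
have f22 := frame z (isT : (2 < 3)%N) (isT : (2 < 3)%N).
rewrite /ip; move: (er 0 z) (er 1 z) (er 2 z) (et 0 z) (et 1 z) (et 2 z)
  (ep 0 z) (ep 1 z) (ep 2 z) f00 f01 f02 f11 f12 f22 => a0 a1 a2 b0 b1 b2 c0 c1 c2
  /= f00 f01 f02 f11 f12 f22.
transitivity (
  u 0 z * v 0 z * (a0 * a0 + b0 * b0 + c0 * c0) +
  (u 0 z * v 1 z + u 1 z * v 0 z) * (a0 * a1 + b0 * b1 + c0 * c1) +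
  (u 0 z * v 2 z + u 2 z * v 0 z) * (a0 * a2 + b0 * b2 + c0 * c2) +
  u 1 z * v 1 z * (a1 * a1 + b1 * b1 + c1 * c1) +
  (u 1 z * v 2 z + u 2 z * v 1 z) * (a1 * a2 + b1 * b2 + c1 * c2) +
  u 2 z * v 2 z * (a2 * a2 + b2 * b2 + c2 * c2)).
  by rewrite f00 f01 f02 f11 f12 f22; ring.
by ring.
Qed.

(** The trace does not depend on the orthonormal basis, and the Jacobian is trace free by [htr]. *)
Let trace_frame z : S z.1.1 ->
  ip (Hv er) er z + ip (Hv et) et z + ip (Hv ep) ep z = 0.
Proof.
move=> /sph_ball/htr tr0; rewrite -tr0.
have f00 := frame z (isT : (0 < 3)%N) (isT : (0 < 3)%N).
have f01 := frame z (isT : (0 < 3)%N) (isT : (1 < 3)%N).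
have f02 := frame z (isT : (0 < 3)%N) (isT : (2 < 3)%N).
have f11 := frame z (isT : (1 < 3)%N) (isT : (1 < 3)%N).
have f12 := frame z (isT : (1 < 3)%N) (isT : (2 < 3)%N).
have f22 := frame z (isT : (2 < 3)%N) (isT : (2 < 3)%N).
rewrite /ip /Hv (hC 1 0) (hC 2 0) (hC 2 1).
move: (er 0 z) (er 1 z) (er 2 z) (et 0 z) (et 1 z) (et 2 z)
  (ep 0 z) (ep 1 z) (ep 2 z) f00 f01 f02 f11 f12 f22 => a0 a1 a2 b0 b1 b2 c0 c1 c2
  /= f00 f01 f02 f11 f12 f22.
transitivity (h 0 0 (sph z) * (a0 * a0 + b0 * b0 + c0 * c0) +
  2 * h 0 1 (sph z) * (a0 * a1 + b0 * b1 + c0 * c1) +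
  2 * h 0 2 (sph z) * (a0 * a2 + b0 * b2 + c0 * c2) +
  h 1 1 (sph z) * (a1 * a1 + b1 * b1 + c1 * c1) +
  2 * h 1 2 (sph z) * (a1 * a2 + b1 * b2 + c1 * c2) +
  h 2 2 (sph z) * (a2 * a2 + b2 * b2 + c2 * c2)); first by ring.
by rewrite f00 f01 f02 f11 f12 f22; ring.
Qed.

Let Hv_sym u v z : ip (Hv u) v z = ip (Hv v) u z.
Proof. by rewrite /ip /Hv (hC 1 0) (hC 2 0) (hC 2 1); ring. Qed.

Let a := ip G er.
Let b := ip G et.
Let c := ip G ep.
Let N := ip G G.

(* The spherical components of |u|^2 x - 2 (x.u) u, each multiplied by the area
   factor s^2 sin t, s sin t or s of its coordinate surface; DA, DB and DC are
   the derivatives of A, B and C in s, t and p. *)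
Let A z := z.1.1 ^+ 3 * (sin z.1.2 * (N z - 2 * (a z * a z))).
Let B z := z.1.1 ^+ 2 * (sin z.1.2 * (- 2 * (a z * b z))).
Let C z := z.1.1 ^+ 2 * (- 2 * (a z * c z)).
Let DA z := 3 * z.1.1 ^+ 2 * (sin z.1.2 * (N z - 2 * (a z * a z))) +
  z.1.1 ^+ 3 * (sin z.1.2 * (2 * ip G (Hv er) z - 4 * (a z * ip (Hv er) er z))).
Let DB z := z.1.1 ^+ 2 * (- 2 * (cos z.1.2 * (a z * b z) + sin z.1.2 *
   ((z.1.1 * ip (Hv et) er z + b z) * b z + a z * (z.1.1 * ip (Hv et) et z - a z)))).
Let DC z := z.1.1 ^+ 2 * (- 2 *
  ((z.1.1 * sin z.1.2 * ip (Hv ep) er z + sin z.1.2 * c z) * c z +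
   a z * (z.1.1 * sin z.1.2 * ip (Hv ep) ep z - sin z.1.2 * a z - cos z.1.2 * b z))).

(** Once |u|^2 and u . (H er) are expanded in the frame, symmetry identifies the mixed entries of
    the Jacobian H and the trace removes the entry (ep, ep); a polynomial identity remains. *)
Let divergence_identity z : S z.1.1 ->
  DA z + DB z + DC z = z.1.1 ^+ 2 * sin z.1.2 * N z.
Proof.
move=> Sz; have tr0 := trace_frame Sz.
rewrite /DA /DB /DC [N z]parseval [ip G (Hv er) z]parseval -/(a z) -/(b z) -/(c z).
rewrite (Hv_sym er et) (Hv_sym er ep).
have -> : ip (Hv ep) ep z = - ip (Hv er) er z - ip (Hv et) et z.
  by move: tr0; lra.
by ring.
Qed.

(** The coordinate lines have velocities er, s et and s sin t ep; this is the chain rule along the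
    first, and the next two lemmas treat the others. *)
Let dG_s i (s t p : R) : (i < 3)%N -> S s ->
  is_derive s 1 (fun s => G i (s, t, p)) (Hv er i (s, t, p)).
Proof.
move=> i3 Ss.
apply: is_derive_eq; first apply: (@chain i (fun s => s * sin t * cos p) (fun s => s * sin t * sin p)
  (fun s => s * cos t) s _ _ _ i3).
- exact: (@sph_ball (s, t, p)).
by rewrite /Hv /er /sph /spherical /= /GRing.scale/=; ring.
Qed.

Let dG_t i (s t p : R) : (i < 3)%N -> S s ->
  is_derive t 1 (fun t => G i (s, t, p)) (s * Hv et i (s, t, p)).
Proof.
move=> i3 Ss.
apply: is_derive_eq; first apply: (@chain i (fun t => s * sin t * cos p) (fun t => s * sin t * sin p)
  (fun t => s * cos t) t _ _ _ i3).
- exact: (@sph_ball (s, t, p)).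
by rewrite /Hv /et /sph /spherical /= /GRing.scale/=; ring.
Qed.

Let dG_p i (s t p : R) : (i < 3)%N -> S s ->
  is_derive p 1 (fun p => G i (s, t, p)) (s * sin t * Hv ep i (s, t, p)).
Proof.
move=> i3 Ss.
apply: is_derive_eq; first apply: (@chain i (fun p => s * sin t * cos p) (fun p => s * sin t * sin p)
  (fun p => s * cos t) p _ _ _ i3).
- exact: (@sph_ball (s, t, p)).
by rewrite /Hv /ep /sph /spherical /= /GRing.scale/=; ring.
Qed.

Let dA (s t p : R) : S s ->
  is_derive s 1 (fun s => A (s, t, p)) (DA (s, t, p)).
Proof.
move=> Ss.
have d0 := dG_s t p (isT : (0 < 3)%N) Ss.
have d1 := dG_s t p (isT : (1 < 3)%N) Ss.
have d2 := dG_s t p (isT : (2 < 3)%N) Ss.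
have da : is_derive s 1 (fun s => a (s, t, p)) (ip (Hv er) er (s, t, p)).
  by rewrite /a /ip /=; apply: is_derive_eq; rewrite /er /= /GRing.scale/=; ring.
have dN : is_derive s 1 (fun s => N (s, t, p)) (2 * ip G (Hv er) (s, t, p)).
  by rewrite /N /ip /=; apply: is_derive_eq; rewrite /= /GRing.scale/=; ring.
by rewrite /A /=; apply: is_derive_eq; rewrite /DA /= /GRing.scale/=; ring.
Qed.

Let dB (s t p : R) : S s ->
  is_derive t 1 (fun t => B (s, t, p)) (DB (s, t, p)).
Proof.
move=> Ss.
have d0 := dG_t t p (isT : (0 < 3)%N) Ss.
have d1 := dG_t t p (isT : (1 < 3)%N) Ss.
have d2 := dG_t t p (isT : (2 < 3)%N) Ss.
(* The terms without the Jacobian come from the rotation of the frame: the t-derivatives of er and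
   et are et and - er. *)
have da : is_derive t 1 (fun t => a (s, t, p)) (s * ip (Hv et) er (s, t, p) + b (s, t, p)).
  by rewrite /a /b /ip /er /et /=; apply: is_derive_eq; rewrite /= /GRing.scale/=; ring.
have db : is_derive t 1 (fun t => b (s, t, p)) (s * ip (Hv et) et (s, t, p) - a (s, t, p)).
  by rewrite /a /b /ip /er /et /=; apply: is_derive_eq; rewrite /= /GRing.scale/=; ring.
by rewrite /B /=; apply: is_derive_eq; rewrite /DB /= /GRing.scale/=; ring.
Qed.

Let dC (s t p : R) : S s ->
  is_derive p 1 (fun p => C (s, t, p)) (DC (s, t, p)).
Proof.
move=> Ss.
have d0 := dG_p t p (isT : (0 < 3)%N) Ss.
have d1 := dG_p t p (isT : (1 < 3)%N) Ss.
have d2 := dG_p t p (isT : (2 < 3)%N) Ss.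
have da : is_derive p 1 (fun p => a (s, t, p)) (s * sin t * ip (Hv ep) er (s, t, p) + sin t * c (s, t, p)).
  by rewrite /a /c /ip /er /ep /=; apply: is_derive_eq; rewrite /= /GRing.scale/=; ring.
(* The p-derivative of ep is the horizontal vector - (sin t er + cos t et); writing it in the frame
   uses cos^2 t + sin^2 t = 1. *)
have dc : is_derive p 1 (fun p => c (s, t, p))
    (s * sin t * ip (Hv ep) ep (s, t, p) - sin t * a (s, t, p) - cos t * b (s, t, p)).
  have h1 := cos2Dsin2 t.
  rewrite /a /b /c /ip /er /et /ep /=; apply: is_derive_eq; rewrite /= /GRing.scale/=.
  transitivity (s * sin t * ip (Hv ep) ep (s, t, p) - (cos t ^+ 2 + sin t ^+ 2) *
     (G 0 (s, t, p) * cos p + G 1 (s, t, p) * sin p)); last by rewrite /ip /ep /=; ring.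
  by rewrite h1 /ip /ep /=; ring.
by rewrite /C /=; apply: is_derive_eq; rewrite /DC /= /GRing.scale/=; ring.
Qed.

Local Notation nice := (regular Box).
Let niceD f1 f2 := @regularD R Box f1 f2.
Let niceM f1 f2 := @regularM R Box f1 f2.
Let niceN f1 := @regularN R Box f1.
Let niceX n f1 := @regularX R Box n f1.
Let niceC k := @regular_cst R Box k.
Let nice_crd i := @regular_crd R Box i.
Let nice_comp k i := @regular_comp R Box k i.

Let nice_s : nice (fun z => z.1.1). Proof. exact: (nice_crd 0). Qed.
Let nice_sint : nice (fun z => sin z.1.2).
Proof. by apply: (nice_comp 1); exact: continuous_sin. Qed.
Let nice_cost : nice (fun z => cos z.1.2).
Proof. by apply: (nice_comp 1); exact: continuous_cos. Qed.
Let nice_sinp : nice (fun z => sin z.2).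
Proof. by apply: (nice_comp 2); exact: continuous_sin. Qed.
Let nice_cosp : nice (fun z => cos z.2).
Proof. by apply: (nice_comp 2); exact: continuous_cos. Qed.

Let cvg3 (F : R3 R -> R3 R) z : (forall i, {for z, continuous (fun w => crd i (F w))}) ->
  {for z, continuous F}.
Proof.
move=> cF.
rewrite (_ : F = fun w => (crd 0 (F w), crd 1 (F w), crd 2 (F w))); last first.
  by apply/funext => w; case: (F w) => -[].
have c12 : (crd 0 (F w), crd 1 (F w)) @[w --> z] --> (crd 0 (F z), crd 1 (F z)).
  exact: (cvg_pair (cF 0) (cF 1)).
exact: (cvg_pair c12 (cF 2)).
Qed.

Let nice_sph i : nice (fun z => crd i (sph z)).
Proof.
case: i => [|[|i]].
- exact: (niceM (niceM nice_s nice_sint) nice_cosp).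
- exact: (niceM (niceM nice_s nice_sint) nice_sinp).
- exact: (niceM nice_s nice_cost).
Qed.

Let measurable_sph : measurable_fun setT (sph : mR3 R -> mR3 R).
Proof.
rewrite (_ : sph = fun w => (crd 0 (sph w), crd 1 (sph w), crd 2 (sph w)))//.
by apply: measurable_fun_pair; [apply: measurable_fun_pair|];
  [exact: (regular_measurable (nice_sph 0))|exact: (regular_measurable (nice_sph 1))|exact: (regular_measurable (nice_sph 2))].
Qed.

Let nice_sph_comp (k : R3 R -> R) : measurable_fun setT (k : mR3 R -> R) ->
  (forall x, ecball r x -> {for x, continuous k}) -> nice (fun z => k (sph z)).
Proof.
move=> mk ck; apply: Regular; first exact: (measurableT_comp mk).
move=> z Bz; apply: (@continuous_comp _ _ _ sph k).
  by apply: cvg3 => i; exact: (regular_continuous (nice_sph i)).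
by apply: ck; apply: sph_ball; case: Bz => -[].
Qed.

Let niceG i : nice (G i).
Proof. by apply: nice_sph_comp; [exact: mg|exact: cg]. Qed.
Let nice_h i j : nice (fun z => h i j (sph z)).
Proof. by apply: nice_sph_comp; [exact: mh|exact: ch]. Qed.

Let nice_er i : nice (er i).
Proof.
case: i => [|[|i]].
- exact: (niceM nice_sint nice_cosp).
- exact: (niceM nice_sint nice_sinp).
- exact: nice_cost.
Qed.
Let nice_et i : nice (et i).
Proof.
case: i => [|[|i]].
- exact: (niceM nice_cost nice_cosp).
- exact: (niceM nice_cost nice_sinp).
- exact: (niceN nice_sint).
Qed.
Let nice_ep i : nice (ep i).
Proof.
case: i => [|[|i]].
- exact: (niceN nice_sinp).
- exact: nice_cosp.
- exact: niceC.
Qed.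

Let nice_ip u v : (forall i, nice (u i)) -> (forall i, nice (v i)) -> nice (ip u v).
Proof.
move=> nu nv.
exact: (niceD (niceD (niceM (nu 0) (nv 0)) (niceM (nu 1) (nv 1))) (niceM (nu 2) (nv 2))).
Qed.

Let nice_Hv v : (forall i, nice (v i)) -> forall i, nice (Hv v i).
Proof.
move=> nv i.
exact: (niceD (niceD (niceM (nice_h i 0) (nv 0)) (niceM (nice_h i 1) (nv 1)))
  (niceM (nice_h i 2) (nv 2))).
Qed.

Let nice_a : nice a. Proof. exact: (nice_ip niceG nice_er). Qed.
Let nice_b : nice b. Proof. exact: (nice_ip niceG nice_et). Qed.
Let nice_c : nice c. Proof. exact: (nice_ip niceG nice_ep). Qed.
Let nice_N : nice N. Proof. exact: (nice_ip niceG niceG). Qed.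

Let niceDA : nice DA.
Proof.
have n1 : nice (fun z => sin z.1.2 * (N z - 2 * (a z * a z))).
  exact: (niceM nice_sint (niceD nice_N (niceN (niceM (niceC 2) (niceM nice_a nice_a))))).
have n2 := nice_ip niceG (nice_Hv nice_er).
have n3 := niceN (niceM (niceC 4) (niceM nice_a (nice_ip (nice_Hv nice_er) nice_er))).
exact: (niceD (niceM (niceM (niceC 3) (niceX 2 nice_s)) n1)
  (niceM (niceX 3 nice_s) (niceM nice_sint (niceD (niceM (niceC 2) n2) n3)))).
Qed.

Let niceDB : nice DB.
Proof.
have n1 := niceD (niceM nice_s (nice_ip (nice_Hv nice_et) nice_er)) nice_b.
have n2 := niceD (niceM nice_s (nice_ip (nice_Hv nice_et) nice_et)) (niceN nice_a).
exact: (niceM (niceX 2 nice_s) (niceM (niceC (- 2))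
  (niceD (niceM nice_cost (niceM nice_a nice_b))
    (niceM nice_sint (niceD (niceM n1 nice_b) (niceM nice_a n2)))))).
Qed.

Let niceDC : nice DC.
Proof.
have n1 := niceD (niceM (niceM nice_s nice_sint) (nice_ip (nice_Hv nice_ep) nice_er)) (niceM nice_sint nice_c).
have n2 := niceD (niceD (niceM (niceM nice_s nice_sint) (nice_ip (nice_Hv nice_ep) nice_ep))
  (niceN (niceM nice_sint nice_a))) (niceN (niceM nice_cost nice_b)).
exact: (niceM (niceX 2 nice_s) (niceM (niceC (- 2))
  (niceD (niceM n1 nice_c) (niceM nice_a n2)))).
Qed.

Let compact_Box : compact Box.
Proof.
by apply: compact_setX; [apply: compact_setX|]; exact: segment_compact.
Qed.

Let nice_bounded f := @regular_bounded R Box f compact_Box.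

Let n2 x : R := g 0 x * g 0 x + g 1 x * g 1 x + g 2 x * g 2 x.
Let W z := z.1.1 ^+ 2 * sin z.1.2 * N z.

Let n2_ge0 x : 0 <= n2 x.
Proof. by rewrite !addr_ge0// -expr2 sqr_ge0. Qed.

Let measurable_n2 : measurable_fun setT (n2 : mR3 R -> R).
Proof. by apply: measurable_funD; [apply: measurable_funD|]; exact: measurable_funM. Qed.

Let sinT t : T t -> 0 <= sin t.
Proof. by rewrite /T/= in_itv/= => h1; exact: sin_ge0_pi. Qed.

Let W0 s t p : S s -> T t -> P p -> (0 <= (W (s, t, p))%:E)%E.
Proof.
move=> _ /sinT st0 _; rewrite lee_fin /W mulr_ge0//; last exact: n2_ge0.
by rewrite mulr_ge0// sqr_ge0.
Qed.

Let mS : measurable (S : set (measurableTypeR R)). Proof. exact: measurable_itv. Qed.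
Let mT : measurable (T : set (measurableTypeR R)). Proof. exact: measurable_itv. Qed.
Let mP : measurable (P : set (measurableTypeR R)). Proof. exact: measurable_itv. Qed.
Let mBox : measurable (Box : set (mR3 R)).
Proof. by apply: measurableX => //; exact: measurableX. Qed.

Let niceW : nice W.
Proof. exact: (niceM (niceM (niceX 2 nice_s) nice_sint) nice_N). Qed.

Lemma ball_integral_box :
  (\int[lebesgue3 R]_(x in ecball r) (n2 x)%:E = \int[lebesgue3 R]_(z in Box) (W z)%:E)%E.
Proof.
have mB : measurable (ecball r : set (mR3 R)).
  rewrite (_ : ecball r = enorm @^-1` `]-oo, r]%classic); last first.
    by apply/seteqP; split => x; rewrite /ecball/= in_itv.
  by rewrite -[X in measurable X]setTI; apply: measurable_enorm.
rewrite [LHS]integral_mkcond (@ge0_integral_spherical _ ((EFin \o n2) \_ (ecball r))); last 2 first.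
- by apply: (measurable_restrictT _ _).1 => //; apply/measurable_EFinP; exact: measurable_funTS.
- by move=> x; rewrite patchE; case: ifPn => // _; rewrite lee_fin.
rewrite [RHS](@box_integral_p_t_s _ S T P (EFin \o W) mS mT mP _ W0); last first.
  by apply/measurable_EFinP; exact: (regular_measurable niceW).
apply: eq_integral => p _; apply: eq_integral => t /set_mem Tt.
rewrite [LHS]integral_mkcond [RHS]integral_mkcond; apply: eq_integral => s _.
rewrite !patchE.
have -> : (spherical s (t, p) \in (ecball r : set (R3 R))) = (`|s| <= r).
  by apply/idP/idP; rewrite inE /ecball/= enorm_spherical.
have -> : (s \in `]0%R, +oo[%classic) = (0 < s) by rewrite mem_setE in_itv/= andbT.
have -> : (s \in S) = (0 <= s <= r) by rewrite mem_setE in_itv.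
have [s0|s0] := ltP 0 s.
  rewrite (ltW s0) gtr0_norm//=; case: ifPn => _; last by rewrite mul0e.
  by rewrite -EFinM /W /N /ip /G /sph /= mulrC.
case: ifPn => // /andP[s0' _].
(* The box contains s = 0, which the spherical formula leaves out; the weight s^2 vanishes there. *)
have -> : s = 0 by apply/eqP; rewrite eq_le s0 s0'.
by rewrite /W /= expr0n/= !mul0r.
Qed.

Let Box_nice_line1 f s t p : nice f -> S s -> T t -> P p ->
  {for s, continuous (fun s => f (s, t, p))}.
Proof.
move=> nf Ss Tt Pp.
apply: (@continuous_comp _ _ _ (fun s : R => (s, t, p) : R3 R) f); last exact: (regular_continuous nf).
have c12 : (s', t) @[s' --> s] --> (s, t) by exact: (cvg_pair cvg_id (cvg_cst t)).
exact: (cvg_pair c12 (cvg_cst p)).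
Qed.

Let Box_nice_line2 f s t p : nice f -> S s -> T t -> P p ->
  {for t, continuous (fun t => f (s, t, p))}.
Proof.
move=> nf Ss Tt Pp.
apply: (@continuous_comp _ _ _ (fun t : R => (s, t, p) : R3 R) f); last exact: (regular_continuous nf).
have c12 : (s, t') @[t' --> t] --> (s, t) by exact: (cvg_pair (cvg_cst s) cvg_id).
exact: (cvg_pair c12 (cvg_cst p)).
Qed.

Let Box_nice_line3 f s t p : nice f -> S s -> T t -> P p ->
  {for p, continuous (fun p => f (s, t, p))}.
Proof.
move=> nf Ss Tt Pp.
apply: (@continuous_comp _ _ _ (fun p : R => (s, t, p) : R3 R) f); last exact: (regular_continuous nf).
exact: (cvg_pair (cvg_cst (s, t)) cvg_id).
Qed.

Let FTC2_shift (F f : R -> R) (k x y : R) : x <= y ->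
  (forall z, x <= z <= y -> is_derive z 1 F (f z)) ->
  (forall z, x <= z <= y -> {for z, continuous f}) ->
  (\int[mu]_(z in `[x, y]) (f z + k)%:E = (F y - F x + k * (y - x))%:E)%E.
Proof.
move=> xy dF cf.
have dFk z : x <= z <= y -> is_derive z 1 (fun z => F z + k * z) (f z + k).
  by move=> /dF dFz; apply: is_derive_eq; rewrite /GRing.scale/=; ring.
have cfk z : x <= z <= y -> {for z, continuous (fun z => f z + k)}.
  by move=> /cf cfz; apply: cvgD => //; exact: cvg_cst.
by rewrite (FTC2_is_derive xy dFk cfk); congr EFin; ring.
Qed.

Let integral_cst_itv (k x y : R) : x <= y ->
  (\int[mu]_(z in `[x, y]) k%:E = (k * (y - x))%:E)%E.
Proof.
move=> xy.
have dk z : x <= z <= y -> is_derive z 1 (fun z => k * z) k.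
  by move=> _; apply: is_derive_eq; rewrite /GRing.scale/=; ring.
have ck z : x <= z <= y -> {for z, continuous (fun=> k)}.
  by move=> _; exact: cvg_cst.
by rewrite (FTC2_is_derive xy dk ck); congr EFin; ring.
Qed.

Let pi0 : 0 <= pi :> R := pi_ge0 R.

(** The lower boundary term disappears because [A] carries the factor s^3. *)
Let int_DA k t p : T t -> P p ->
  (\int[mu]_(s in S) (DA (s, t, p) + k)%:E = (A (r, t, p) + k * r)%:E)%E.
Proof.
move=> Tt Pp; have hS s : 0 <= s <= r -> S s by rewrite /S/= in_itv.
rewrite (FTC2_shift k (ltW r0) (fun s hs => dA t p (hS s hs))
  (fun s hs => Box_nice_line1 niceDA (hS s hs) Tt Pp)).
by congr EFin; rewrite {2}/A /= expr0n /= mul0r !subr0.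
Qed.

(** [B] carries the factor sin t, so it vanishes at both poles and only the shift survives. *)
Let int_DB k s p : S s -> P p ->
  (\int[mu]_(t in T) (DB (s, t, p) + k)%:E = \int[mu]_(t in T) k%:E)%E.
Proof.
move=> Ss Pp; have hT t : 0 <= t <= pi -> T t by rewrite /T/= in_itv.
rewrite (FTC2_shift k pi0 (fun t ht => dB t p Ss)
  (fun t ht => Box_nice_line2 niceDB Ss (hT t ht) Pp)).
rewrite (integral_cst_itv k pi0); congr EFin.
by rewrite /B /= sinpi sin0 !mul0r mulr0 subrr add0r.
Qed.

(** [C] is periodic in the azimuth, so its two boundary values cancel. *)
Let int_DC k s t : S s -> T t ->
  (\int[mu]_(p in P) (DC (s, t, p) + k)%:E = \int[mu]_(p in P) k%:E)%E.
Proof.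
move=> Ss Tt; have pi20 : 0 <= 2 * pi :> R by rewrite mulr_ge0.
have hP p : 0 <= p <= 2 * pi -> P p by rewrite /P/= in_itv.
rewrite (FTC2_shift k pi20 (fun p hp => dC t p Ss)
  (fun p hp => Box_nice_line3 niceDC Ss Tt (hP p hp))).
rewrite (integral_cst_itv k pi20); congr EFin.
rewrite (_ : C (s, t, 2 * pi) = C (s, t, 0)) ?subrr ?add0r//.
have e1 : cos (2 * pi) = cos 0 :> R by rewrite mulrC mulr_natr cos2pi cos0.
have e2 : sin (2 * pi) = sin 0 :> R by rewrite mulrC mulr_natr sin2pi sin0.
by rewrite /C /a /c /ip /G /sph /er /ep /spherical /= e1 e2.
Qed.

(** The right side is the flux of [A] through s = r after its nonpositive part - 2 a^2 has been
    dropped. All integrals in the proof have nonnegative integrands, thanks to the shifts [kA], [kB]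
    and [kC]. *)
Let box_inequality :
  (\int[lebesgue3 R]_(z in Box) (W z)%:E <=
   r%:E * \int[lebesgue2 R]_(z in angles) (n2 (spherical r z) * (r ^+ 2 * sin z.1))%:E)%E.
Proof.
have [kA kA0 hA] := nice_bounded niceDA.
have [kB kB0 hB] := nice_bounded niceDB.
have [kC kC0 hC'] := nice_bounded niceDC.
(* The contribution of a shift k to the integral over the box. Its finiteness is what allows the
   final cancellation. *)
pose V (k : R) : \bar R := (\int[lebesgue3 R]_(z in Box) k%:E)%E.
have Vfin k : V k \is a fin_num.
  rewrite /V (@integral_cst _ _ _ (lebesgue3 R) Box mBox k%:E).
  apply: fin_numM => //; rewrite ge0_fin_numE//.
  have l2fin : (lebesgue2 R (S `*` T) < +oo)%E.
    rewrite product_measure1E//; apply: lte_mul_pinfty; first exact: measure_ge0.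
      by rewrite ge0_fin_numE; [exact: lebesgue_segment_lty|exact: measure_ge0].
    exact: lebesgue_segment_lty.
  rewrite [X in (X < _)%E](@product_measure1E _ _ _ _ R (lebesgue2 R) sf_lebesgue1)//; last exact: measurableX.
  apply: lte_mul_pinfty; first exact: measure_ge0.
    by rewrite ge0_fin_numE; [exact: l2fin|exact: measure_ge0].
  exact: lebesgue_segment_lty.
have mD f k : nice f -> measurable_fun setT (fun z : mR3 R => (f z + k)%:E).
  by move=> nf; apply/measurable_EFinP; exact: (regular_measurable (niceD nf (niceC k))).
have k0 (k : R) : 0 <= k -> forall s t p : R, S s -> T t -> P p -> (0 <= k%:E)%E.
  by move=> k0 s t p _ _ _; rewrite lee_fin.
have mK (k : R) : measurable_fun setT (fun _ : mR3 R => k%:E) by exact: measurable_cst.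
have XB : (\int[lebesgue3 R]_(z in Box) (DB z + kB)%:E = V kB)%E.
  have DB0 s t p : S s -> T t -> P p -> (0 <= (DB (s, t, p) + kB)%:E)%E.
    by move=> Ss Tt Pp; rewrite lee_fin; exact: hB.
  rewrite [LHS](@box_integral_p_s_t _ S T P _ mS mT mP (mD _ kB niceDB) DB0).
  rewrite /V [RHS](@box_integral_p_s_t _ S T P (fun=> kB%:E) mS mT mP (mK kB) (k0 kB kB0)).
  apply: eq_integral => p /set_mem Pp; apply: eq_integral => s /set_mem Ss.
  exact: int_DB.
have XC : (\int[lebesgue3 R]_(z in Box) (DC z + kC)%:E = V kC)%E.
  have DC0 s t p : S s -> T t -> P p -> (0 <= (DC (s, t, p) + kC)%:E)%E.
    by move=> Ss Tt Pp; rewrite lee_fin; exact: hC'.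
  rewrite [LHS](@box_integral_stp _ S T P _ mS mT mP (mD _ kC niceDC) DC0).
  rewrite /V [RHS](@box_integral_stp _ S T P (fun=> kC%:E) mS mT mP (mK kC) (k0 kC kC0)).
  by apply: eq_integral => -[s t] /set_mem [Ss Tt]; exact: int_DC.
pose Z : \bar R := (\int[lebesgue2 R]_(z in T `*` P) (r ^+ 3 * (sin z.1 * n2 (spherical r z)))%:E)%E.
have mtp : measurable_fun setT (fun z : mR2 R => (r, z.1, z.2) : mR3 R).
  by apply: measurable_fun_pair => //; apply: measurable_fun_pair.
have msph : measurable_fun setT (fun z : mR2 R => n2 (spherical r z)).
  by apply: (measurableT_comp measurable_n2); exact: measurable_spherical.
have [ms _ _ _] := @measurable_cot_weight R.
have mZ : measurable_fun setT (fun z : mR2 R => r ^+ 3 * (sin z.1 * n2 (spherical r z))).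
  by apply: measurable_funM => //; apply: measurable_funM => //; exact: (measurableT_comp ms).
have Z0 z : (T `*` P) z -> 0 <= r ^+ 3 * (sin z.1 * n2 (spherical r z)).
  by move=> [Tt _]; rewrite mulr_ge0 ?exprn_ge0 ?mulr_ge0 ?sinT// ltW.
have Sr : S r by rewrite /S/= in_itv/= lexx ltW.
have nA : nice A.
  exact: (niceM (niceX 3 nice_s) (niceM nice_sint
    (niceD nice_N (niceN (niceM (niceC 2) (niceM nice_a nice_a)))))).
have mA : measurable_fun setT (fun z : mR2 R => A (r, z.1, z.2)).
  by apply: (@measurableT_comp _ _ _ _ _ _ (A : mR3 R -> R)); [exact: (regular_measurable nA)|exact: mtp].
have kAr : 0 <= kA * r by rewrite mulr_ge0// ltW.
(* [A] alone has no sign; the shifted value is nonnegative because it is the integral of [DA + kA]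
   over s. *)
have A0 z : (T `*` P) z -> 0 <= A (r, z.1, z.2) + kA * r.
  move=> [Tt Pp]; rewrite -lee_fin -int_DA//; apply: integral_ge0 => s Ss.
  by rewrite lee_fin; exact: hA.
have mTP : measurable (T `*` P : set (mR2 R)) by exact: measurableX.
have eVA : (V kA = \int[lebesgue2 R]_(z in T `*` P) (kA * r)%:E)%E.
  rewrite /V [LHS](@box_integral_p_t_s _ S T P (fun=> kA%:E) mS mT mP (mK kA) (k0 kA kA0)).
  have kAr0 (t p : R) : T t -> P p -> (0 <= (kA * r)%:E)%E by move=> _ _; rewrite lee_fin.
  rewrite [RHS](@ge0_integral_setX2 _ _ _ _ R sf_lebesgue1 sf_lebesgue1 T P (fun=> (kA * r)%:E)
     mT mP (measurable_cst _) kAr0).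
  apply: eq_integral => p _; apply: eq_integral => t _.
  by rewrite /S integral_cst_itv ?subr0// ltW.
have eA : (\int[lebesgue3 R]_(z in Box) (DA z + kA)%:E =
    \int[lebesgue2 R]_(z in T `*` P) (A (r, z.1, z.2) + kA * r)%:E)%E.
  have DA0 s t p : S s -> T t -> P p -> (0 <= (DA (s, t, p) + kA)%:E)%E.
    by move=> Ss Tt Pp; rewrite lee_fin; exact: hA.
  rewrite [LHS](@box_integral_p_t_s _ S T P _ mS mT mP (mD _ kA niceDA) DA0).
  have A0' (t p : R) : T t -> P p -> (0 <= (A (r, t, p) + kA * r)%:E)%E.
    by move=> Tt Pp; rewrite lee_fin; exact: (A0 (t, p)).
  have mA' : measurable_fun setT (fun z : mR2 R => (A (r, z.1, z.2) + kA * r)%:E).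
    by apply/measurable_EFinP; apply: measurable_funD.
  rewrite [RHS](@ge0_integral_setX2 _ _ _ _ R sf_lebesgue1 sf_lebesgue1 T P
    (fun z => (A (r, z.1, z.2) + kA * r)%:E) mT mP mA' A0').
  apply: eq_integral => p /set_mem Pp; apply: eq_integral => t /set_mem Tt.
  exact: int_DA.
have XA : (\int[lebesgue3 R]_(z in Box) (DA z + kA)%:E <= Z + V kA)%E.
  move: eA eVA => -> ->.
  have -> : (Z + \int[lebesgue2 R]_(z in T `*` P) (kA * r)%:E =
      \int[lebesgue2 R]_(z in T `*` P) ((r ^+ 3 * (sin z.1 * n2 (spherical r z)))%:E + (kA * r)%:E))%E.
    rewrite [RHS]ge0_integralD; [by []|exact: mTP| | | |exact: measurable_cst].
    - by move=> z /Z0; rewrite lee_fin.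
    - by apply/measurable_EFinP; exact: measurable_funTS.
    - by move=> z _; rewrite lee_fin.
  apply: ge0_le_integral => //.
  - by apply/measurable_EFinP; apply: measurable_funTS; apply: measurable_funD.
  - apply: emeasurable_funD; last exact: measurable_cst.
    by apply/measurable_EFinP; exact: measurable_funTS.
  - move=> z [Tt Pp]; rewrite -EFinD lee_fin lerD2r /A /=.
    have r30 : 0 <= r ^+ 3 by rewrite exprn_ge0// ltW.
    rewrite (ler_wpM2l r30)// (ler_wpM2l (sinT Tt))//.
    rewrite (_ : n2 (spherical r z) = N (r, z.1, z.2)); last by rewrite /N /ip /G /sph /=; case: z {Tt Pp}.
    by rewrite gerBl mulr_ge0// -expr2 sqr_ge0.
have K0 : 0 <= kA + kB + kC by rewrite !addr_ge0.
have VD : V (kA + kB + kC) = (V kA + V kB + V kC)%E.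
  rewrite /V !(@integral_cst _ _ _ (lebesgue3 R) Box mBox _%:E).
  by rewrite -!ge0_muleDl// -?EFinD ?lee_fin ?addr_ge0.
have mWb k : measurable_fun Box (fun z : mR3 R => (W z + k)%:E).
  by apply: measurable_funTS; exact: mD.
have mDT f k : nice f -> measurable_fun Box (fun z : mR3 R => (f z + k)%:E).
  by move=> nf; apply: measurable_funTS; exact: mD.
have eW : (\int[lebesgue3 R]_(z in Box) (W z)%:E + V (kA + kB + kC)%R =
    \int[lebesgue3 R]_(z in Box) (W z + (kA + kB + kC))%R%:E)%E.
  rewrite /V -ge0_integralD//.
  - by move=> [[s t] p] [[Ss Tt] Pp]; exact: W0.
  - by apply/measurable_EFinP; apply: measurable_funTS; exact: (regular_measurable niceW).
have eD : (\int[lebesgue3 R]_(z in Box) (W z + (kA + kB + kC))%R%:E =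
    \int[lebesgue3 R]_(z in Box) (DA z + kA)%R%:E + \int[lebesgue3 R]_(z in Box) (DB z + kB)%R%:E
    + \int[lebesgue3 R]_(z in Box) (DC z + kC)%R%:E)%E.
  transitivity (\int[lebesgue3 R]_(z in Box) (((DA z + kA)%R%:E + (DB z + kB)%R%:E) + (DC z + kC)%R%:E))%E.
    apply: eq_integral => -[[s t] p] /set_mem [[Ss Tt] Pp]; rewrite -!EFinD; congr EFin.
    by rewrite /W -divergence_identity//; ring.
  have a0 z : Box z -> (0 <= (DA z + kA)%R%:E)%E by move=> Bz; rewrite lee_fin hA.
  have b0 z : Box z -> (0 <= (DB z + kB)%R%:E)%E by move=> Bz; rewrite lee_fin hB.
  have c0 z : Box z -> (0 <= (DC z + kC)%R%:E)%E by move=> Bz; rewrite lee_fin hC'.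
  have ab0 z : Box z -> (0 <= (DA z + kA)%R%:E + (DB z + kB)%R%:E)%E.
    by move=> Bz; apply: adde_ge0; [exact: a0|exact: b0].
  have mAB := emeasurable_funD (mDT _ kA niceDA) (mDT _ kB niceDB).
  rewrite [LHS](ge0_integralD _ mBox ab0 mAB c0 (mDT _ kC niceDC)).
  congr (_ + _)%E.
  exact: (ge0_integralD _ mBox a0 (mDT _ kA niceDA) b0 (mDT _ kB niceDB)).
(* [DB] and [DC] contribute exactly their shifts, so the same finite quantity appears on both
   sides. *)
have main : (\int[lebesgue3 R]_(z in Box) (W z)%:E + V (kA + kB + kC)%R <= Z + V (kA + kB + kC)%R)%E.
  move: eW eD XA XB XC => -> -> XA -> ->.
  rewrite VD; apply: (le_trans (leeD2r _ (leeD2r _ XA))).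
  by rewrite !addeA.
have {}main : (\int[lebesgue3 R]_(z in Box) (W z)%:E <= Z)%E.
  by rewrite -(leeD2rE _ _ (Vfin (kA + kB + kC)%R)).
apply: (le_trans main).
have n0 z : angles z -> (0 <= (n2 (spherical r z) * (r ^+ 2 * sin z.1))%:E)%E.
  by move=> [Tt _]; rewrite lee_fin mulr_ge0// mulr_ge0 ?sqr_ge0// sinT.
have mn : measurable_fun angles (fun z : mR2 R => (n2 (spherical r z) * (r ^+ 2 * sin z.1))%:E).
  apply/measurable_EFinP; apply: measurable_funTS; apply: measurable_funM => //.
  by apply: measurable_funM => //; exact: (measurableT_comp ms).
rewrite -(ge0_integralZl_EFin (lebesgue2 R) (@measurable_angles R) n0 mn (ltW r0)).
rewrite le_eqVlt; apply/orP; left; apply/eqP.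
apply: eq_integral => z _; rewrite -EFinM; congr EFin; ring.
Qed.

Lemma rellich_inequality :
  (\int[lebesgue3 R]_(x in ecball r) (n2 x)%:E <=
   r%:E * \int[lebesgue2 R]_(z in angles) (n2 (spherical r z) * (r ^+ 2 * sin z.1))%:E)%E.
Proof. exact: (eq_ind_r (fun x => x <= _)%E box_inequality ball_integral_box). Qed.

End rellich.

(** * Riesz representation *)

Section gram_minimization.
Context {R : realType} {T : Type} (k : T -> T -> R) (L : T -> R) (C : R).
Implicit Types l : seq (R * T).

(** Lists of pairs (coefficient, index) are formal finite combinations. No quotient by the relations
    between the generators is taken: [bound] already forces [lin] to vanish on null combinations. *)
Definition gram l l' : R := \sum_(p <- l) \sum_(q <- l') p.1 * q.1 * k p.2 q.2.

Definition lin l : R := \sum_(p <- l) p.1 * L p.2.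

Definition scalel (a : R) l := [seq (a * p.1, p.2) | p <- l].

Hypotheses (kC : forall s t, k s t = k t s) (C0 : 0 <= C)
  (gram_ge0 : forall l, 0 <= gram l l)
  (bound : forall l, lin l ^+ 2 <= C * gram l l).

Lemma gramC l l' : gram l l' = gram l' l.
Proof.
rewrite /gram exchange_big; apply: eq_bigr => p _; apply: eq_bigr => q _.
by rewrite kC; ring.
Qed.

Lemma gram_catl l1 l2 l : gram (l1 ++ l2) l = gram l1 l + gram l2 l.
Proof. by rewrite /gram big_cat. Qed.

Lemma gram_catr l1 l2 l : gram l (l1 ++ l2) = gram l l1 + gram l l2.
Proof. by rewrite gramC gram_catl !(gramC l). Qed.

Lemma gram_scalel a l l' : gram (scalel a l) l' = a * gram l l'.
Proof.
rewrite /gram big_map mulr_sumr; apply: eq_bigr => p _.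
by rewrite mulr_sumr; apply: eq_bigr => q _ /=; ring.
Qed.

Lemma gram_scaler a l l' : gram l (scalel a l') = a * gram l l'.
Proof. by rewrite gramC gram_scalel gramC. Qed.

Lemma lin_cat l1 l2 : lin (l1 ++ l2) = lin l1 + lin l2.
Proof. by rewrite /lin big_cat. Qed.

Lemma lin_scale a l : lin (scalel a l) = a * lin l.
Proof. by rewrite /lin big_map mulr_sumr; apply: eq_bigr => p _ /=; ring. Qed.

Definition subl l l' := l ++ scalel (- 1) l'.

Let J l := gram l l - 2 * lin l.

(** With q = [gram l l] and x = [lin l], a value below - C would give (q + C)^2 < 4 x^2 <= 4 C q,
    against (q - C)^2 >= 0. *)
Let J_ge l : - C <= J l.
Proof.
rewrite /J; have := bound l; have := gram_ge0 l.
move: (gram l l) (lin l) => q x q0 xq.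
rewrite leNgt; apply/negP => h.
have h1 : q + C < 2 * x by lra.
have h2 : (q + C) ^+ 2 < (2 * x) ^+ 2.
  have qC : 0 <= q + C by rewrite addr_ge0.
  have x2 : 0 <= 2 * x by lra.
  by rewrite ltr_pXn2r.
have := sqr_ge0 (q - C); nra.
Qed.

(* Minimizing the energy [gram l l - 2 * lin l] replaces a completeness argument
   on the abstract span. *)
Lemma gram_minimizing_sequence : exists l_ : nat -> seq (R * T),
  (forall n, gram (subl (l_ n.+1) (l_ n)) (subl (l_ n.+1) (l_ n)) <= 4 * (16 ^- n)) /\
  (forall n t, (gram (l_ n) [:: (1, t)] - L t) ^+ 2 <= 16 ^- n * (k t t + 1)).
Proof.
pose E := range J.
have lbE : has_lbound E by exists (- C) => _ [l _ <-]; exact: J_ge.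
have infE : has_inf E by split => //; exists (J [::]), [::].
have J_inf l : inf E <= J l by apply: ge_inf => //; exists l.
have /choice[l_ Hl] : forall n : nat, exists l, J l < inf E + 16 ^- n.
  move=> n; have e0 : 0 < (16 : R) ^- n by rewrite invr_gt0 exprn_gt0.
  by have [_ [l _ <-] hl] := inf_adherent e0 infE; exists l.
exists l_; split => [n|n t].
- set a := l_ n.+1; set b := l_ n.
  (* Parallelogram law: J a + J b - 2 J ((a + b) / 2) is half the energy of a - b, and it is at most
     2 * 16^-n since J at the midpoint is at least the infimum. *)
  have := J_inf (scalel 2^-1 (a ++ b)).
  rewrite /J gram_scalel gram_scaler lin_scale gram_catl !gram_catr lin_cat.
  rewrite (gramC b a).
  have := Hl n; have := Hl n.+1; rewrite -/a -/b /J.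
  rewrite /subl !(gram_catl, gram_catr, gram_scalel, gram_scaler) (gramC b a).
  have : (16 : R) ^- n.+1 <= 16 ^- n.
    by rewrite lef_pV2 ?posrE ?exprn_gt0// ler_eXn2l// ltr1n.
  by move: (gram a a) (gram a b) (gram b b) (lin a) (lin b) (inf E)
    (16 ^- n.+1) (16 ^- n) => *; lra.
- set e := gram (l_ n) [:: (1, t)] - L t.
  have q0 := gram_ge0 [:: (1, t)].
  have qE : gram [:: (1, t)] [:: (1, t)] = k t t by rewrite /gram !big_seq1/=; ring.
  rewrite qE in q0.
  have q1 : 0 < k t t + 1 by rewrite ltr_wpDl.
  (* First-order condition at an almost-minimizer: moving by s along t changes J by 2 s e + s^2
     [k t t]. The step is nearly the optimal one; the added 1 keeps its denominator positive. *)
  have := J_inf (l_ n ++ scalel (- e / (k t t + 1)) [:: (1, t)]).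
  rewrite /J gram_catl !gram_catr !gram_scalel !gram_scaler lin_cat lin_scale.
  rewrite qE (gramC [:: (1, t)]).
  have -> : lin [:: (1, t)] = L t by rewrite /lin big_seq1 mul1r.
  have -> : gram (l_ n) [:: (1, t)] = e + L t by rewrite /e subrK.
  have := Hl n; rewrite /J.
  set s := - e / _.
  have es : e = - s * (k t t + 1) by rewrite /s; field; rewrite gt_eqF.
  move: (gram (l_ n) (l_ n)) (lin (l_ n)) (inf E) (16 ^- n) => x y i d h1 h2.
  have h3 : 0 <= d + 2 * s * e + s ^+ 2 * k t t by move: h1 h2; nra.
  have h4 : s ^+ 2 * (k t t + 1) <= d.
    move: h3; rewrite es; have := sqr_ge0 s; nra.
  rewrite es (_ : (- s * (k t t + 1)) ^+ 2 = s ^+ 2 * (k t t + 1) * (k t t + 1)); last by ring.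
  by rewrite ler_pM2r.
Qed.

End gram_minimization.

Section geometric_cauchy.
Context {R : realType}.

(** With w n = 2 c 2^-n, whose decrements are c 2^-n, the sequence u + w decreases and u - w
    increases; their common limit gives both the convergence and its rate. *)
Lemma cvg_geometric_increments (u : nat -> R) (c : R) :
  (forall n, `|u n.+1 - u n| <= c * 2 ^- n) ->
  exists l, u @ \oo --> l /\ forall n, `|l - u n| <= 2 * c * 2 ^- n.
Proof.
move=> hu.
have c0 : 0 <= c by have := hu 0; rewrite expr0 invr1 mulr1; exact: le_trans.
pose w n : R := 2 * c * 2 ^- n.
have w0 n : 0 <= w n by rewrite /w !mulr_ge0// invr_ge0 exprn_ge0.
have wS n : w n.+1 = c * 2 ^- n.
  rewrite /w exprS; field; by rewrite expf_neq0.
have wE n : w n = 2 * (c * 2 ^- n) by rewrite /w mulrA.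
have cw : w @ \oo --> (0 : R).
  rewrite (_ : w = geometric (2 * c) 2^-1); last first.
    by apply/funext => n; rewrite /w /geometric/= exprVn.
  by apply: cvg_geometric; rewrite gtr0_norm// invf_lt1// ltr1n.
have dn : nonincreasing_seq (u \+ w).
  apply/nonincreasing_seqP => n /=; rewrite wS wE.
  by have := ler_normlW (hu n); lra.
have up : nondecreasing_seq (u \- w).
  apply/nondecreasing_seqP => n /=; rewrite wS wE.
  by have := lerNnormlW (hu n); lra.
have lbn : lbound (range (u \+ w)) ((u \- w) 0).
  move=> _ [n _ <-]; rewrite (le_trans (up _ _ (leq0n n)))//=.
  by have := w0 n; lra.
have cu : (u \+ w) @ \oo --> lim ((u \+ w) @ \oo).
  by apply: nonincreasing_is_cvgn => //; exists ((u \- w) 0).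
set l := lim _ in cu.
have ul : u @ \oo --> l.
  rewrite (_ : u = (u \+ w) \- w); last by apply/funext => n /=; rewrite addrK.
  by rewrite -[l]subr0; apply: cvgB.
have ul' : (u \- w) @ \oo --> l by rewrite -[l]subr0; apply: cvgB.
exists l; split => // n.
have h1 : l <= (u \+ w) n by apply: (nonincreasing_cvgn_ge dn); apply/cvg_ex; exists l.
have h2 : (u \- w) n <= l.
  rewrite -(cvg_lim _ ul')//.
  by apply: (nondecreasing_cvgn_le up); apply/cvg_ex; exists l.
rewrite ler_norml -/(w n); move: h1 h2 => /=; lra.
Qed.

End geometric_cauchy.

Section square_integrable.
Context {d} {Y : measurableType d} {R : realType} (nu : {measure set Y -> \bar R}).
Implicit Types f g : Y -> R.

Lemma Lfun2P f : f \in Lfun nu 2%:E <->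
  measurable_fun setT f /\ (\int[nu]_y ((f y) ^+ 2)%:E < +oo)%E.
Proof.
split=> [f2|[mf f2]].
  have mf : measurable_fun setT f by move: f2 => /[!inE] /andP[/[!inE]/= mf _].
  split=> //; have /integrableP[_] := Lfun2_integrable_sqr f2.
  apply: le_lt_trans; rewrite le_eqVlt; apply/orP; left; apply/eqP.
  by apply: eq_integral => y _ /=; rewrite ger0_norm// sqr_ge0.
rewrite inE; apply/andP; split; rewrite inE//= /finite_norm unlock /Lnorm.
apply: poweR_lty; apply: le_lt_trans f2.
rewrite le_eqVlt; apply/orP; left; apply/eqP; apply: eq_integral => y _ /=.
by rewrite powR_mulrn// real_normK// num_real.
Qed.

Lemma Lfun2D f g : f \in Lfun nu 2%:E -> g \in Lfun nu 2%:E ->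
  (fun y => f y + g y) \in Lfun nu 2%:E.
Proof.
move=> /Lfun2P[mf f2] /Lfun2P[mg g2]; apply/Lfun2P; split.
  exact: measurable_funD.
have mX (u : Y -> R) : measurable_fun setT u -> measurable_fun setT (fun y => ((u y) ^+ 2)%:E).
  by move=> mu; apply/measurable_EFinP; exact: measurable_funX.
have m2X (u : Y -> R) : measurable_fun setT u -> measurable_fun setT (fun y => (2%:E * ((u y) ^+ 2)%:E)%E).
  by move=> mu; apply: emeasurable_funM => //; exact: mX.
apply: (@le_lt_trans _ _ (\int[nu]_y (2%:E * ((f y) ^+ 2)%:E + 2%:E * ((g y) ^+ 2)%:E))%E).
  apply: ge0_le_integral => //.
  - by move=> y _; rewrite lee_fin sqr_ge0.
  - by apply: mX; exact: measurable_funD.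
  - by apply: emeasurable_funD; exact: m2X.
  - move=> y _; rewrite -!EFinM -EFinD lee_fin; have := sqr_ge0 (f y - g y).
    by move: (f y) (g y) => a b; nra.
rewrite ge0_integralD//; [|by move=> y _; rewrite -EFinM lee_fin mulr_ge0 ?sqr_ge0|exact: m2X
  |by move=> y _; rewrite -EFinM lee_fin mulr_ge0 ?sqr_ge0|exact: m2X].
rewrite !ge0_integralZl_EFin//; do ?[exact: mX|by move=> y _; rewrite lee_fin sqr_ge0].
by apply: lte_add_pinfty; apply: lte_mul_pinfty.
Qed.

Lemma Lfun2Z a f : f \in Lfun nu 2%:E -> (fun y => a * f y) \in Lfun nu 2%:E.
Proof.
move=> f2; rewrite (_ : (fun y => _) = a \o* f); last by apply/funext => y /=; rewrite mulrC.
by apply: Lfun_scale => //; rewrite ler1n.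
Qed.

Lemma Lfun2_0 : (fun _ : Y => 0 : R) \in Lfun nu 2%:E.
Proof.
apply/Lfun2P; split; first exact: measurable_cst.
by rewrite integral0_eq// => y _; rewrite expr0n.
Qed.

End square_integrable.

Section riesz.
Context {d} {Y : measurableType d} {R : realType}.
Variables (nu : {measure set Y -> \bar R}) (T : Type) (n3 : nat)
  (K : T -> 'I_n3 -> Y -> R) (L : T -> R) (C : R).
Hypothesis K2 : forall t i, K t i \in Lfun nu 2%:E.
Implicit Types l : seq (R * T).

Definition comb l i y : R := \sum_(p <- l) p.1 * K p.2 i y.

Lemma comb_cons p l i : comb (p :: l) i = (fun y => p.1 * K p.2 i y + comb l i y).
Proof. by apply/funext => y; rewrite /comb big_cons. Qed.

Lemma Lfun2_comb l i : comb l i \in Lfun nu 2%:E.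
Proof.
elim: l => [|p l IH].
  rewrite (_ : comb _ _ = fun=> 0); first exact: Lfun2_0.
  by apply/funext => y; rewrite /comb big_nil.
by rewrite comb_cons; apply: Lfun2D => //; exact: Lfun2Z.
Qed.

Definition inner (u v : 'I_n3 -> Y -> R) : R := \sum_(i < n3) \int[nu]_y (u i y * v i y).

Lemma integrable_mul (f g : Y -> R) : f \in Lfun nu 2%:E -> g \in Lfun nu 2%:E ->
  nu.-integrable setT (EFin \o (fun y => f y * g y)).
Proof. by move=> f2 g2; apply/Lfun1_integrable; exact: Lfun2_mul_Lfun1. Qed.

Lemma inner_comb l (v : 'I_n3 -> Y -> R) : (forall i, v i \in Lfun nu 2%:E) ->
  inner (comb l) v = \sum_(p <- l) p.1 * inner (K p.2) v.
Proof.
move=> v2; rewrite /inner.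
elim: l => [|p l IH].
  rewrite big_nil big1// => i _; rewrite (_ : (fun y => _) = cst 0).
    by rewrite Rintegral_cst// mul0r.
  by apply/funext => y; rewrite /comb big_nil mul0r.
rewrite big_cons -IH mulr_sumr -big_split/=; apply: eq_bigr => i _.
rewrite -RintegralZl//; last exact: integrable_mul.
rewrite -RintegralD//.
- by apply: eq_Rintegral => y _; rewrite /comb big_cons/=; ring.
- rewrite (_ : _ \o _ = EFin \o (fun y => (p.1 * K p.2 i y) * v i y)); last first.
    by apply/funext => y /=; congr EFin; ring.
  by apply: integrable_mul => //; exact: Lfun2Z.
- by apply: integrable_mul => //; exact: Lfun2_comb.
Qed.

Lemma innerC u v : inner u v = inner v u.
Proof. by apply: eq_bigr => i _; apply: eq_Rintegral => y _; rewrite mulrC. Qed.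

Let k s t := inner (K s) (K t).

Lemma inner_comb2 l l' : inner (comb l) (comb l') = gram k l l'.
Proof.
rewrite inner_comb; last by move=> i; exact: Lfun2_comb.
apply: eq_bigr => p _; rewrite innerC inner_comb// mulr_sumr.
by apply: eq_bigr => q _; rewrite (innerC (K q.2)) /k; ring.
Qed.

Hypotheses (C0 : 0 <= C) (bound : forall l, lin L l ^+ 2 <= C * inner (comb l) (comb l)).

Let gram_k_ge0 l : 0 <= gram k l l.
Proof.
rewrite -inner_comb2; apply: sumr_ge0 => i _; apply: Rintegral_ge0 => y _.
by rewrite -expr2 sqr_ge0.
Qed.

(** Pointwise arithmetic-geometric inequality with a free weight. It stands in for Cauchy-Schwarz
    and stays additive over components; [a] is chosen at each use. *)
Lemma norm_Rintegral_mul_le (u v : Y -> R) (a : R) : 0 < a ->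
  u \in Lfun nu 2%:E -> v \in Lfun nu 2%:E ->
  `|\int[nu]_y (u y * v y)| <=
    a * \int[nu]_y (u y * u y) + a^-1 * \int[nu]_y (v y * v y).
Proof.
move=> a0 u2 v2.
apply: (le_trans (le_normr_Rintegral measurableT (integrable_mul u2 v2))).
rewrite -!RintegralZl//; [|exact: integrable_mul|exact: integrable_mul].
have iZ w c : w \in Lfun nu 2%:E -> nu.-integrable setT (EFin \o (fun y => c * (w y * w y))).
  move=> w2; rewrite (_ : _ \o _ = EFin \o (fun y => (c * w y) * w y)); last first.
    by apply/funext => y /=; rewrite mulrA.
  by apply: integrable_mul => //; exact: Lfun2Z.
rewrite -RintegralD//; [|exact: iZ|exact: iZ].
apply: le_Rintegral => //.
- exact: (integrable_abse (integrable_mul u2 v2)).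
- exact: (integrableD measurableT (iZ _ _ u2) (iZ _ _ v2)).
move=> y _; rewrite normrM.
have h1 : 0 <= (a * `|u y| - 2^-1 * `|v y|) ^+ 2 by exact: sqr_ge0.
have h2 : `|u y| * `|u y| = u y * u y by rewrite -normrM ger0_norm// -expr2 sqr_ge0.
have h3 : `|v y| * `|v y| = v y * v y by rewrite -normrM ger0_norm// -expr2 sqr_ge0.
rewrite -h2 -h3 -(ler_pM2l a0) mulrDr mulVKf ?gt_eqF//.
move: h1 (normr_ge0 (u y)) (normr_ge0 (v y)); move: (`|u y|) (`|v y|) => p q; nra.
Qed.

Lemma EFin_integral_sqr (u : Y -> R) : u \in Lfun nu 2%:E ->
  (\int[nu]_y ((u y) ^+ 2)%:E = (\int[nu]_y (u y * u y)%R)%R%:E)%E.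
Proof.
move=> u2; rewrite /Rintegral fineK.
  by apply: eq_integral => y _; rewrite expr2.
exact: (integrable_fin_num measurableT (integrable_mul u2 u2)).
Qed.

(** The almost-minimizers converge pointwise wherever the weighted sum [S] of their squared
    increments is finite. Integrating the pointwise rate gives convergence in L^2, and the
    approximate first-order condition becomes exact in the limit. *)
Theorem riesz_representation : exists m : 'I_n3 -> Y -> R,
  (forall i, m i \in Lfun nu 2%:E) /\ forall t, inner m (K t) = L t.
Proof.
have kC s t : k s t = k t s by exact: innerC.
have bound' l : lin L l ^+ 2 <= C * gram k l l by rewrite -inner_comb2.
have [l_ [hD hL]] := gram_minimizing_sequence kC C0 gram_k_ge0 bound'.
pose f n i y := comb (l_ n) i y.
have f2 n i : f n i \in Lfun nu 2%:E by exact: Lfun2_comb.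
pose D n i y := f n.+1 i y - f n i y.
have DE n i : D n i = comb (subl (l_ n.+1) (l_ n)) i.
  apply/funext => y; rewrite /D /f /comb /subl big_cat/= big_map/=; congr (_ + _).
  by rewrite -sumrN; apply: eq_bigr => p _; rewrite mulN1r mulNr.
have mf n i : measurable_fun setT (f n i) by have /Lfun2P[] := f2 n i.
have mD n i : measurable_fun setT (D n i) by exact: measurable_funB.
(* The weight 4^n turns finiteness of the sum into increments of size at most sqrt (S y) 2^-n, and
   the energies 4 * 16^-n leave room for it. *)
pose s n y : \bar R := (4 ^+ n * \sum_(i < n3) D n i y ^+ 2)%:E.
have s0 n y : (0 <= s n y)%E.
  by rewrite lee_fin mulr_ge0 ?exprn_ge0// sumr_ge0// => i _; exact: sqr_ge0.
have ms n : measurable_fun setT (s n).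
  apply/measurable_EFinP; apply: measurable_funM => //.
  by apply: measurable_sum => i; exact: measurable_funX.
pose S y := (\sum_(n <oo) s n y)%E.
have S0 y : (0 <= S y)%E by apply: nneseries_ge0 => n _ _; exact: s0.
have mS : measurable_fun setT S.
  by apply: ge0_emeasurable_sum => // n y _ _; exact: s0.
have D2 n i : D n i \in Lfun nu 2%:E by rewrite DE; exact: Lfun2_comb.
have Ds n : (\int[nu]_y s n y = (4 ^+ n * gram k (subl (l_ n.+1) (l_ n)) (subl (l_ n.+1) (l_ n)))%:E)%E.
  have mDX i : measurable_fun setT (fun y => (D n i y ^+ 2)%:E).
    by apply/measurable_EFinP; exact: measurable_funX.
  transitivity (\int[nu]_y ((4 ^+ n)%:E * \sum_(i < n3) (D n i y ^+ 2)%:E))%E.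
    by apply: eq_integral => y _; rewrite /s EFinM sumEFin.
  rewrite ge0_integralZl_EFin//; last 2 first.
  - by move=> y _; apply: sume_ge0 => i _; rewrite lee_fin sqr_ge0.
  - by apply: emeasurable_sum => i; exact: mDX.
  rewrite ge0_integral_sum//; last by move=> i y _; rewrite lee_fin sqr_ge0.
  rewrite EFinM; congr (_ * _)%E; rewrite -inner_comb2 /inner -sumEFin.
  by apply: eq_bigr => i _; rewrite EFin_integral_sqr// DE.
have intS : (\int[nu]_y S y < +oo)%E.
  rewrite /S integral_nneseries//.
  (* 16 / 3 is the sum of the series 4 * 4^-n that dominates these integrals. *)
  apply: (@le_lt_trans _ _ (16 / 3 : R)%:E); last exact: ltry.
  apply: lime_le.
    by apply: is_cvg_nneseries => n _ _; exact: integral_ge0.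
  apply: nearW => N.
  apply: (@le_trans _ _ (16 / 3 * (1 - 4 ^- N) : R)%:E); last first.
    by rewrite lee_fin ler_piMr// gerBl invr_ge0 exprn_ge0.
  elim: N => [|N IH]; first by rewrite big_geq// lee_fin expr0 invr1 subrr mulr0.
  rewrite big_nat_recr//=; apply: (le_trans (leeD2r _ IH)).
  rewrite Ds -EFinD lee_fin.
  have := hD N; move: (gram _ _ _) => q hq.
  have h4 : 4 ^+ N * q <= 4 * 4 ^- N.
    have p4 : 0 < (4 : R) ^+ N by rewrite exprn_gt0.
    have -> : 4 * 4 ^- N = 4 ^+ N * (4 * 16 ^- N) :> R.
      rewrite (_ : 16 = 4 * 4 :> R) ?exprMn; last by ring.
      by field; rewrite expf_neq0.
    by rewrite ler_pM2l.
  apply: (le_trans (lerD (lexx _) h4)).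
  rewrite exprS invfM; set x := 4 ^- N; lra.
have p2 n : 0 < (2 : R) ^- n by rewrite invr_gt0 exprn_gt0.
have p4 n : (4 : R) ^+ n = 2 ^+ n * 2 ^+ n by rewrite -exprMn; congr (_ ^+ _); ring.
have hinc y i n : (S y < +oo)%E -> `|f n.+1 i y - f n i y| <= Num.sqrt (fine (S y)) * 2 ^- n.
  move=> Sy.
  have Sfin : S y \is a fin_num by rewrite ge0_fin_numE.
  have h1 : (s n y <= S y)%E.
    apply: (@le_trans _ _ (\sum_(0 <= m < n.+1) s m y)%E); last first.
      by apply: nneseries_lim_ge => m _ _; exact: s0.
    by rewrite big_nat_recr//= leeDr// sume_ge0.
  have h2 : 4 ^+ n * D n i y ^+ 2 <= fine (S y).
    rewrite -lee_fin fineK//; apply: le_trans h1; rewrite lee_fin ler_pM2l ?exprn_gt0//.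
    by rewrite (bigD1 i)//= lerDl sumr_ge0// => ? _; exact: sqr_ge0.
  have fS0 : 0 <= fine (S y) by rewrite fine_ge0.
  rewrite -/(D n i y) -(@ler_pXn2r _ 2)// ?nnegrE ?mulr_ge0 ?sqrtr_ge0 ?(ltW (p2 n))//.
  rewrite real_normK ?num_real// exprMn sqr_sqrtr//.
  have -> : (2 ^- n) ^+ 2 = (4 ^+ n)^-1 :> R by rewrite p4 expr2 invfM.
  by rewrite ler_pdivlMr ?exprn_gt0// mulrC.
(* The default 0 on the set where [S] is infinite is harmless: the bound [hbound] has an infinite
   right side there, so it holds at every point. *)
pose m i y : R := if (S y < +oo)%E then lim ((fun n => f n i y) @ \oo) else 0.
have hm y i n : (S y < +oo)%E ->
    (fun n => f n i y) @ \oo --> m i y /\ `|m i y - f n i y| <= 2 * Num.sqrt (fine (S y)) * 2 ^- n.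
  move=> Sy; have [l [fl hl]] := cvg_geometric_increments (fun n => hinc y i n Sy).
  have -> : m i y = l by rewrite /m Sy; apply: cvg_lim.
  by split.
have mSfin : measurable [set y | (S y < +oo)%E].
  rewrite (_ : [set y | _] = S @^-1` [set x | (x < +oo)%E]); last by [].
  rewrite -[X in measurable X]setTI; apply: mS => //.
  rewrite (_ : [set x | _] = ~` [set +oo%E]); first by apply: measurableC; exact: emeasurable_set1.
  by apply/seteqP; split=> x /=; rewrite ltey => /eqP.
have mm i : measurable_fun setT (m i).
  (* Multiplication by the indicator makes the convergence to [m i] hold everywhere. *)
  apply: (@measurable_fun_cvg _ _ _ _ (fun n y => f n i y * \1_[set y | (S y < +oo)%E] y)).
    by move=> n; apply: measurable_funM => //; exact: measurable_indic.
  move=> y _; have [Sy|Sy] := boolP (S y < +oo)%E.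
    have [h _] := hm y i 0 Sy.
    rewrite (_ : (fun n => _) = (fun n => f n i y)); first exact: h.
    by apply/funext => n; rewrite indicE mem_set// mulr1.
  rewrite (_ : (fun n => _) = (fun=> 0)).
    by rewrite /m (negbTE Sy); exact: cvg_cst.
  by apply/funext => n; rewrite indicE memNset ?mulr0//; exact/negP.
have hbound i n y : (((m i y - f n i y) ^+ 2)%:E <= (4 * 4 ^- n)%:E * S y)%E.
  have c0 : 0 < (4 : R) * 4 ^- n by rewrite mulr_gt0// invr_gt0 exprn_gt0.
  have [Sy|] := boolP (S y < +oo)%E; last first.
    by rewrite ltey negbK => /eqP ->; rewrite gt0_muley ?lte_fin// leey.
  have [_ h] := hm y i n Sy.
  have Sfin : S y \is a fin_num by rewrite ge0_fin_numE.
  have fS0 : 0 <= fine (S y) by rewrite fine_ge0.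
  rewrite -(fineK Sfin) -EFinM lee_fin -real_normK ?num_real//.
  rewrite (_ : 4 * 4 ^- n * fine (S y) = (2 * Num.sqrt (fine (S y)) * 2 ^- n) ^+ 2).
    by rewrite ler_pXn2r// nnegrE ?mulr_ge0 ?sqrtr_ge0 ?(ltW (p2 n)).
  rewrite !exprMn sqr_sqrtr// p4 [(2 ^- n) ^+ 2]expr2 -invfM; ring.
pose IS := fine (\int[nu]_y S y)%E.
have ISfin : (\int[nu]_y S y)%E \is a fin_num by rewrite ge0_fin_numE// integral_ge0.
have hint i n : (\int[nu]_y ((m i y - f n i y) ^+ 2)%:E <= (4 * 4 ^- n * IS)%:E)%E.
  have c0 : 0 <= (4 : R) * 4 ^- n by rewrite mulr_ge0// invr_ge0 exprn_ge0.
  rewrite EFinM fineK// -ge0_integralZl_EFin//.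
  apply: ge0_le_integral => //.
  - by move=> y _; rewrite lee_fin sqr_ge0.
  - by apply/measurable_EFinP; apply: measurable_funX; exact: measurable_funB.
  - by apply: emeasurable_funM.
have mf2 i n : (fun y => m i y - f n i y) \in Lfun nu 2%:E.
  apply/Lfun2P; split; first exact: measurable_funB.
  by apply: le_lt_trans (hint i n) _; exact: ltry.
have m2 i : m i \in Lfun nu 2%:E.
  rewrite (_ : m i = fun y => (m i y - f 0%N i y) + f 0%N i y); last first.
    by apply/funext => y; rewrite subrK.
  exact: Lfun2D.
exists m; split => // t.
pose q := k t t + 1.
have kt0 : 0 <= k t t by rewrite sumr_ge0// => i _; apply: Rintegral_ge0 => y _; rewrite -expr2 sqr_ge0.
have IS0 : 0 <= IS by rewrite fine_ge0// integral_ge0.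
have est n : `|inner m (K t) - L t| <= (q + n3%:R * (4 * IS) + k t t) * 2 ^- n.
  have h1 : `|inner m (K t) - inner (f n) (K t)| <= (n3%:R * (4 * IS) + k t t) * 2 ^- n.
    have -> : inner m (K t) - inner (f n) (K t) =
        \sum_(i < n3) \int[nu]_y ((m i y - f n i y) * K t i y).
      rewrite /inner -sumrB; apply: eq_bigr => i _.
      rewrite -RintegralB//; [|exact: integrable_mul|exact: integrable_mul].
      by apply: eq_Rintegral => y _; rewrite mulrBl.
    apply: (le_trans (ler_norm_sum _ _ _)).
    have -> : (n3%:R * (4 * IS) + k t t) * 2 ^- n =
        \sum_(i < n3) (4 * IS * 2 ^- n + 2 ^- n * \int[nu]_y (K t i y * K t i y)).
      by rewrite big_split/= sumr_const card_ord -mulr_natl -mulr_sumr /k /inner; ring.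
    apply: ler_sum => i _.
    have e0 : 0 < (2 : R) ^+ n by rewrite exprn_gt0.
    (* The weight 2^n balances the two terms: the squared error is of order 4^-n, so both become of
       order 2^-n. *)
    apply: (le_trans (norm_Rintegral_mul_le e0 (mf2 i n) (K2 t i))).
    apply: lerD => //.
    have := hint i n; rewrite EFin_integral_sqr// lee_fin => h.
    apply: (le_trans (ler_wpM2l (ltW e0) h)).
    rewrite p4 le_eqVlt; apply/orP; left; apply/eqP; field.
    by rewrite expf_neq0.
  have h2 : `|inner (f n) (K t) - L t| <= q * 2 ^- n.
    have := hL n t; rewrite -inner_comb2 -/q.
    have -> : inner (comb (l_ n)) (comb [:: (1, t)]) = inner (f n) (K t).
      apply: eq_bigr => i _; apply: eq_Rintegral => y _.
      by rewrite /comb big_seq1/= mul1r.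
    move=> h; rewrite -(@ler_pXn2r _ 2)// ?nnegrE ?mulr_ge0 ?addr_ge0 ?(ltW (p2 n))//.
    rewrite real_normK ?num_real//; apply: (le_trans h).
    have e1 : (2 : R) ^- n <= 1 by rewrite invf_le1 ?exprn_gt0// exprn_ege1// ler1n.
    have -> : (16 : R) ^- n = 2 ^- n * 2 ^- n * (2 ^- n * 2 ^- n).
      rewrite -!invfM -p4 -exprMn; congr (_ ^- _); ring.
    have q1 : 1 <= q by rewrite /q lerDr.
    rewrite exprMn !expr2; have := p2 n; move: (2 ^- n) e1 => x e1 x0.
    have hx : x * x <= 1 by nra.
    have hq : q <= q * q by nra.
    have hxx : 0 <= x * x by nra.
    by nra.
  have -> : inner m (K t) - L t =
    (inner m (K t) - inner (f n) (K t)) + (inner (f n) (K t) - L t) by ring.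
  apply: (le_trans (ler_normD _ _)); apply: (le_trans (lerD h1 h2)).
  by rewrite le_eqVlt; apply/orP; left; apply/eqP; ring.
apply/eqP; rewrite -subr_eq0 -normr_le0.
set c := (q + _ + _) in est.
have cz : (fun n => c * 2 ^- n) @ \oo --> (0 : R).
  rewrite (_ : (fun n => _) = geometric c 2^-1); last first.
    by apply/funext => n /=; rewrite exprVn.
  by apply: cvg_geometric; rewrite gtr0_norm// invf_lt1// ltr1n.
rewrite -(cvg_lim _ cz)//; apply: limr_ge; first by apply/cvg_ex; exists 0.
exact: nearW.
Qed.

End riesz.

(** * Test functions and bumps *)

Section directional.
Context {R : realType} {V : normedModType R}.
Implicit Types (f g : V -> R) (x v : V).

Lemma is_derive_lineP f x v (d : R) :
  is_derive x v f d <-> is_derive (0 : R) 1 (fun h : R => f (h *: v + x)) d.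
Proof.
have E : (fun h : R => h^-1 *: ((f \o shift x) (h *: v) - f x)) =
    (fun h : R => h^-1 *: (((fun h => f (h *: v + x)) \o shift 0) (h *: 1) -
      (fun h => f (h *: v + x)) 0)).
  apply/funext => h /=; congr (_ *: (f _ - f _)).
    by rewrite /shift/= addr0 [h *: 1]mulr1.
  by rewrite scale0r add0r.
split=> [[dv dE]|[dv dE]].
- by apply: DeriveDef; [rewrite /derivable -E|rewrite /derive -E].
- by apply: DeriveDef; [rewrite /derivable E|rewrite /derive E].
Qed.

Lemma is_derive_comp_dir (F : R -> R) g x v (a b : R) :
  is_derive (g x) 1 F a -> is_derive x v g b -> is_derive x v (fun y => F (g y)) (a * b).
Proof.
move=> dF /is_derive_lineP dg; apply/is_derive_lineP.
have := @is_derive1_comp R F (fun h => g (h *: v + x)) 0 a b.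
by rewrite scale0r add0r => /(_ dF dg).
Qed.

End directional.

Section flat.
Context {R : realType}.
Implicit Types (n : nat) (x : R).

(** The powers of 1 / x are included so that the family is closed under differentiation. *)
Definition flat n x : R := if 0 < x then x ^- n * expR (- x^-1) else 0.

Lemma flat_ge0 n x : 0 <= flat n x.
Proof.
rewrite /flat; case: ifPn => // x0.
by rewrite mulr_ge0 ?expR_ge0// invr_ge0 exprn_ge0// ltW.
Qed.

Lemma flat_le0 n x : x <= 0 -> flat n x = 0.
Proof. by rewrite /flat leNgt => /negbTE ->. Qed.

(** With y = 1 / x and N = n + 1, exp y = (exp (y / N))^N >= (y / N)^N, which absorbs x^-n and
    leaves one factor x. *)
Lemma flat_bound n x : `|flat n x| <= n.+1%:R ^+ n.+1 * `|x|.
Proof.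
rewrite /flat; case: ifPn => x0; last by rewrite normr0 mulr_ge0// exprn_ge0.
set N : R := n.+1%:R.
have N0 : 0 < N by rewrite ltr0n.
have w0 : 0 < x * N by rewrite mulr_gt0.
have h1 : ((x * N)^-1) ^+ n.+1 <= expR (x^-1).
  have -> : x^-1 = n.+1%:R * (x * N)^-1.
    by rewrite -/N invfM mulrCA divff ?mulr1// gt_eqF.
  rewrite expRM_natl; apply: lerXn2r; rewrite ?nnegrE ?expR_ge0 ?invr_ge0 ?(ltW w0)//.
  by rewrite (le_trans _ (expR_ge1Dx _))// lerDr.
rewrite expRN ger0_norm; last first.
  by rewrite mulr_ge0// invr_ge0 ?expR_ge0// exprn_ge0// ltW.
rewrite gtr0_norm// ler_pdivrMr ?expR_gt0// -ler_pdivrMl; last first.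
  by rewrite mulr_gt0// exprn_gt0.
apply: le_trans h1; rewrite le_eqVlt; apply/orP; left; apply/eqP.
by rewrite -invfM exprVn exprMn [x ^+ n.+1]exprS; congr (_^-1); ring.
Qed.

Lemma flat_cvg0 n : flat n x @[x --> (0 : R)] --> (0 : R).
Proof.
apply/cvgr0Pnorm_le => e e0.
pose c : R := n.+1%:R ^+ n.+1 + 1.
have c0 : 0 < c by rewrite ltr_wpDl// exprn_ge0.
near=> x.
apply: (le_trans (flat_bound n x)).
apply: (@le_trans _ _ (c * `|x|)); first by rewrite ler_wpM2r// lerDl.
rewrite -ler_pdivlMl//; near: x.
have ec : 0 < c^-1 * e by rewrite mulr_gt0// invr_gt0.
by have /cvgr0Pnorm_le := (@cvg_id _ (nbhs (0 : R))); apply.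
Unshelve. all: by end_near. Qed.

Lemma is_derive_flat n x :
  is_derive x 1 (flat n) (- n%:R * flat n.+1 x + flat n.+2 x).
Proof.
have [x0|x0|->] := ltgtP x 0.
- rewrite !flat_le0 ?(ltW x0)// mulr0 addr0.
  apply: (@near_eq_is_derive _ _ _ (cst 0)).
  near=> y; rewrite flat_le0//; apply: ltW; near: y; exact: lt_nbhsl.
- have xn0 : x != 0 by rewrite gt_eqF.
  apply: (@near_eq_is_derive _ _ _ (fun y : R => (y ^+ n)^-1 * expR (- y^-1))).
    near=> y; rewrite /flat ifT//; near: y; exact: lt_nbhsr.
  have dV := is_deriveV xn0 (is_derive_id x 1).
  have xnn : x ^+ n != 0 by rewrite expf_neq0.
  have dX : is_derive x 1 (fun y : R => y ^+ n) (n%:R * x ^+ n.-1).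
    have := is_deriveX n (is_derive_id x 1); rewrite exprfctE => dX.
    by apply: is_derive_eq; exact: mulr1.
  have dXV := is_deriveV (f := fun y : R => y ^+ n) xnn dX.
  have dN : is_derive x 1 (fun y : R => - y^-1) (x ^- 2).
    by apply: is_derive_eq; rewrite -[RHS]opprK; congr (- _); exact: mulr1.
  have dE := is_derive1_comp (g := fun y : R => - y^-1) (is_derive_expR (- x^-1)) dN.
  apply: is_derive_eq; rewrite /flat x0 /= /GRing.scale/=.
  case: n xnn {dX dXV} => [|n] xnn /=.
    by rewrite expr0 expr1; field.
  have xn : x ^+ n != 0 by rewrite expf_neq0.
  rewrite [x ^+ n.+3]exprS [x ^+ n.+2]exprS [x ^+ n.+1]exprS.
  move: (n.+1%:R : R) (x ^+ n) xn (expR _) => N p p0 e.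
  by field; rewrite xn0 p0.
- rewrite !flat_le0// mulr0 addr0.
  (* At the origin the difference quotient of [flat n] is [flat n.+1], which tends to 0. *)
  have H : h^-1 *: ((flat n \o shift 0) (h *: 1) - flat n 0) @[h --> (0 : R)^'] --> (0 : R).
    rewrite (_ : (fun h => _) = fun h => flat n.+1 h).
      by apply: cvg_within_filter; exact: flat_cvg0.
    apply/funext => h /=; rewrite /shift/= addr0 (@flat_le0 n 0)// subr0.
    rewrite /GRing.scale/= mulr1 /flat; case: ifPn => h0; last by rewrite mulr0.
    by rewrite exprS invfM mulrA.
  apply: DeriveDef; first by apply/cvg_ex; exists 0.
  exact: cvg_lim.
Unshelve. all: by end_near. Qed.

Lemma flat_continuous n : continuous (flat n).
Proof.
by move=> x; have [d _] := is_derive_flat n x; exact/differentiable_continuous/derivable1_diffP.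
Qed.

Lemma flat0_gt0 x : 0 < x -> 0 < flat 0 x.
Proof. by move=> x0; rewrite /flat x0 expr0 invr1 mul1r expR_gt0. Qed.

Lemma flat0_nondecreasing x y : x <= y -> flat 0 x <= flat 0 y.
Proof.
move=> xy; have [x0|x0] := ltP 0 x; last by rewrite (flat_le0 _ x0) flat_ge0.
have y0 := lt_le_trans x0 xy.
rewrite /flat x0 y0 expr0 invr1 !mul1r ler_expR lerN2.
by rewrite lef_pV2.
Qed.

End flat.

Section smooth_functions.
Context {R : realType}.
Implicit Types (f g : R3 R -> R) (x y z : R3 R).

Lemma smooth_coind (A : set (R3 R -> R)) :
  (forall f, A f -> continuous f /\
    forall i : 'I_3, (forall x, derivable f x (basis3 i)) /\ A ('D_(basis3 i) f)) ->
  forall f, A f -> smooth f.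
Proof.
move=> HA f Af s.
have {Af} : A (mpartial s f) by elim: s => //= i s IH; have [_ /(_ i)[_]] := HA _ IH.
by move=> /HA[cf df]; split => // i x; have [] := df i.
Qed.

(* A class of smooth functions that is stable under differentiation for
   syntactic reasons; [smooth_elem] is then a coinduction. *)
Inductive elem : (R3 R -> R) -> Prop :=
| elem_smooth f : smooth f -> elem f
| elem_cst c : elem (fun=> c)
| elem_crd i : elem (crd i)
| elemD f g : elem f -> elem g -> elem (fun x => f x + g x)
| elemM f g : elem f -> elem g -> elem (fun x => f x * g x)
| elem_flat n g : elem g -> elem (fun x => flat n (g x))
| elem_rsqrt g : elem g -> (forall x, 0 < g x) -> elem (fun x => (Num.sqrt (g x))^-1).

Lemma elem_continuous f : elem f -> continuous f.
Proof.
elim=> {f} [f sf|c|i|f g _ cf _ cg|f g _ cf _ cg|n g _ cg|g _ cg g0] x.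
- by have [] := sf [::].
- exact: cvg_cst.
- exact: crd_continuous.
- by apply: cvgD; [exact: cf|exact: cg].
- by apply: cvgM; [exact: cf|exact: cg].
- by apply: (@continuous_comp _ _ _ g (flat n)); [exact: cg|exact: flat_continuous].
- apply: cvgV; first by rewrite gt_eqF// sqrtr_gt0.
  by apply: (@continuous_comp _ _ _ g Num.sqrt); [exact: cg|exact: sqrt_continuous].
Qed.

Lemma is_derive_crd i x (v : R3 R) : is_derive x v (crd i) (crd i v).
Proof.
apply/is_derive_lineP.
rewrite (_ : (fun h : R => _) = fun h : R => h * crd i v + crd i x); last first.
  by apply/funext => h; case: i => [|[|i]].
by apply: is_derive_eq; rewrite /GRing.scale/= addr0 mulr0 add0r mulr1.
Qed.

Lemma elem_is_derive (i : 'I_3) f : elem f ->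
  exists2 f', elem f' & forall x, is_derive x (basis3 i) f (f' x).
Proof.
elim=> {f} [f sf|c|k|f g ef [f' ef' df] eg [g' eg' dg]|f g ef [f' ef' df] eg [g' eg' dg]
  |n g eg [g' eg' dg]|g eg [g' eg' dg] g0].
- exists ('D_(basis3 i) f).
    by apply: elem_smooth => s; have := sf (rcons s i); rewrite /mpartial foldr_rcons.
  by move=> x; apply: DeriveDef => //; have [_] := sf [::]; apply.
- exists (fun=> 0); first exact: elem_cst.
  by move=> x; apply: DeriveDef; [exact: derivable_cst|exact: derive_cst].
- exists (fun=> crd k (basis3 i)); first exact: elem_cst.
  by move=> x; exact: is_derive_crd.
- exists (fun x => f' x + g' x); first exact: elemD.
  by move=> x; exact: is_deriveD.
- exists (fun x => f x * g' x + g x * f' x); first by apply: elemD; exact: elemM.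
  by move=> x; exact: is_deriveM.
- exists (fun x => (- n%:R * flat n.+1 (g x) + flat n.+2 (g x)) * g' x).
    apply: elemM => //; apply: elemD; last exact: elem_flat.
    by apply: elemM; [exact: elem_cst|exact: elem_flat].
  by move=> x; apply: is_derive_comp_dir => //; exact: is_derive_flat.
(* The derivative of p is - p^3 g' / 2, again in the class. *)
- pose p x := (Num.sqrt (g x))^-1.
  have ep : elem p by exact: elem_rsqrt.
  exists (fun x => (- 2^-1 * (p x * (p x * p x))) * g' x).
    by apply: elemM => //; apply: elemM; [exact: elem_cst|do 2 apply: elemM => //].
  move=> x; apply: (@is_derive_comp_dir _ _ (fun t => (Num.sqrt t)^-1)) => //.
  have s0 : Num.sqrt (g x) != 0 by rewrite gt_eqF// sqrtr_gt0.
  have := is_deriveV s0 (is_derive1_sqrt (g0 x)).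
  by move=> h; apply: is_derive_eq; rewrite /p /GRing.scale/=; field.
Qed.

Lemma smooth_elem f : elem f -> smooth f.
Proof.
apply: smooth_coind => {}f ef; split; first exact: elem_continuous.
move=> i; have [f' ef' df] := elem_is_derive i ef; split => [x|]; first by have [] := df x.
rewrite (_ : 'D_(basis3 i) f = f')//; apply/funext => x.
by have [_] := df x.
Qed.

(** Written with [+ -] and products so that it is literally assembled from the constructors of
    [elem]. *)
Definition sqdist z y : R :=
  (crd 0 y + - crd 0 z) * (crd 0 y + - crd 0 z) +
  (crd 1 y + - crd 1 z) * (crd 1 y + - crd 1 z) +
  (crd 2 y + - crd 2 z) * (crd 2 y + - crd 2 z).

Lemma sqdistE z y : sqdist z y = dot (y - z) (y - z).
Proof. by rewrite dotE !crdB. Qed.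

Lemma sqdistxx z : sqdist z z = 0.
Proof. by rewrite /sqdist !subrr !mulr0 !addr0. Qed.

Lemma elem_sqdist z : elem (sqdist z).
Proof.
have e i : elem (fun y => crd i y + - crd i z).
  by apply: elemD; [exact: elem_crd|exact: elem_cst].
by apply: elemD; [apply: elemD|]; exact: elemM.
Qed.

Lemma sqdist_continuous z : continuous (sqdist z).
Proof. exact/elem_continuous/elem_sqdist. Qed.

(** [flat 0] is nested: the inner value is 0 up to b, which leaves the normalized value 1, and from
    c on it is at least a = [flat 0 (c - b)], so the outer argument is nonpositive. *)
Lemma elem_bump z (b c : R) : b < c -> exists chi, [/\ elem chi,
  forall y, sqdist z y <= b -> chi y = 1 & forall y, c <= sqdist z y -> chi y = 0].
Proof.
move=> bc; have a0 : 0 < flat 0 (c - b) by rewrite flat0_gt0// subr_gt0.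
set a := flat 0 (c - b) in a0; have ea0 := flat0_gt0 a0.
exists (fun y => (flat 0 a)^-1 * flat 0 (a + (- 1) * flat 0 (sqdist z y + - b))); split.
- apply: elemM; first exact: elem_cst.
  apply: elem_flat; apply: elemD; first exact: elem_cst.
  apply: elemM; first exact: elem_cst.
  apply: elem_flat; apply: elemD; first exact: elem_sqdist.
  exact: elem_cst.
- move=> y yb; rewrite (@flat_le0 _ 0 (_ + - b)) ?subr_le0// mulr0 addr0.
  by rewrite mulVf// gt_eqF.
- move=> y yc; rewrite (@flat_le0 _ 0 (a + _)) ?mulr0// mulN1r subr_le0.
  by apply: flat0_nondecreasing; rewrite lerD2r.
Qed.

End smooth_functions.

Section open_measurable3.
Context {R : realType}.

Lemma ball3P (x y : R3 R) (e : R) : ball x e y <->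
  [/\ `|x.1.1 - y.1.1| < e, `|x.1.2 - y.1.2| < e & `|x.2 - y.2| < e].
Proof. by split=> [[[/= ? ?] ?]|[? ? ?]]. Qed.

(** An open set is a countable union of boxes with rational centre and half-side 1 / (n + 1), and
    boxes belong to the product sigma-algebra. *)
Lemma open_measurable3 (O : set (R3 R)) : open O -> measurable (O : set (mR3 R)).
Proof.
move=> oO.
pose I := (rat * rat * rat * nat)%type.
pose q (i : I) : R3 R := (ratr i.1.1.1, ratr i.1.1.2, ratr i.1.2).
pose box (i : I) : set (R3 R) := [set y | ball (q i) (i.2.+1%:R^-1) y].
have mbox i : measurable (box i : set (mR3 R)).
  have mI j (c : R) : measurable ((fun x : mR3 R => crd j x) @^-1` (ball c (i.2.+1%:R^-1))).
    rewrite -[X in measurable X]setTI; apply: measurable_crd => //.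
    exact: measurable_ball.
  rewrite (_ : box i = ((crd 0 @^-1` ball (ratr i.1.1.1 : R) (i.2.+1%:R^-1)) `&`
    (crd 1 @^-1` ball (ratr i.1.1.2 : R) (i.2.+1%:R^-1))) `&`
    (crd 2 @^-1` ball (ratr i.1.2 : R) (i.2.+1%:R^-1))).
    exact: (measurableI _ _ (measurableI _ _ (mI 0 _) (mI 1 _)) (mI 2 _)).
  by apply/seteqP; split => [y [[? ?] ?]|y [[? ?] ?]]; do ?split.
pose F i := if `[< box i `<=` O >] then box i else set0.
have -> : O = \bigcup_i F i.
  apply/seteqP; split => [x Ox|x [i _]]; last first.
    by rewrite /F; case: asboolP => // h; exact: h.
  have /nbhs_ballP[e /= e0 xeO] : nbhs x O by exact: open_nbhs_nbhs.
  pose n := Num.bound (2 / e).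
  have n0 : 0 < (n.+1%:R : R)^-1 by rewrite invr_gt0.
  have ne : 2 * n.+1%:R^-1 < e.
    rewrite ltr_pdivrMr// mulrC -ltr_pdivrMr//.
    apply: (@lt_trans _ _ n%:R); last by rewrite ltr_nat.
    by apply: archi_boundP; rewrite divr_ge0// ltW.
  have rat_near (c : R) : exists p : rat, `|ratr p - c| < n.+1%:R^-1.
    have : c - n.+1%:R^-1 < c + n.+1%:R^-1 by rewrite ltrD2l -subr_gt0 opprK addr_gt0.
    move=> /rat_in_itvoo[p]; rewrite in_itv/= => /andP[h1 h2]; exists p.
    by rewrite ltr_distl h1.
  have [p1 h1] := rat_near x.1.1; have [p2 h2] := rat_near x.1.2.
  have [p3 h3] := rat_near x.2.
  exists ((p1, p2, p3), n) => //.
  have xbox : box (p1, p2, p3, n) x by apply/ball3P.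
  rewrite /F; case: asboolP => // -[] y /ball3P[/= k1 k2 k3]; apply: xeO; apply/ball3P.
  have tri (u v w : R) : `|u - v| < n.+1%:R^-1 -> `|u - w| < n.+1%:R^-1 -> `|v - w| < e.
    by move: ne; move: (n.+1%:R^-1 : R) => d'; rewrite !ltr_distl; lra.
  by split; [exact: (tri (ratr p1))|exact: (tri (ratr p2))|exact: (tri (ratr p3))].
apply: countable_bigcupT_measurable; first exact: countableP.
by move=> i; rewrite /F; case: ifPn.
Qed.

Lemma continuous_measurable3 (f : R3 R -> R) : continuous f ->
  measurable_fun setT (f : mR3 R -> R).
Proof.
move=> cf; apply: (measurability _ (RGenOInfty.measurableE R)).
move=> _ [_ [x ->] <-]; apply: measurableI => //; apply: open_measurable3.
by move/continuousP : cf; apply; exact: interval_open.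
Qed.

End open_measurable3.

(** * Supports of test functions and of distributions *)

Section test_functions.
Context {R : realType}.
Implicit Types (phi chi : R3 R -> R) (x y z : R3 R) (D : (R3 R -> R) -> R).

Lemma fsupp_near0 phi z : (\forall y \near z, phi y = 0) -> ~ fsupp phi z.
Proof. by move=> h /(_ _ h) [y [/= /eqP]]. Qed.

Lemma near0_fsupp phi z : ~ fsupp phi z -> \forall y \near z, phi y = 0.
Proof.
move=> zn; have : nbhs z (~` fsupp phi).
  by apply: open_nbhs_nbhs; split => //; rewrite openC; exact: closed_closure.
apply: filterS => y yn; apply/eqP; apply: contra_notT yn => h.
exact: subset_closure.
Qed.

Lemma fsupp_notin phi z : ~ fsupp phi z -> phi z = 0.
Proof. by move/near0_fsupp/nbhs_singleton. Qed.

Lemma fsupp_subset phi (A : set (R3 R)) : closed A ->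
  (forall y, ~ A y -> phi y = 0) -> fsupp phi `<=` A.
Proof.
move=> cA h; rewrite [X in _ `<=` X](closure_id A).1//; apply: closureS => y /= /eqP py.
by apply: contrapT => /h.
Qed.

Lemma fsupp_mull phi chi : fsupp (fun y => phi y * chi y) `<=` fsupp phi.
Proof.
apply: fsupp_subset; first exact: closed_closure.
by move=> y /fsupp_notin ->; rewrite mul0r.
Qed.

Lemma fsupp_mulr phi chi : fsupp (fun y => phi y * chi y) `<=` fsupp chi.
Proof.
apply: fsupp_subset; first exact: closed_closure.
by move=> y /fsupp_notin ->; rewrite mulr0.
Qed.

Lemma test_elem phi : elem phi -> compact (fsupp phi) -> test_function phi.
Proof. by move=> /smooth_elem. Qed.

Lemma elem_test phi : test_function phi -> elem phi.
Proof. by move=> [/elem_smooth]. Qed.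

Lemma test_mul phi chi : test_function phi -> elem chi ->
  test_function (fun y => phi y * chi y).
Proof.
move=> tphi echi; apply: test_elem; first by apply: elemM => //; exact: elem_test.
by apply: (subclosed_compact _ tphi.2); [exact: closed_closure|exact: fsupp_mull].
Qed.

Lemma test_linear (a : R) phi psi : test_function phi -> test_function psi ->
  test_function (fun y => a * phi y + psi y).
Proof.
move=> tphi tpsi; apply: test_elem.
  apply: elemD; last exact: elem_test.
  by apply: elemM; [exact: elem_cst|exact: elem_test].
apply: (@subclosed_compact _ _ (fsupp phi `|` fsupp psi)); first exact: closed_closure.
  by apply: compactU; [exact: tphi.2|exact: tpsi.2].
apply: fsupp_subset; first by apply: closedU; exact: closed_closure.
move=> y; rewrite not_orE => -[/fsupp_notin -> /fsupp_notin ->].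
by rewrite mulr0 addr0.
Qed.

Lemma test0 : test_function (fun _ : R3 R => 0 : R).
Proof.
apply: test_elem; first exact: elem_cst.
rewrite (_ : fsupp _ = set0); first exact: compact0.
apply/seteqP; split => // y; apply: fsupp_near0.
by apply: filterS filterT.
Qed.

Lemma sqdist_ball_compact z (c : R) : compact [set y | sqdist z y <= c].
Proof.
have [c0|c0] := ltP c 0.
  rewrite (_ : [set y | _] = set0); first exact: compact0.
  apply/seteqP; split => // y /=; rewrite leNgt (lt_le_trans c0)// sqdistE.
  exact: dot_ge0.
(* Half-side c + 1 avoids a square root: a larger deviation has square above (c + 1)^2 >= c. *)
pose K (j : nat) : set R := `[crd j z - (c + 1), crd j z + (c + 1)]%classic.
apply: (@subclosed_compact _ _ ((K 0%N `*` K 1%N) `*` K 2%N)).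
- have /continuous_closedP h := @sqdist_continuous _ z.
  exact: (h _ (@closed_le _ c)).
- by apply: compact_setX; [apply: compact_setX|]; exact: segment_compact.
- move=> y /=; rewrite /sqdist => h.
  have b j : (crd j y + - crd j z) * (crd j y + - crd j z) <= c -> K j (crd j y).
    move=> hj; rewrite /K/= in_itv/=; move: hj; move: (crd j y) (crd j z) => u v hj.
    by apply/andP; split; rewrite leNgt; apply/negP => hh; nra.
  have s j := sqr_ge0 (crd j y + - crd j z).
  move: (s 0%N) (s 1%N) (s 2%N); rewrite !expr2 => s0 s1 s2.
  by split; [split|]; [apply: (b 0%N)|apply: (b 1%N)|apply: (b 2%N)]; lra.
Qed.

Lemma bump_support chi z (c : R) : (forall y, c <= sqdist z y -> chi y = 0) ->
  fsupp chi `<=` [set y | sqdist z y <= c].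
Proof.
move=> h; apply: fsupp_subset; last by move=> y /negP; rewrite -ltNge => /ltW; exact: h.
have /continuous_closedP hc := @sqdist_continuous R z.
exact: (hc _ (@closed_le _ c)).
Qed.

Lemma nbhs_sqdist z x (b : R) : sqdist z x < b -> \forall y \near x, sqdist z y < b.
Proof.
by move=> h; exact: (cvgr_lt _ (@sqdist_continuous R z x)).
Qed.

Lemma nbhs_sqdist_gt z x (b : R) : b < sqdist z x -> \forall y \near x, b < sqdist z y.
Proof.
by move=> h; exact: (cvgr_gt _ (@sqdist_continuous R z x)).
Qed.

Lemma bump_in_open z (U : set (R3 R)) : open U -> U z ->
  exists chi, [/\ elem chi, fsupp chi `<=` U & \forall y \near z, chi y = 1].
Proof.
move=> oU Uz.
have /nbhs_ballP[e /= e0 zeU] : nbhs z U by exact: open_nbhs_nbhs.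
have c0 : 0 < e ^+ 2 / 2 by rewrite divr_gt0// exprn_gt0.
have bc : e ^+ 2 / 4 < e ^+ 2 / 2.
  by rewrite ltr_pM2l ?exprn_gt0// ltf_pV2 ?posrE// ltr_nat.
have [chi [ec h1 h0]] := elem_bump z bc.
exists chi; split => //.
  apply: (subset_trans (bump_support h0)) => y /= hy; apply: zeU; apply/ball3P.
  move: hy; rewrite /sqdist => hy.
  have s j := sqr_ge0 (crd j y + - crd j z).
  have b j : (crd j y + - crd j z) * (crd j y + - crd j z) <= e ^+ 2 / 2 ->
      `|crd j z - crd j y| < e.
    move: (crd j y) (crd j z) => u v hj; rewrite ltr_norml.
    by apply/andP; split; rewrite ltNge; apply/negP => hh; nra.
  move: (s 0%N) (s 1%N) (s 2%N); rewrite !expr2 => s0 s1 s2; 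
  by split; [apply: (b 0%N)|apply: (b 1%N)|apply: (b 2%N)]; move: hy s0 s1 s2; rewrite /= !expr2; lra.
have : sqdist z z < e ^+ 2 / 4 by rewrite sqdistxx divr_gt0// exprn_gt0.
by move=> /nbhs_sqdist; apply: filterS => y /ltW; exact: h1.
Qed.

Definition linear_on_test D := forall (a : R) phi psi, test_function phi ->
  test_function psi -> D (fun x => a * phi x + psi x) = a * D phi + D psi.

Lemma linear_test0 D : linear_on_test D -> D (fun=> 0) = 0.
Proof.
move=> lD; have := lD 1 _ _ test0 test0.
rewrite (_ : (fun x => _) = fun=> 0); last by apply/funext => x; rewrite mulr0 addr0.
by rewrite mul1r => h; apply: (addrI (D (fun=> 0))); rewrite addr0 -h.
Qed.

(* A smooth partition of unity is avoided by expanding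
   phi = phi chi_1 + (1 - chi_1) phi chi_2 + ... *)
Lemma vanishes_off_dsupp D phi : linear_on_test D -> test_function phi ->
  (forall z, dsupp D z -> ~ fsupp phi z) -> D phi = 0.
Proof.
move=> lD tphi disj.
have HU z : exists chi, fsupp phi z -> [/\ elem chi,
    \forall y \near z, chi y = 1 & exists2 U, vanishes_on D U & fsupp chi `<=` U].
  have [zs|zs] := pselect (fsupp phi z); last by exists (fun=> 0).
  have : ~ dsupp D z by move=> /disj.
  move=> /contrapT[U /= [oU vU] Uz].
  have [chi [ec sc nc]] := bump_in_open oU Uz.
  by exists chi => _; split => //; exists U.
have [chi Hchi] := choice HU.
pose V : normedModType R := (R * R * R)%type.
have cov : @cover_compact V (fsupp phi) by rewrite -(@compact_cover V); exact: tphi.2.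
have := cov _ (fsupp phi) (fun z => interior [set y | chi z y = 1]).
case.
- by move=> z _; exact: open_interior.
- move=> z zs; exists z => //; have [_ h _] := Hchi z zs; exact: h.
move=> E Esub Ecov.
(* The invariant says that psi lives where some bump of the list equals 1. Multiplying psi by 1 -
   chi_z kills the points served by z alone, so z can be removed from the list. *)
have key (s : seq (R3 R)) : (forall z, z \in s -> fsupp phi z) ->
    forall psi, test_function psi ->
    (forall y, psi y != 0 -> exists2 z, z \in s & chi z y = 1) -> D psi = 0.
  elim: s => [|z s IH] sphi psi tpsi hpsi.
    rewrite (_ : psi = fun=> 0); first exact: linear_test0.
    by apply/funext => y; apply/eqP; apply: contraT => /hpsi[].
  have [ez _ [U vU sU]] := Hchi z (sphi z (mem_head _ _)).
  have t1 : test_function (fun y => psi y * chi z y) by exact: test_mul.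
  have e2 : elem (fun y => 1 + (- 1) * chi z y).
    by apply: elemD; [exact: elem_cst|apply: elemM => //; exact: elem_cst].
  have t2 : test_function (fun y => psi y * (1 + (- 1) * chi z y)) by exact: test_mul.
  rewrite (_ : psi = fun y => 1 * (psi y * chi z y) + psi y * (1 + (- 1) * chi z y)); last first.
    by apply/funext => y; ring.
  rewrite lD// vU//; last by apply: subset_trans sU; exact: fsupp_mulr.
  rewrite mulr0 add0r; apply: IH => //.
    by move=> w ws; apply: sphi; rewrite inE ws orbT.
  move=> y; rewrite mulf_eq0 negb_or => /andP[/hpsi[w]].
  rewrite inE => /predU1P[->|ws] cw; last by exists w.
  by rewrite cw mulr1 subrr eqxx.
apply: (key (finmap.enum_fset E)) => //.
- by move=> z zE; have := Esub z zE; rewrite inE.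
- move=> y py; have /Ecov[z /= zE zy] : fsupp phi y by exact: subset_closure.
  by exists z => //; exact: (interior_subset zy).
Qed.

End test_functions.

(** * Potentials of divergences *)

Section newton_cutoff.
Context {R : realType}.
Implicit Types (phi chi : R3 R -> R) (x y z : R3 R).

Lemma is_derive_rho_basis (i : 'I_3) x y : x != y ->
  is_derive y (basis3 i) (rho x) (kgrad i x y).
Proof.
move=> xy; apply/is_derive_lineP.
pose a j (h : R) := h * crd j (basis3 i) + crd j y.
have da j : is_derive (0 : R) 1 (a j) (crd j (basis3 i)).
  by rewrite /a; apply: is_derive_eq; rewrite /GRing.scale/= addr0 mulr0 add0r mulr1.
have ya : (a 0%N 0, a 1%N 0, a 2%N 0) = y.
  by rewrite /a !mul0r !add0r; case: y {xy a da} => -[].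
have xa : x != (a 0%N 0, a 1%N 0, a 2%N 0) by rewrite ya.
have := is_derive_rho xa (da 0%N) (da 1%N) (da 2%N); rewrite ya.
rewrite [X in is_derive _ _ X _ -> _](_ : _ = fun h : R => rho x (h *: basis3 i + y)); last first.
  by [].
move=> d; apply: is_derive_eq.
by case: i {a da ya xa d} => -[|[|[|//]]] ? /=; ring.
Qed.

Lemma is_derive_newton (i : 'I_3) x y : x != y ->
  is_derive y (basis3 i) (newton x) (- (4 * pi)^-1 * kgrad i x y).
Proof.
move=> xy; have d := is_derive_rho_basis i xy.
rewrite (_ : newton x = fun y => - (4 * pi)^-1 * rho x y)//.
have dc : is_derive y (basis3 i) (fun _ : R3 R => - (4 * pi)^-1 : R) 0.
  by apply: DeriveDef; [exact: derivable_cst|exact: derive_cst].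
by apply: is_derive_eq.
Qed.

Lemma sqdistC x y : sqdist x y = sqdist y x.
Proof. by rewrite /sqdist; ring. Qed.

(** The singularity is removed by adding to |x - y|^2 the square of a bump that equals 1 near x and
    is supported where chi vanishes. The radicand becomes positive everywhere and the product with
    chi is unchanged. *)
Lemma test_newton chi x : test_function chi -> (\forall y \near x, chi y = 0) ->
  test_function (fun y => chi y * newton x y).
Proof.
move=> tchi h0.
have Ux : interior [set y | chi y = 0] x by exact: h0.
have [beta [eb sb nb]] := bump_in_open (@open_interior _ _) Ux.
pose g y := sqdist x y + beta y * beta y.
have g0 y : 0 < g y.
  rewrite /g; have [->|yx] := eqVneq y x.
    by rewrite sqdistxx (nbhs_singleton nb) add0r mulr1.
  by rewrite ltr_wpDr// ?sqdistE ?dot_gt0 ?subr_eq0// -expr2 sqr_ge0.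
have eg : elem g by apply: elemD; [exact: elem_sqdist|exact: elemM].
rewrite (_ : (fun y => _) = fun y => chi y * ((- (4 * pi)^-1) * (Num.sqrt (g y))^-1)).
  by apply: test_mul => //; apply: elemM; [exact: elem_cst|exact: elem_rsqrt].
apply/funext => y; have [->|cy] := eqVneq (chi y) 0; first by rewrite !mul0r.
congr (_ * (_ * _)); congr (_^-1).
have b0 : beta y = 0.
  apply: fsupp_notin => /sb /interior_subset /= c0.
  by rewrite c0 eqxx in cy.
by rewrite /g b0 /enorm mulr0 addr0 sqdistC sqdistE.
Qed.

Lemma exists_cutoff (r : R) x : 0 < r -> r < enorm x ->
  exists chi, [/\ test_function chi, forall z, ecball r z -> \forall y \near z, chi y = 1
    & \forall y \near x, chi y = 0].
Proof.
move=> r0 rx; pose o : R3 R := (0, 0, 0).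
have so y : sqdist o y = enorm y ^+ 2.
  by rewrite enorm_sqr sqdistE (_ : y - o = y)//; case: y => -[u v] w; congr (_, _, _); rewrite /= subr0.
have rx2 : r ^+ 2 < enorm x ^+ 2 by rewrite ltr_pXn2r ?nnegrE ?enorm_ge0 ?ltW.
pose d := enorm x ^+ 2 - r ^+ 2.
have bc : r ^+ 2 + d / 4 < r ^+ 2 + d / 2 by rewrite /d; lra.
have [chi [ec h1 h0]] := elem_bump o bc.
exists chi; split.
- apply: test_elem => //.
  apply: (@subclosed_compact _ _ [set y | sqdist o y <= r ^+ 2 + d / 2]).
  + exact: closed_closure.
  + exact: sqdist_ball_compact.
  + exact: bump_support.
- move=> z rz; have : sqdist o z < r ^+ 2 + d / 4.
    rewrite so; apply: (@le_lt_trans _ _ (r ^+ 2)); last by rewrite /d; lra.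
    by rewrite ler_pXn2r// nnegrE ?enorm_ge0// ltW.
  by move=> /nbhs_sqdist; apply: filterS => y /ltW; exact: h1.
- have : r ^+ 2 + d / 2 < sqdist o x by rewrite so /d; lra.
  by move=> /nbhs_sqdist_gt; apply: filterS => y /ltW; exact: h0.
Qed.

Lemma is_cutoffS (D : (R3 R -> R) -> R) (A : set (R3 R)) x chi : dsupp D `<=` A ->
  [/\ test_function chi, forall z, A z -> \forall y \near z, chi y = 1
    & \forall y \near x, chi y = 0] -> is_cutoff D x chi.
Proof. by move=> DA [tc c1 c0]; split => // z /DA; exact: c1. Qed.

(** Two cutoffs agree near the support of D, so the difference of the two test functions vanishes
    there and D kills it. *)
Lemma potentialE (D : (R3 R -> R) -> R) x chi : linear_on_test D -> is_cutoff D x chi ->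
  potential D x = D (fun y => chi y * newton x y).
Proof.
move=> lD [tc c1 c0]; apply: xget_unique; first by exists chi; split.
move=> _ [psi [tp p1 p0] ->].
have tcn := test_newton tc c0; have tpn := test_newton tp p0.
have := @vanishes_off_dsupp _ D (fun y => (- 1) * (chi y * newton x y) + psi y * newton x y) lD.
rewrite lD//; move=> H; apply/eqP; rewrite -subr_eq0 addrC -mulN1r; apply/eqP.
apply: H; first exact: test_linear.
move=> z zD; apply: fsupp_near0.
have := c1 z zD; have := p1 z zD; apply: filterS2 => y -> ->; ring.
Qed.

End newton_cutoff.

Section Rintegral_linear.
Context {d} {Y : measurableType d} {R : realType} (nu : {measure set Y -> \bar R}).
Implicit Types (f g h : Y -> R).

Lemma integrableZl_fun (a : R) f : nu.-integrable setT (EFin \o f) ->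
  nu.-integrable setT (EFin \o (fun y => a * f y)).
Proof.
move=> jf; rewrite (_ : _ \o _ = (fun y => a%:E * (EFin \o f) y)%E); first exact: integrableZl.
by apply/funext => y /=; rewrite EFinM.
Qed.

Lemma integrableD_fun f g : nu.-integrable setT (EFin \o f) -> nu.-integrable setT (EFin \o g) ->
  nu.-integrable setT (EFin \o (fun y => f y + g y)).
Proof. by move=> jf jg; exact: (integrableD measurableT jf jg). Qed.

Lemma Rintegral_linear (a : R) f g :
  nu.-integrable setT (EFin \o f) -> nu.-integrable setT (EFin \o g) ->
  \int[nu]_y (a * f y + g y) = a * \int[nu]_y f y + \int[nu]_y g y.
Proof.
move=> jf jg; have jaf := integrableZl_fun a jf.
by rewrite (RintegralD measurableT jaf jg) (RintegralZl a measurableT jf).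
Qed.

Lemma Rintegral_add3 f g h : nu.-integrable setT (EFin \o f) ->
  nu.-integrable setT (EFin \o g) -> nu.-integrable setT (EFin \o h) ->
  \int[nu]_y (f y + g y + h y) = \int[nu]_y f y + \int[nu]_y g y + \int[nu]_y h y.
Proof.
move=> jf jg jh; have jfg := integrableD_fun jf jg.
by rewrite (RintegralD measurableT jfg jh)
  (RintegralD measurableT jf jg).
Qed.

End Rintegral_linear.

Section divergence_form.
Context {R : realType} (nu : {measure set (mR3 R) -> \bar R}) (F : R3 R -> R3 R).
Implicit Types (phi : R3 R -> R).
Hypothesis iF : forall i, nu.-integrable setT (EFin \o (fun y : mR3 R => crd i (F y))).

(** A common form for both divergences: [nu] is Lebesgue measure for the field in the ball, and
    [surface r] for the field on the sphere extended by zero. *)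
Definition div_form : (R3 R -> R) -> R :=
  divergence (fun Phi => \int[nu]_y dot (F y) (Phi y)).

Lemma dot_grad phi y : dot (F y) (grad phi y) =
  crd 0 (F y) * 'D_(basis3 0) phi y + crd 1 (F y) * 'D_(basis3 1) phi y
  + crd 2 (F y) * 'D_(basis3 2%:R) phi y.
Proof. by rewrite dotE. Qed.

Lemma partial_test (i : 'I_3) phi : test_function phi -> test_function ('D_(basis3 i) phi).
Proof.
move=> tphi; apply: test_elem.
  by have [f' ef' df] := elem_is_derive i (elem_test tphi);
    rewrite (_ : 'D_(basis3 i) phi = f')//; apply/funext => x; have [_] := df x.
apply: (subclosed_compact _ tphi.2); first exact: closed_closure.
apply: fsupp_subset; first exact: closed_closure.
move=> y /near0_fsupp h.
by rewrite (near_eq_derive _ h) derive_cst.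
Qed.

Lemma test_bounded phi : test_function phi -> exists2 k, 0 <= k & forall y, `|phi y| <= k.
Proof.
move=> tphi; have := elem_test tphi => /elem_continuous cphi.
have : compact (phi @` fsupp phi).
  apply: continuous_compact; last exact: tphi.2.
  exact: continuous_subspaceT.
move=> /compact_bounded [k [kr Hk]].
exists (`|k| + 1); first by rewrite addr_ge0.
move=> y; have [ys|ys] := pselect (fsupp phi y); last first.
  by rewrite (fsupp_notin ys) normr0 addr_ge0.
apply: (Hk (`|k| + 1)); last by exists y.
by rewrite (le_lt_trans (ler_norm k))// ltrDl.
Qed.

Lemma integrable_mul_bounded (f h : mR3 R -> R) (k : R) :
  nu.-integrable setT (EFin \o f) -> measurable_fun setT h ->
  (forall y, `|h y| <= k) -> nu.-integrable setT (EFin \o (fun y => f y * h y)).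
Proof.
move=> intf mh hk.
have k0 : 0 <= k by exact: le_trans (normr_ge0 _) (hk point).
have mf : measurable_fun setT f.
  by apply/measurable_EFinP; have /integrableP[] := intf.
apply: (@le_integrable _ _ _ nu setT measurableT _ (EFin \o (fun y => k * f y))).
- by apply/measurable_EFinP; exact: measurable_funM.
- move=> y _ /=; rewrite lee_fin !normrM (ger0_norm k0) mulrC.
  by rewrite ler_wpM2r.
- rewrite (_ : _ \o _ = (fun y => k%:E * (EFin \o f) y)%E); last by apply/funext => y /=; rewrite EFinM.
  exact: integrableZl.
Qed.

Lemma integrable_partial (j : nat) (i : 'I_3) phi : test_function phi ->
  nu.-integrable setT (EFin \o (fun y : mR3 R => crd j (F y) * 'D_(basis3 i) phi y)).
Proof.
move=> /(partial_test i) tp; have [k _ hk] := test_bounded tp.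
apply: (integrable_mul_bounded (iF j)) hk.
by apply: continuous_measurable3; apply: elem_continuous; exact: elem_test.
Qed.

Lemma div_formE phi : test_function phi -> div_form phi =
  - (\int[nu]_y (crd 0 (F y) * 'D_(basis3 0) phi y)
   + \int[nu]_y (crd 1 (F y) * 'D_(basis3 1) phi y)
   + \int[nu]_y (crd 2 (F y) * 'D_(basis3 2%:R) phi y)).
Proof.
move=> tphi; rewrite /div_form /divergence; congr (- _).
have i0 := integrable_partial 0 0 tphi.
have i1 := integrable_partial 1 1 tphi.
have i2 := integrable_partial 2 2%:R tphi.
rewrite -(Rintegral_add3 i0 i1 i2).
by apply: eq_Rintegral => y _; rewrite dot_grad.
Qed.

Lemma derive_linear (i : 'I_3) (a : R) phi psi y : test_function phi -> test_function psi ->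
  'D_(basis3 i) (fun x => a * phi x + psi x) y =
    a * 'D_(basis3 i) phi y + 'D_(basis3 i) psi y.
Proof.
move=> tphi tpsi.
have d1 : derivable phi y (basis3 i) by have [_] := tphi.1 [::]; apply.
have d2 : derivable psi y (basis3 i) by have [_] := tpsi.1 [::]; apply.
have D1 : is_derive y (basis3 i) phi ('D_(basis3 i) phi y) by exact: DeriveDef.
have D2 : is_derive y (basis3 i) psi ('D_(basis3 i) psi y) by exact: DeriveDef.
have Dc : is_derive y (basis3 i) (fun _ : R3 R => a) 0.
  by apply: DeriveDef; [exact: derivable_cst|exact: derive_cst].
by have : is_derive y (basis3 i) (fun x => a * phi x + psi x) (a * 'D_(basis3 i) phi y + 'D_(basis3 i) psi y);
  [apply: is_derive_eq|move=> [_ ->]].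
Qed.

Lemma div_form_linear : linear_on_test div_form.
Proof.
move=> a phi psi tphi tpsi; rewrite !div_formE//; last exact: test_linear.
have H j (i : 'I_3) : \int[nu]_y (crd j (F y) * 'D_(basis3 i) (fun x => a * phi x + psi x) y) =
    a * \int[nu]_y (crd j (F y) * 'D_(basis3 i) phi y) + \int[nu]_y (crd j (F y) * 'D_(basis3 i) psi y).
  rewrite -(Rintegral_linear a (integrable_partial j i tphi) (integrable_partial j i tpsi)).
  by apply: eq_Rintegral => y _; rewrite derive_linear//; ring.
have regroup (u v w u' v' w' : R) :
  - (a * u + u' + (a * v + v') + (a * w + w')) = a * - (u + v + w) + - (u' + v' + w') by ring.
apply: (etrans _ (regroup _ _ _ _ _ _)); congr (- (_ + _ + _)).
- exact: (H 0%N 0).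
- exact: (H 1%N 1).
- exact: (H 2%N 2%:R).
Qed.

Lemma div_form_bound phi (b : R) : test_function phi ->
  (forall s : seq 'I_3, (size s <= 1)%N -> forall x, `|mpartial s phi x| <= b) ->
  `|div_form phi| <= (\int[nu]_y `|crd 0 (F y)| + \int[nu]_y `|crd 1 (F y)|
     + \int[nu]_y `|crd 2 (F y)|) * b.
Proof.
move=> tphi hb; rewrite div_formE// normrN.
have H j (i : 'I_3) : `|\int[nu]_y (crd j (F y) * 'D_(basis3 i) phi y)| <=
    (\int[nu]_y `|crd j (F y)|) * b.
  have i1 := integrable_partial j i tphi.
  have inF : nu.-integrable setT (EFin \o (fun y : mR3 R => `|crd j (F y)|)).
    exact: (integrable_abse (iF j)).
  apply: (le_trans (le_normr_Rintegral measurableT i1)).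
  rewrite mulrC -(RintegralZl b measurableT inF); apply: le_Rintegral.
  - exact: measurableT.
  - exact: (integrable_abse i1).
  - exact: (integrableZl_fun b inF).
  - by move=> y _; rewrite normrM mulrC ler_wpM2r//; exact: (hb [:: i]).
by rewrite !mulrDl; apply: (le_trans (ler_normD _ _)); apply: lerD => //;
  apply: (le_trans (ler_normD _ _)); apply: lerD.
Qed.

Lemma div_form_distribution : is_distribution div_form.
Proof.
split; first exact: div_form_linear.
move=> K _; eexists; exists 1%N => phi b tphi _ hb; exact: (div_form_bound tphi hb).
Qed.

Variable A : set (R3 R).
Hypotheses (cA : closed A) (F0 : forall y, ~ A y -> F y = 0).

Let crd_mul0 (a b c : R) :
  crd 0 (0 : R3 R) * a + crd 1 (0 : R3 R) * b + crd 2 (0 : R3 R) * c = 0.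
Proof. by rewrite !mul0r !addr0. Qed.

Lemma div_form_supp : dsupp div_form `<=` A.
Proof.
move=> z; apply: contraPP => nAz; apply; exists (~` A) => //; split.
  by rewrite openC.
move=> phi tphi sphi; rewrite /div_form /divergence.
have -> : \int[nu]_y dot (F y) (grad phi y) = \int[nu]_y (0 : R); last first.
  by rewrite /Rintegral integral0 oppr0.
apply: eq_Rintegral.
move=> y _; rewrite dot_grad; have [Ay|nAy] := pselect (A y); last first.
  by rewrite (F0 nAy); exact: crd_mul0.
have h : \forall w \near y, phi w = 0 by apply: near0_fsupp => /sphi.
by rewrite !(near_eq_derive _ h) !derive_cst !mulr0 !addr0.
Qed.

(** The cutoff is 1 near every point of A, so on the set that carries F the derivatives of the
    cut-off kernel are those of the kernel itself. *)
Lemma div_form_potential (r : R) x : 0 < r -> A `<=` ecball r -> r < enorm x ->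
  potential div_form x = (4 * pi)^-1 * \int[nu]_y
    (crd 0 (F y) * kgrad 0 x y + crd 1 (F y) * kgrad 1 x y + crd 2 (F y) * kgrad 2 x y).
Proof.
move=> r0 Ar rx; have [chi hchi] := exists_cutoff r0 rx.
have [tc c1 c0] := hchi.
have sD : dsupp div_form `<=` ecball r by apply: subset_trans Ar; exact: div_form_supp.
rewrite (potentialE div_form_linear (is_cutoffS sD hchi)).
have tn := test_newton tc c0.
rewrite (div_formE tn); set psi := fun y => chi y * newton x y.
pose S (y : mR3 R) := crd 0 (F y) * 'D_(basis3 0) psi y + crd 1 (F y) * 'D_(basis3 1) psi y
  + crd 2 (F y) * 'D_(basis3 2%:R) psi y.
have i0 := integrable_partial 0 0 tn.
have i1 := integrable_partial 1 1 tn.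
have i2 := integrable_partial 2 2%:R tn.
have iS : nu.-integrable setT (EFin \o S) := integrableD_fun (integrableD_fun i0 i1) i2.
rewrite -(Rintegral_add3 i0 i1 i2).
have p0 : (4 * pi : R) != 0 by rewrite mulf_neq0// gt_eqF// pi_gt0.
have -> : \int[nu]_y (crd 0 (F y) * kgrad 0 x y + crd 1 (F y) * kgrad 1 x y + crd 2 (F y) * kgrad 2 x y)
   = - (4 * pi) * \int[nu]_y S y.
  rewrite -(RintegralZl _ measurableT iS); apply: eq_Rintegral => y _; rewrite /S.
  have [Ay|nAy] := pselect (A y); last by rewrite (F0 nAy) !crd_mul0 mulr0.
  have xy : x != y by apply: contraTneq rx => ->; rewrite -leNgt; exact: Ar.
  have D (i : 'I_3) : 'D_(basis3 i) psi y = - (4 * pi)^-1 * kgrad i x y.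
    have h : \forall w \near y, psi w = newton x w.
      by apply: filterS (c1 y (Ar _ Ay)) => w; rewrite /psi => ->; rewrite mul1r.
    rewrite (near_eq_derive _ h).
    by have [_ ->] := is_derive_newton i xy.
  by rewrite !D; move: p0; set c := 4 * pi => p0; field.
by rewrite mulNr mulrN mulKf.
Qed.

End divergence_form.

(** * Duality between the ball and the sphere *)

Section surface_integral.
Context {R : realType} (r : R).
Local Open Scope ereal_scope.

(** By definition [surface r] is the weighted image of the angle rectangle. *)
Lemma ge0_integral_surface (f : mR3 R -> \bar R) : measurable_fun setT f ->
  (forall y, 0 <= f y) -> \int[surface r]_y f y =
  \int[lebesgue2 R]_(t in angles) (f (spherical r t) * (r ^+ 2 * sin t.1)%:E).
Proof.
move=> mf f0.
have mw : measurable_fun setT (fun t : mR2 R => (r ^+ 2 * sin t.1)%R).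
  apply: measurable_funM; first exact: measurable_cst.
  by apply: (measurableT_comp (f := @sin R));
    [exact: continuous_measurable_fun (@continuous_sin R)|exact: measurable_fst].
have w0 (t : mR2 R) : angles t -> (0 <= r ^+ 2 * sin t.1)%R.
  by move=> [/= t1 _]; rewrite mulr_ge0 ?sqr_ge0// sin_ge0_pi.
apply: (ge0_integral_weighted_pushforward (measurable_spherical r) mw (@measurable_angles R) w0) => //.
Qed.

Lemma surface_lty : surface r setT < +oo.
Proof.
rewrite /surface preimage_setT setIT.
apply: (@le_lt_trans _ _ (\int[lebesgue2 R]_(t in angles) (cst (r ^+ 2)%:E) t)).
  apply: ge0_le_integral.
  - exact: measurable_angles.
  - by move=> t [/= t1 _]; rewrite lee_fin mulr_ge0 ?sqr_ge0// sin_ge0_pi.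
  - apply: measurable_funTS; apply/measurable_EFinP; apply: measurable_funM; first exact: measurable_cst.
    by apply: (measurableT_comp (f := @sin R));
      [exact: continuous_measurable_fun (@continuous_sin R)|exact: measurable_fst].
  - exact: measurable_cst.
  - by move=> t _; rewrite lee_fin ler_piMr ?sqr_ge0// sin_le1.
rewrite integral_cst; last exact: measurable_angles.
apply: lte_mul_pinfty; rewrite ?lee_fin ?sqr_ge0//.
rewrite [X in X < _](@product_measure1E _ _ _ _ _ sf_lebesgue1 sf_lebesgue1); [|exact: measurable_itv..].
rewrite (_ : _ * _ = ((pi - 0) * (2 * pi - 0))%:E) ?ltry//.
rewrite EFinM; congr (_ * _); rewrite /=.
  by rewrite lebesgue_measure_itv/= lte_fin pi_gt0 EFinB.
by rewrite lebesgue_measure_itv/= lte_fin mulr_gt0 ?pi_gt0// EFinB.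
Qed.

Lemma measurable_ecball : measurable (ecball r : set (mR3 R)).
Proof.
rewrite (_ : ecball r = @enorm R @^-1` `]-oo, r]); last first.
  by apply/seteqP; split => x /=; rewrite in_itv.
by rewrite -[X in measurable X]setTI; apply: measurable_enorm => //; exact: measurable_itv.
Qed.

Lemma measurable_esphere : measurable (esphere r : set (mR3 R)).
Proof.
rewrite (_ : esphere r = @enorm R @^-1` [set r])//.
by rewrite -[X in measurable X]setTI; exact: measurable_enorm.
Qed.

Lemma lebesgue_ecball_lty : (0 < r)%R -> lebesgue3 R (ecball r) < +oo.
Proof.
move=> r0; pose I : set (measurableTypeR R) := `[(- r)%R, r]%classic.
have mI : measurable I by exact: measurable_itv.
have I_lty : lebesgue_measure I < +oo.
  by rewrite /I lebesgue_measure_itv/= lte_fin gt0_cp// -EFinB ltry.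
apply: (@le_lt_trans _ _ (lebesgue3 R ((I `*` I) `*` I))).
  apply: le_measure; rewrite ?inE.
  - exact: measurable_ecball.
  - by apply: measurableX => //; exact: measurableX.
  move=> x /= xr.
  have H i : (- r <= crd i x <= r)%R.
    rewrite -ler_norml -(ler_pXn2r (n := 2)) ?nnegrE ?normr_ge0 ?(ltW r0)//.
    apply: (@le_trans _ _ (enorm x ^+ 2)%R); last by rewrite ler_pXn2r ?nnegrE ?enorm_ge0 ?(ltW r0).
    rewrite real_normK ?num_real// enorm_sqr dotE.
    by case: i => [|[|i]] /=; nra.
  by split; [split|]; rewrite /I /= in_itv/=; [exact: (H 0%N)|exact: (H 1%N)|exact: (H 2%N)].
rewrite [X in X < _](@product_measure1E _ _ _ _ _ sf_lebesgue2 sf_lebesgue1)//; last exact: measurableX.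
apply: lte_mul_pinfty => //.
  rewrite ge0_fin_numE//.
  rewrite [X in X < _](@product_measure1E _ _ _ _ _ sf_lebesgue1 sf_lebesgue1)//.
  by apply: lte_mul_pinfty => //; rewrite ge0_fin_numE.
Qed.

End surface_integral.

Section inner_product.
Context {d} {Y : measurableType d} {R : realType} (nu : {measure set Y -> \bar R}).

Lemma Lfun2_bounded (E : set Y) (f : Y -> R) (k : R) : measurable E -> (nu E < +oo)%E ->
  measurable_fun setT f -> (forall y, ~ E y -> f y = 0) -> (forall y, `|f y| <= k) ->
  f \in Lfun nu 2%:E.
Proof.
move=> mE Eoo mf f0 fk; apply/Lfun2P; split => //.
apply: (@le_lt_trans _ _ (\int[nu]_y ((k ^+ 2)%:E * (\1_E y)%:E))%E).
  apply: ge0_le_integral => //.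
  - by move=> y _; rewrite lee_fin sqr_ge0.
  - by apply/measurable_EFinP; exact: measurable_funX.
  - by apply/measurable_EFinP; apply: measurable_funM.
  move=> y _; rewrite -EFinM lee_fin indicE; have [yE|yE] := boolP (y \in E).
    by rewrite mulr1 -real_normK ?num_real// ler_pXn2r ?nnegrE// (le_trans _ (fk y)).
  have nE : ~ E y by move=> Ey; rewrite mem_set in yE.
  by rewrite f0// expr0n mulr0.
rewrite ge0_integralZl ?lee_fin ?sqr_ge0//; last by apply/measurable_EFinP; exact: measurable_indic.
by rewrite integral_indic// setIT; apply: lte_mul_pinfty; rewrite ?lee_fin ?sqr_ge0.
Qed.

Lemma inner_ge0 n3 (u : 'I_n3 -> Y -> R) : 0 <= inner nu u u.
Proof.
by apply: sumr_ge0 => i _; apply: Rintegral_ge0 => y _; rewrite -expr2 sqr_ge0.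
Qed.

(** Cauchy-Schwarz with a worse constant. With X the absolute value of the product and P the square
    norm of u, the weight a = X / (2 (P + 1)) absorbs half of X on the left; P + 1 in place of P
    covers u of norm zero. *)
Lemma inner_sqr_le n3 (u v : 'I_n3 -> Y -> R) :
  (forall i, u i \in Lfun nu 2%:E) -> (forall i, v i \in Lfun nu 2%:E) ->
  inner nu u v ^+ 2 <= 4 * (inner nu u u + 1) * inner nu v v.
Proof.
move=> u2 v2; set P := inner nu u u; set Q := inner nu v v.
have P0 : 0 <= P by exact: inner_ge0.
have Q0 : 0 <= Q by exact: inner_ge0.
have H a : 0 < a -> `|inner nu u v| <= a * P + a^-1 * Q.
  move=> a0; rewrite /P /Q /inner !mulr_sumr -big_split/=.
  apply: (le_trans (ler_norm_sum _ _ _)); apply: ler_sum => i _.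
  exact: norm_Rintegral_mul_le.
rewrite -real_normK ?num_real//; set X := `|_| in H *.
have [X0|X0] := leP X 0.
  have -> : X = 0 by apply/eqP; rewrite eq_le X0 /X normr_ge0.
  by rewrite expr0n !mulr_ge0// addr_ge0.
have P1 : 0 < P + 1 by rewrite ltr_wpDl.
have := H (X / (2 * (P + 1))); rewrite divr_gt0 ?mulr_gt0// => /(_ isT) h.
have h2 : X / (2 * (P + 1)) * P <= X / 2.
  rewrite invfM mulrA -mulrA ler_piMr ?divr_ge0 ?ltW//.
  by rewrite mulrC ltr_pdivrMr// mul1r ltrDl.
have h3 : X / 2 <= 2 * (P + 1) / X * Q.
  by move: h; rewrite invf_div; move: h2; lra.
have : X * (X / 2) <= 2 * (P + 1) * Q.
  by rewrite mulrC -ler_pdivlMr// mulrAC.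
by lra.
Qed.

Lemma EFin_inner (u : 'I_3 -> Y -> R) : (forall i, u i \in Lfun nu 2%:E) ->
  (inner nu u u)%:E =
  (\int[nu]_y (u 0 y * u 0 y + u 1 y * u 1 y + u 2%:R y * u 2%:R y)%R%:E)%E.
Proof.
move=> u2; have i2 i := integrable_mul (u2 i) (u2 i).
have -> : inner nu u u = \int[nu]_y (u 0 y * u 0 y + u 1 y * u 1 y + u 2%:R y * u 2%:R y).
  rewrite (Rintegral_add3 (i2 0) (i2 1) (i2 2%:R)) /inner 3!big_ord_recl big_ord0 addr0 addrA.
  by congr (_ + _ + _); apply: eq_Rintegral => y _; congr (u _ y * u _ y); exact/val_inj.
rewrite /Rintegral fineK//.
apply: integrable_fin_num => //.
exact: (integrableD_fun (integrableD_fun (i2 0) (i2 1)) (i2 2%:R)).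
Qed.

End inner_product.

Section tgrad_span.
Context {R : realType} (r : R).
Hypothesis r0 : 0 < r.

Definition exterior := {x : R3 R | r < enorm x}.

Implicit Types (l : seq (R * exterior)) (t : exterior).

Lemma exterior_neq t y : ecball r y -> sval t != y.
Proof. by move=> yr; apply: contraTneq (svalP t) => ->; rewrite -leNgt. Qed.

(** Truncation removes the pole at the exterior point t, so these functions are bounded and square
    integrable for both measures; the closed ball keeps their values on the sphere. *)
Definition tgrad t (i : 'I_3) : mR3 R -> R := kgrad i (sval t) \_ (ecball r).

Lemma tgradE t i y : ecball r y -> tgrad t i y = kgrad i (sval t) y.
Proof. by move=> yr; rewrite /tgrad patchE mem_set. Qed.

Lemma tgrad0 t i y : ~ ecball r y -> tgrad t i y = 0.
Proof. by move=> yr; rewrite /tgrad patchE memNset. Qed.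

Lemma measurable_tgrad t i : measurable_fun setT (tgrad t i).
Proof.
apply/(measurable_restrictT _ (measurable_ecball r)).
exact: measurable_funTS (@measurable_kgrad R i (sval t)).
Qed.

Lemma ecball_compact : compact (ecball r).
Proof.
rewrite (_ : ecball r = [set y | sqdist (0, 0, 0) y <= r ^+ 2]); first exact: sqdist_ball_compact.
have so y : sqdist (0, 0, 0) y = enorm y ^+ 2.
  by rewrite enorm_sqr /sqdist /= dotxx; ring.
apply/seteqP; split => y /=; rewrite so ler_pXn2r ?nnegrE ?enorm_ge0 ?(ltW r0)//.
Qed.

Lemma tgrad_bounded t i : exists k, forall y, `|tgrad t i y| <= k.
Proof.
have rg : regular (ecball r) (kgrad i (sval t)).
  apply: Regular; first exact: measurable_kgrad.
  by move=> z zr; apply: kgrad_continuous; exact: exterior_neq.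
have [k1 k10 h1] := regular_bounded ecball_compact rg.
have [k2 k20 h2] := regular_bounded ecball_compact (regularN rg).
exists (k1 + k2) => y; have [yr|yr] := pselect (ecball r y); last first.
  by rewrite tgrad0// normr0 addr_ge0.
rewrite tgradE// ler_norml; have := h1 y yr; have := h2 y yr => /=.
by move: k10 k20; lra.
Qed.

Lemma Lfun2_tgrad (nu : {measure set (mR3 R) -> \bar R}) t i :
  (nu (ecball r) < +oo)%E -> tgrad t i \in Lfun nu 2%:E.
Proof.
move=> nur; have [k hk] := tgrad_bounded t i.
exact: (Lfun2_bounded (measurable_ecball r) nur (measurable_tgrad t i) (@tgrad0 t i) hk).
Qed.

Definition span_grad l (i : nat) (y : R3 R) : R :=
  \sum_(p <- l) p.1 * kgrad i (sval p.2) y.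
Definition span_hess l (i j : nat) (y : R3 R) : R :=
  \sum_(p <- l) p.1 * khess i j (sval p.2) y.

Lemma comb_tgradE l i y : ecball r y -> comb tgrad l i y = span_grad l i y.
Proof. by move=> yr; apply: eq_bigr => p _; rewrite tgradE. Qed.

Lemma comb_tgrad0 l i y : ~ ecball r y -> comb tgrad l i y = 0.
Proof. by move=> yr; rewrite /comb big1// => p _; rewrite tgrad0// mulr0. Qed.

Lemma regular_sum l (f : exterior -> R3 R -> R) : (forall t, regular (ecball r) (f t)) ->
  regular (ecball r) (fun y => \sum_(p <- l) p.1 * f p.2 y).
Proof.
move=> rf; elim: l => [|p l IH].
  by under eq_fun do rewrite big_nil; exact: regular_cst.
under eq_fun do rewrite big_cons.
by apply: regularD; [apply: regularM; [exact: regular_cst|exact: rf]|exact: IH].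
Qed.

Lemma regular_span_grad l i : regular (ecball r) (span_grad l i).
Proof.
apply: (@regular_sum l (fun t => kgrad i (sval t))) => t.
apply: Regular; first exact: measurable_kgrad.
by move=> z zr; apply: kgrad_continuous; exact: exterior_neq.
Qed.

Lemma regular_span_hess l i j : regular (ecball r) (span_hess l i j).
Proof.
apply: (@regular_sum l (fun t => khess i j (sval t))) => t.
apply: Regular; first exact: measurable_khess.
by move=> z zr; apply: khess_continuous; exact: exterior_neq.
Qed.

Lemma is_derive_span_grad l i (a b c : R -> R) (s a' b' c' : R) : (i < 3)%N ->
  ecball r (a s, b s, c s) ->
  is_derive s 1 a a' -> is_derive s 1 b b' -> is_derive s 1 c c' ->
  is_derive s 1 (fun s => span_grad l i (a s, b s, c s))
    (span_hess l i 0 (a s, b s, c s) * a' + span_hess l i 1 (a s, b s, c s) * b'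
     + span_hess l i 2 (a s, b s, c s) * c').
Proof.
move=> i3 sr da db dc; rewrite /span_grad /span_hess; elim: l => [|p l IH].
  under eq_fun do rewrite big_nil.
  by rewrite !big_nil !mul0r !addr0; exact: is_derive_cst.
under eq_fun do rewrite big_cons.
rewrite !big_cons.
have dk := is_derive_kgrad i3 (exterior_neq p.2 sr) da db dc.
have dp : is_derive s (1 : R) (fun _ : R => p.1) 0 by exact: is_derive_cst.
have := is_deriveD (is_deriveM dp dk) IH.
rewrite /GRing.scale/= => d; apply: is_derive_eq; ring.
Qed.

(** The truncated combinations are not differentiable across the sphere, so the inequality is
    applied to the untruncated [span_grad], which has the same values on the closed ball. *)
Lemma rellich_span l :
  (inner (lebesgue3 R) (comb tgrad l) (comb tgrad l) <=
   r * inner (surface r) (comb tgrad l) (comb tgrad l)).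
Proof.
pose n2 y := span_grad l 0 y * span_grad l 0 y + span_grad l 1 y * span_grad l 1 y
  + span_grad l 2 y * span_grad l 2 y.
pose N y := comb tgrad l 0 y * comb tgrad l 0 y + comb tgrad l 1 y * comb tgrad l 1 y
  + comb tgrad l 2%:R y * comb tgrad l 2%:R y.
have NE y : ecball r y -> N y = n2 y by move=> yr; rewrite /N !comb_tgradE.
have N0 y : ~ ecball r y -> N y = 0 by move=> yr; rewrite /N !comb_tgrad0// mulr0 !addr0.
have N_ge0 y : 0 <= N y by rewrite /N -!expr2 !addr_ge0// sqr_ge0.
have mc i : measurable_fun setT (comb tgrad l i).
  rewrite /comb; elim: (l) => [|p l' IH].
    by under eq_fun do rewrite big_nil; exact: measurable_cst.
  under eq_fun do rewrite big_cons.
  by apply: measurable_funD => //; apply: measurable_funM => //; exact: measurable_tgrad.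
have mN : measurable_fun setT N.
  by apply: measurable_funD; [apply: measurable_funD|]; exact: measurable_funM.
have B3 i : comb tgrad l i \in Lfun (lebesgue3 R) 2%:E.
  apply: Lfun2_comb => t j; apply: Lfun2_tgrad; exact: lebesgue_ecball_lty.
have BS i : comb tgrad l i \in Lfun (surface r) 2%:E.
  apply: Lfun2_comb => t j; apply: Lfun2_tgrad; apply: le_lt_trans (surface_lty r).
  by apply: le_measure; rewrite ?inE//; exact: measurable_ecball.
have e3 : (\int[lebesgue3 R]_y (N y)%:E = \int[lebesgue3 R]_(y in ecball r) (n2 y)%:E)%E.
  rewrite [RHS]integral_mkcond; apply: eq_integral => y _; rewrite patchE.
  by case: ifPn => [/set_mem /NE ->//|/negP yr]; rewrite N0// => h; apply: yr; exact/mem_set.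
have eS : (\int[surface r]_y (N y)%:E =
    \int[lebesgue2 R]_(z in angles) (n2 (spherical r z) * (r ^+ 2 * sin z.1))%:E)%E.
  have := @ge0_integral_surface R r (fun y => (N y)%:E); move=> ->.
  - apply: eq_integral => z _; rewrite NE ?EFinM//.
    by rewrite /ecball /= enorm_spherical ger0_norm// ltW.
  - exact/measurable_EFinP.
  - by move=> y; rewrite lee_fin.
rewrite -lee_fin EFinM.
have E3 := etrans (EFin_inner B3) e3; have ES := etrans (EFin_inner BS) eS.
rewrite [X in (X <= _)%E]E3 [X in (_ <= _ * X)%E]ES.
apply: (@rellich_inequality R r (span_grad l) (span_hess l)) => //.
- by move=> i; exact: regular_measurable (regular_span_grad l i).
- by move=> i j; exact: regular_measurable (regular_span_hess l i j).
- by move=> i x; exact: regular_continuous (regular_span_grad l i).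
- by move=> i j x; exact: regular_continuous (regular_span_hess l i j).
- by move=> i j x; apply: eq_bigr => p _; rewrite khessC.
- move=> x xr; rewrite /span_hess -!big_split big1//= => p _.
  by rewrite -!mulrDr khess_trace ?mulr0//; exact: exterior_neq.
- exact: is_derive_span_grad.
Qed.

End tgrad_span.

Section balayage.
Context {R : realType} (r : R).
Hypothesis r0 : 0 < r.

Lemma surface_density (U : 'I_3 -> mR3 R -> R) : (forall i, U i \in Lfun (lebesgue3 R) 2%:E) ->
  exists m : 'I_3 -> mR3 R -> R, (forall i, m i \in Lfun (surface r) 2%:E) /\
    forall t, inner (surface r) m (@tgrad R r t) = inner (lebesgue3 R) U (@tgrad R r t).
Proof.
move=> U2; set P := inner (lebesgue3 R) U U.
have P0 : 0 <= P by exact: inner_ge0.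
have B3 t i : @tgrad R r t i \in Lfun (lebesgue3 R) 2%:E.
  by apply: Lfun2_tgrad => //; exact: lebesgue_ecball_lty.
have BS t i : @tgrad R r t i \in Lfun (surface r) 2%:E.
  apply: Lfun2_tgrad => //; apply: le_lt_trans (surface_lty r).
  by apply: le_measure; rewrite ?inE//; exact: measurable_ecball.
(* 4 (P + 1) comes from [inner_sqr_le] in the ball, and r from the passage to the sphere. *)
have C0 : 0 <= 4 * (P + 1) * r by rewrite !mulr_ge0 ?ltW// ltr_wpDl.
apply: (@riesz_representation _ _ R (surface r) (exterior r) 3 (@tgrad R r)
  (fun t => inner (lebesgue3 R) U (@tgrad R r t)) _ BS C0) => l.
have -> : lin (fun t => inner (lebesgue3 R) U (@tgrad R r t)) l =
    inner (lebesgue3 R) U (comb (@tgrad R r) l).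
  rewrite [RHS]innerC (inner_comb B3 l U2).
  by apply: eq_bigr => p _; rewrite innerC.
apply: (le_trans (inner_sqr_le U2 (Lfun2_comb B3 l))).
rewrite -/P -[leRHS]mulrA; apply: ler_wpM2l; first by rewrite mulr_ge0// addr_ge0.
exact: rellich_span.
Qed.

Section field.
Context (nu : {measure set (mR3 R) -> \bar R}) (F : R3 R -> R3 R) (A : set (R3 R)).
Hypotheses (nur : (nu (ecball r) < +oo)%E) (F2 : forall i, (fun y : mR3 R => crd i (F y)) \in Lfun nu 2%:E)
  (cA : closed A) (Ar : A `<=` ecball r) (F0 : forall y, ~ A y -> F y = 0).

Let crd0 i : crd i (0 : R3 R) = 0.
Proof. by case: i => [|[|i]]. Qed.

Lemma integrable_crd_field i : nu.-integrable setT (EFin \o (fun y : mR3 R => crd i (F y))).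
Proof.
have i2 : (\1_(ecball r) : mR3 R -> R) \in Lfun nu 2%:E.
  apply: (@Lfun2_bounded _ _ _ nu (ecball r) _ 1) => //.
  - exact: measurable_ecball.
  - by apply: measurable_indic; exact: measurable_ecball.
  - by move=> y yr; rewrite indicE memNset.
  - by move=> y; rewrite indicE; case: (_ \in _); rewrite ?normr1 ?normr0.
have := integrable_mul (F2 i) i2.
rewrite (_ : (fun y => _ * _) = fun y : mR3 R => crd i (F y))//.
apply/funext => y; rewrite indicE; have [yr|yr] := boolP (y \in ecball r); first by rewrite mulr1.
have nA : ~ A y by move=> /Ar /mem_set; apply/negP.
by rewrite (F0 nA) crd0 mulr0.
Qed.

(** Both potentials become inner products with the same family [tgrad], which is the identity
    delivered by [surface_density]. *)
Lemma field_potential (t : exterior r) : potential (div_form nu F) (sval t) =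
  (4 * pi)^-1 * inner nu (fun (i : 'I_3) y => crd i (F y)) (@tgrad R r t).
Proof.
rewrite (div_form_potential integrable_crd_field cA F0 r0 Ar (svalP t)); congr (_ * _).
have K2 i : @tgrad R r t i \in Lfun nu 2%:E by exact: Lfun2_tgrad.
have i2 i (j : 'I_3) := integrable_mul (F2 i) (K2 j).
rewrite /inner 3!big_ord_recl big_ord0 addr0 addrA.
have -> : \int[nu]_y (crd 0 (F y) * kgrad 0 (sval t) y + crd 1 (F y) * kgrad 1 (sval t) y
    + crd 2 (F y) * kgrad 2 (sval t) y) =
  \int[nu]_y (crd 0 (F y) * tgrad t 0 y + crd 1 (F y) * tgrad t 1 y
    + crd 2 (F y) * tgrad t 2%:R y).
  apply: eq_Rintegral => y _; have [yr|yr] := pselect (ecball r y); first by rewrite !tgradE.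
  have nA : ~ A y by move=> /Ar.
  by rewrite (F0 nA) !crd0 !mul0r.
rewrite (Rintegral_add3 (i2 0%N 0) (i2 1%N 1) (i2 2%N 2%:R)).
by congr (_ + _ + _); apply: eq_Rintegral => y _; congr (_ * tgrad _ _ _); exact/val_inj.
Qed.

End field.

(** Every point of the parametrization has norm r, so the preimage of the complement is empty. *)
Lemma esphere_ae : {ae surface r, forall y, esphere r y}.
Proof.
exists (~` esphere r); split => //.
  by apply: measurableC; exact: measurable_esphere.
rewrite /= /surface (_ : _ `&` _ = set0) ?integral_set0//.
apply/seteqP; split => // t [_ /=]; apply.
by rewrite /esphere /= enorm_spherical ger0_norm// ltW.
Qed.

Lemma Lfun2_restrict (nu : {measure set (mR3 R) -> \bar R}) (E : set (mR3 R)) (f : mR3 R -> R) :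
  measurable E -> f \in Lfun nu 2%:E -> f \_ E \in Lfun nu 2%:E.
Proof.
move=> mE /Lfun2P[mf f2]; apply/Lfun2P.
have mfE : measurable_fun setT (f \_ E).
  by apply/(measurable_restrictT _ mE); exact: measurable_funTS.
split => //; apply: le_lt_trans f2; apply: ge0_le_integral => //.
- by move=> y _; rewrite lee_fin sqr_ge0.
- by apply/measurable_EFinP; exact: measurable_funX.
- by apply/measurable_EFinP; exact: measurable_funX.
- by move=> y _; rewrite lee_fin patchE; case: ifP => // _; rewrite expr0n sqr_ge0.
Qed.

End balayage.

Section ball_sphere.
Context {R : realType} (r : R).

Lemma ecball_closed : closed (ecball r).
Proof.
apply: (@closed_comp _ _ (@enorm R) [set x | x <= r]); last exact: closed_le.
by move=> x _; exact: enorm_continuous.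
Qed.

Lemma esphere_closed : closed (esphere r).
Proof.
apply: (@closed_comp _ _ (@enorm R) [set x | x = r]); last exact: closed_eq.
by move=> x _; exact: enorm_continuous.
Qed.

Lemma Lfun2_crd (nu : {measure set (mR3 R) -> \bar R}) (F : R3 R -> R3 R) (i : nat) :
  L2_field nu F -> (fun y : mR3 R => crd i (F y)) \in Lfun nu 2%:E.
Proof. by move=> F2; case: i => [|[|i]]; [exact: (F2 0)|exact: (F2 1)|exact: (F2 2%:R)]. Qed.

Lemma dot0l (z : R3 R) : dot 0 z = 0.
Proof.
rewrite /dot big1// => i _; rewrite coord3E (_ : crd i 0 = 0) ?mul0r//.
by case: i => -[|[|[|]]].
Qed.

Lemma sphere_distributionE (m : R3 R -> R3 R) :
  divergence (sphere_distribution r m) = div_form (surface r) (m \_ (esphere r)).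
Proof.
apply/funext => phi; congr (- fine _); rewrite [LHS]integral_mkcond.
apply: eq_integral => y _; rewrite !patchE; case: ifPn => // _.
exact: (congr1 EFin (esym (dot0l _))).
Qed.

Lemma inner_restrict_esphere (r0 : 0 < r) (m k : 'I_3 -> mR3 R -> R) :
  (forall i, m i \in Lfun (surface r) 2%:E) -> (forall i, k i \in Lfun (surface r) 2%:E) ->
  inner (surface r) (fun i => m i \_ (esphere r)) k = inner (surface r) m k.
Proof.
move=> m2 k2; apply: eq_bigr => i _; congr fine.
have i1 := integrable_mul (Lfun2_restrict (measurable_esphere r) (m2 i)) (k2 i).
have i2 := integrable_mul (m2 i) (k2 i).
apply: ae_eq_integral.
- exact: measurableT.
- by have /integrableP[] := i1.
- by have /integrableP[] := i2.
have [N [mN N0 sN]] := esphere_ae r0; exists N; split => // y /= h; apply: sN => /= yr.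
by apply: h => _; rewrite patchE mem_set.
Qed.

End ball_sphere.

Theorem lemma3p2 (R : realType) (r : R) (r_gt0 : 0 < r)
  (M : R3 R -> R3 R)
  (M_L2 : L2_field (lebesgue3 R) M)
  (M_ext0 : forall x, ~ eball r x -> M x = 0)
  (M_hardy : hardy_bounded r M) :
  exists m : R3 R -> R3 R,
    L2_field (surface r) m /\
    is_balayage r (divergence (field_distribution M))
                  (divergence (sphere_distribution r m)).
Proof.
have M2 i := Lfun2_crd i M_L2.
have M0 y : ~ ecball r y -> M y = 0.
  by move=> yr; apply: M_ext0 => yb; apply: yr; exact: ltW.
have [m [m2 mE]] := surface_density r_gt0 (fun i : 'I_3 => M2 i).
pose mv (y : R3 R) : R3 R := (m 0 y, m 1 y, m 2%:R y).
have mvE (i : 'I_3) y : crd i (mv y) = m i y.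
  by case: i => -[|[|[|//]]] ? /=; congr (m _ y); exact/val_inj.
have mv2 : L2_field (surface r) mv.
  move=> i; rewrite (_ : (fun y => _) = m i)//.
  by apply/funext => y; rewrite coord3E mvE.
exists mv; split; first exact: mv2.
rewrite [X in is_balayage _ _ X]sphere_distributionE.
(* The density is defined on the whole space and fixed only up to null sets. Its restriction to the
   sphere gives the same functional, and it makes the support condition hold at every point. *)
set F := mv \_ (esphere r).
have FE (i : nat) : (fun y : mR3 R => crd i (F y)) = (fun y : mR3 R => crd i (mv y)) \_ (esphere r).
  by apply/funext => y; rewrite /F !patchE; case: ifP => // _; case: i => [|[|]].
have F2 i : (fun y : mR3 R => crd i (F y)) \in Lfun (surface r) 2%:E.
  by rewrite FE; apply: Lfun2_restrict (measurable_esphere r) _; exact: Lfun2_crd.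
have F0 y : ~ esphere r y -> F y = 0 by move=> yr; rewrite /F patchE memNset.
have sb : esphere r `<=` ecball r by move=> y; rewrite /esphere /ecball /= => ->.
have noo := lebesgue_ecball_lty r_gt0.
have soo : (surface r (ecball r) < +oo)%E.
  apply: le_lt_trans (surface_lty r).
  by apply: le_measure; rewrite ?inE//; exact: measurable_ecball.
have iM := integrable_crd_field noo M2 (@subset_refl _ _) M0.
have iF := integrable_crd_field soo F2 sb F0.
have cb := @ecball_closed R r; have cs := @esphere_closed R r.
split.
- by split; [exact: (div_form_distribution iM)|exact: (div_form_supp cb M0)].
- by split; [exact: (div_form_distribution iF)|exact: (div_form_supp cs F0)].
move=> x /negP; rewrite -ltNge => rx.
pose t : exterior r := exist _ x rx.
have PM := field_potential r_gt0 noo M2 cb (@subset_refl _ _) M0 t.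
have PF := field_potential r_gt0 soo F2 cs sb F0 t.
apply: (etrans PF); apply: (etrans _ (esym PM)); congr (_ * _); rewrite -mE.
have K2 i : tgrad t i \in Lfun (surface r) 2%:E by exact: Lfun2_tgrad.
rewrite -(inner_restrict_esphere r_gt0 m2 K2); congr (inner _ _ _).
apply/funext => i; rewrite FE; congr (_ \_ _).
by apply/funext => y; exact: mvE.
Qed.
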